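(* Let $F\colon(\mathbb{C}^{n}\times\mathbb{C},0)\to(\mathbb{C}^{m},0)$, $F=F(x,t)=F_t(x)$, be (the germ of) a holomorphic map. Assume that for all $t$ (in a neighbourhood of $0\in\mathbb{C}$) the ideal $(F_t)\mathcal{O}_n$ is an $\mathfrak{m}_n$-primary ideal of $\mathcal{O}_n$. Then there exists a complex linear map $\pi\colon\mathbb{C}^{m}\to\mathbb{C}^{n}$, independent of $t$, such that for all $t$ (sufficiently close to $0$) the ideal $(\pi\circ F_t)\mathcal{O}_n$ is a reduction of $(F_t)\mathcal{O}_n$.
   Context: $(\mathcal{O}_n,\mathfrak{m}_n)$ is the local ring of germs at $0$ of holomorphic functions $\mathbb{C}^n\to\mathbb{C}$. For a fixed $t$ near $0$, $F_t$ is the germ at $0\in\mathbb{C}^n$ of $x\mapsto F(x,t)$, and $(F_t)\mathcal{O}_n$ is the ideal of $\mathcal{O}_n$ generated by the components of $F_t$; similarly for $\pi\circ F_t$. An ideal $J$ of a ring $R$ is a reduction of an ideal $I$ if $J\subset I$ and $I^{r+1}=JI^{r}$ for some integer $r>0$. *)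

(* Defs.v *)
From HB Require Import structures.
From mathcomp Require Import all_boot all_order all_algebra.
From mathcomp Require Import ring_quotient complex.
From mathcomp Require Import all_classical all_reals all_analysis.

Set Implicit Arguments.
Unset Strict Implicit.
Unset Printing Implicit Defensive.
Import Order.TTheory GRing.Theory Num.Theory.
Import numFieldNormedType.Exports.
Local Open Scope classical_set_scope.
Local Open Scope ring_scope.

Section Ideals.
Variable A : comNzRingType.
Implicit Types I J M : set A.

Definition is_ideal I : Prop :=
  [/\ I 0, (forall x y, I x -> I y -> I (x + y))
    & (forall a x, I x -> I (a * x))].

Definition ideal_gen (G : set A) : set A := smallest is_ideal G.

Definition ideal_mul I J : set A :=
  ideal_gen [set x * y | x in I & y in J].

Fixpoint ideal_exp I (k : nat) : set A :=
  if k is k'.+1 then ideal_mul I (ideal_exp I k') else [set: A].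

Definition radical I : set A := [set x | exists k : nat, I (x ^+ k)].

Definition primary I : Prop :=
  [/\ is_ideal I, ~ I 1
    & forall x y, I (x * y) -> I x \/ exists k : nat, I (y ^+ k)].

Definition primary_to M I : Prop := primary I /\ radical I = M.

Definition reduction J I : Prop :=
  J `<=` I /\
  exists r : nat, (0 < r)%N /\ ideal_exp I r.+1 = ideal_mul J (ideal_exp I r).

End Ideals.

(* The topology of R[i] is given by the complex modulus, and [differentiable]
   is then complex (Frechet) differentiability between R[i]-normed spaces. *)
HB.instance Definition _ (R : rcfType) := NormedModule.copy R[i] R[i]^o.

Definition holomorphic_near0 (R : realType) (V W : normedModType R[i])
    (f : V -> W) : Prop :=
  \forall x \near (0 : V), differentiable f x.

Section GermRing.
Variables (R : realType) (n : nat).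
Local Notation C := R[i].

Definition holo : {pred 'rV[C]_n -> C} := fun f => `[< holomorphic_near0 f >].

Lemma holo_subring : subring_closed holo.
Proof.
split=> [|f g /asboolP hf /asboolP hg|f g /asboolP hf /asboolP hg];
    apply/asboolP; near=> x.
- exact: differentiable_cst.
- by apply: differentiableB; [near: x; exact: hf|near: x; exact: hg].
- by apply: differentiableM; [near: x; exact: hf|near: x; exact: hg].
Unshelve. all: by end_near. Qed.

HB.instance Definition _ :=
  GRing.isSubringClosed.Build ('rV[C]_n -> C) holo holo_subring.

Record holo_fun := HoloFun {
  holo_val :> 'rV[C]_n -> C;
  holo_valP : holo_val \in holo }.

HB.instance Definition _ := [isSub for holo_val].
HB.instance Definition _ := [Choice of holo_fun by <:].
HB.instance Definition _ := [SubChoice_isSubComNzRing of holo_fun by <:].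

Definition null_germ : {pred holo_fun} :=
  fun f => `[< \forall x \near (0 : 'rV[C]_n), f x = 0 >].

Lemma null_germ_ideal : idealr_closed null_germ.
Proof.
split.
- by apply/asboolP; near=> x.
- by apply/asboolP => /nbhs_singleton /eqP; rewrite oner_eq0.
- move=> a f g /asboolP hf /asboolP hg; apply/asboolP.
  apply: filterS2 hf hg => x fx0 gx0.
  have -> : (a * f + g) x = a x * f x + g x by [].
  by rewrite fx0 gx0 mulr0 addr0.
Unshelve. all: by end_near. Qed.

HB.instance Definition _ := isIdealr.Build holo_fun null_germ null_germ_ideal.

Definition holo_germ : Type := Quotient.quot null_germ.

HB.instance Definition _ := GRing.ComNzRing.on holo_germ.

(* The germ at 0 of [f]; the junk value is 0 when [f] is not holomorphic near 0. *)
Definition germ (f : 'rV[C]_n -> C) : holo_germ :=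
  \pi_(Quotient.quot null_germ)%qT (insubd (0 : holo_fun) f).

Lemma germ_eqP f g : holomorphic_near0 f -> holomorphic_near0 g ->
  germ f = germ g <-> \forall x \near (0 : 'rV[C]_n), f x = g x.
Proof.
move=> /asboolP hf /asboolP hg.
have sub_val x : (insubd (0 : holo_fun) f - insubd (0 : holo_fun) g) x
    = f x - g x.
  have -> : (insubd (0 : holo_fun) f - insubd (0 : holo_fun) g) x
    = val (insubd (0 : holo_fun) f) x - val (insubd (0 : holo_fun) g) x by [].
  by rewrite !insubdK.
split=> [/eqP|fg].
  rewrite -Quotient.idealrBE => /asboolP; apply: filterS => x.
  by rewrite sub_val => /eqP; rewrite subr_eq0 => /eqP.
apply/eqP; rewrite -Quotient.idealrBE; apply/asboolP.
by apply: filterS fg => x; rewrite sub_val => ->; rewrite subrr.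
Qed.

Definition maximal_ideal : set holo_germ :=
  [set germ f | f in [set f | holomorphic_near0 f /\ f 0 = 0]].

Definition component_ideal k (f : 'rV[C]_n -> 'rV[C]_k) : set holo_germ :=
  ideal_gen (range (fun i : 'I_k => germ (fun x => f x 0 i))).

End GermRing.

Arguments maximal_ideal R n : clear implicits.

(* Main.v *)
Require Import Defs.
From HB Require Import structures.
From mathcomp Require Import all_boot all_order all_algebra complex ring lra.
From mathcomp Require Import all_classical all_reals all_analysis.

(** Generators are removed one at a time, by a Noether normalization of the fibre
    cone that is uniform in [t].  Let [g_0, ..., g_m] with [m >= n] generate [I_t],
    and let [M] be the maximal ideal.  The quotients of the ring of germs by [I_t]
    have bounded length near [t = 0], so some [x_i^s] lie in [I_t] for all small
    [t].  There are more monomials in [g] of bounded degree than jets modulo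
    [(x_i^N)], whence a linear relation between these monomials modulo [(x_i^N)],
    whose coefficients are holomorphic in [t].  Its part of lowest degree [j] is a
    nonzero form [Q_t] with [Q_t(g) \in M I_t^j], and dividing by a power of [t]
    makes [Q_t] converge to a nonzero form as [t -> 0].  At [t = 0] itself the same
    argument applies to the constant family.  For a vector [c] at which both forms
    do not vanish, the combinations [c_0 g_i - c_i g_0] generate an ideal [J_t] with
    [g_0^j \in J_t I_t^(j-1) + M I_t^j], and Nakayama's lemma makes [J_t] a
    reduction of [I_t].

    Holomorphic here means complex differentiable, so the expansions in [x] with
    coefficients holomorphic in [t] rest on Cauchy's formula, which is obtained
    from Goursat's bisection argument. *)

Set Implicit Arguments.
Unset Strict Implicit.
Unset Printing Implicit Defensive.
Import Order.TTheory GRing.Theory Num.Theory.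
Import numFieldNormedType.Exports.
Local Open Scope classical_set_scope.
Local Open Scope ring_scope.
Local Open Scope complex_scope.


(** The vector [c] must not depend on [t], whereas the coefficients of [Q_t] may all vanish at
    [t = 0]. Dividing the part of degree [j] by the least power of [t] occurring in its coefficients
    leaves a nonzero limit form, and a [c] off its zero locus serves every small [t != 0]. The terms
    of higher degree and the remainder modulo [(x_i^N)] need not be divisible by that power of [t],
    so the limit form need not satisfy a relation at [t = 0]; this is why the constant family is
    treated as well. A uniform [N] matters because the jets are counted before [t] is fixed; it
    rests on a spanning set of the quotient at [t = 0] that still spans, modulo a power of the
    variables, for small [t], followed by Nakayama's lemma. The vector [c] is sought on the curve
    [c_i = y^(B^i)] (Kronecker's substitution): for exponents smaller than [B], distinct monomials
    become distinct powers of [y], so both nonvanishing conditions concern polynomials in one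
    variable. *)

(** * Real-valued norms and the epsilon form of differentiability *)

Section RealNorm.
Variable R : realType.
Local Notation C := R[i].

(* Norms over [R[i]] are [R[i]]-valued; [nr] is the same norm with values in [R]. *)
Definition nr (V : normedModType C) (v : V) : R := complex.Re `|v|.

Section Basics.
Variable V : normedModType C.
Implicit Types (v w : V) (a : C).

Lemma nrE v : `|v| = (nr v)%:C.
Proof. by rewrite /nr RRe_real ?normr_real. Qed.

Lemma nr_ge0 v : 0 <= nr v.
Proof. by rewrite -lecR -nrE; exact: normr_ge0. Qed.

Lemma nr0 : nr (0 : V) = 0.
Proof. by rewrite /nr normr0. Qed.

Lemma nrN v : nr (- v) = nr v.
Proof. by rewrite /nr normrN. Qed.

Lemma nr_distC v w : nr (v - w) = nr (w - v).
Proof. by rewrite /nr distrC. Qed.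

Lemma ler_nrD v w : nr (v + w) <= nr v + nr w.
Proof. by rewrite -lecR rmorphD/= -!nrE ler_normD. Qed.

Lemma ler_nrB v w : nr (v - w) <= nr v + nr w.
Proof. by rewrite -(nrN w) ler_nrD. Qed.

Lemma ler_nr_distD u v w : nr (v - w) <= nr (v - u) + nr (u - w).
Proof. by rewrite (le_trans _ (ler_nrD _ _))// addrA subrK. Qed.

Lemma nr_eq0 v : (nr v == 0) = (v == 0).
Proof. by rewrite -(normr_eq0 v) nrE -(inj_eq (@complexI R)). Qed.

Lemma nr_gt0 v : (0 < nr v) = (v != 0).
Proof. by rewrite lt_def nr_eq0 nr_ge0 andbT. Qed.

Lemma nrZ a v : nr (a *: v) = nr (a : C) * nr v.
Proof. by apply: complexI; rewrite rmorphM/= -!nrE normrZ. Qed.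

(** A positive element of [R[i]] is real, so radii can be taken in [R], where the order is total and
    linear arithmetic applies. *)
Lemma nbhs_nrP v (P : V -> Prop) :
  (\forall x \near v, P x) <->
  exists2 d : R, 0 < d & forall x, nr (x - v) < d -> P x.
Proof.
split.
- move=> /nbhs_ballP[e /= e0 h].
  have eE : e = (complex.Re e)%:C by rewrite RRe_real// gtr0_real.
  exists (complex.Re e); first by rewrite -ltcR -eE.
  by move=> x xd; apply: h; rewrite -ball_normE/= nrE nr_distC eE ltcR.
- move=> [d d0 h]; apply/nbhs_ballP; exists d%:C; first by rewrite /= ltcR.
  by move=> x; rewrite -ball_normE/= nrE nr_distC ltcR => /h.
Qed.

End Basics.

Lemma nrM (a b : C) : nr (a * b) = nr a * nr b.
Proof. exact: (nrZ a (b : C)). Qed.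

Lemma nr1 : nr (1 : C) = 1.
Proof. by rewrite /nr normr1. Qed.

Lemma nrX (a : C) k : nr (a ^+ k) = nr a ^+ k.
Proof. by elim: k => [|k ih]; rewrite ?expr0 ?nr1// !exprS nrM ih. Qed.

Lemma nrV (a : C) : nr a^-1 = (nr a)^-1.
Proof. by apply: complexI; rewrite fmorphV/= -!nrE normfV. Qed.

Lemma nr_real (r : R) : nr (r%:C) = `|r|.
Proof. by rewrite /nr normc_def/= expr0n/= addr0 sqrtr_sqr. Qed.

Lemma ler_abs_Re (z : C) : `|complex.Re z| <= nr z.
Proof.
rewrite /nr normc_def/= -sqrtr_sqr ler_wsqrtr// lerDl sqr_ge0//.
Qed.

Lemma ler_abs_Im (z : C) : `|complex.Im z| <= nr z.
Proof. by rewrite /nr normc_def/= -sqrtr_sqr ler_wsqrtr// lerDr sqr_ge0. Qed.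

Lemma ler_nr_ReIm (z : C) : nr z <= `|complex.Re z| + `|complex.Im z|.
Proof.
rewrite [z in nr z]complexE (le_trans (ler_nrD _ _))// nr_real lerD2l.
by rewrite nrM nr_real {1}/nr normc_def/= expr0n expr1n/= add0r sqrtr1 mul1r.
Qed.

Section Differentiable.
Variables V W : normedModType C.

Lemma differentiable_eps (f : V -> W) z : differentiable f z ->
  forall e : R, 0 < e -> exists2 d : R, 0 < d &
   forall v, nr v < d -> nr (f (z + v) - f z - 'd f z v) <= e * nr v.
Proof.
move=> /diff_locally /eqaddoP h e e0.
have e0' : 0 < e%:C by rewrite ltcR.
have /nbhs_nrP[d d0 hd] := h _ e0'.
exists d => // v vd; have := hd v; rewrite subr0 => /(_ vd).
rewrite !fctE /= !nrE -rmorphM lecR /=.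
by rewrite (addrC v z) opprD addrA.
Qed.

(** Uniqueness of the differential identifies ['d f z] with the candidate [L], so exhibiting a
    first-order expansion suffices. *)
Lemma eps_differentiable (f : V -> W) z (L : {linear V -> W}) : continuous L ->
  (forall e : R, 0 < e -> exists2 d : R, 0 < d &
   forall v, nr v < d -> nr (f (z + v) - f z - L v) <= e * nr v) ->
  differentiable f z.
Proof.
move=> cL h.
have hL : f \o shift z = cst (f z) + L +o_ 0 id.
  apply/eqaddoP => e e0.
  have eE : e = (complex.Re e)%:C by rewrite RRe_real// gtr0_real.
  have [|d d0 hd] := h (complex.Re e); first by rewrite -ltcR -eE.
  apply/nbhs_nrP; exists d => // v; rewrite subr0 => /hd hv.
  rewrite !fctE /= !nrE [X in X * _]eE -rmorphM lecR /=.
  by rewrite (addrC v z) opprD addrA.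
have dE := diff_unique cL hL.
apply/diff_locallyP; split; first by (rewrite dE; exact: cL).
by rewrite [LHS]hL; congr (_ + _ + _); rewrite dE.
Qed.

Lemma linear_nr_continuous (L : {linear V -> W}) (k : R) :
  (forall v, nr (L v) <= k * nr v) -> continuous L.
Proof.
move=> Lk z; apply/cvgrPdist_lt => e e0.
have eE : e = (complex.Re e)%:C by rewrite RRe_real// gtr0_real.
have e0' : 0 < complex.Re e by rewrite -ltcR -eE.
have k1 : 0 < `|k| + 1 by rewrite ltr_wpDl.
apply/nbhs_nrP; exists (complex.Re e / (`|k| + 1)); first by rewrite divr_gt0.
move=> x xd; rewrite -linearB nrE eE ltcR (le_lt_trans (Lk _))// nr_distC.
rewrite (@le_lt_trans _ _ ((`|k| + 1) * nr (x - z)))//.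
  by rewrite ler_wpM2r ?nr_ge0// (le_trans (ler_norm _))// lerDl.
by rewrite mulrC -ltr_pdivlMr.
Qed.

Lemma continuous_nrP (f : V -> W) z : {for z, continuous f} <->
  (forall e : R, 0 < e -> exists2 d : R, 0 < d &
   forall w, nr (w - z) < d -> nr (f w - f z) < e).
Proof.
split=> [cf e e0|h].
  have e0' : 0 < e%:C by rewrite ltcR.
  have /cvgrPdist_lt/(_ _ e0')/nbhs_nrP[d d0 hd] := cf.
  by exists d => // w /hd; rewrite nrE ltcR nr_distC.
apply/cvgrPdist_lt => e e0.
have eE : e = (complex.Re e)%:C by rewrite RRe_real// gtr0_real.
have [|d d0 hd] := h (complex.Re e); first by rewrite -ltcR -eE.
by apply/nbhs_nrP; exists d => // w /hd; rewrite nrE eE ltcR nr_distC.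
Qed.

End Differentiable.
End RealNorm.

(** * Integrals of continuous real functions over segments *)

Section RealIntegral.
Variable R : realType.
Implicit Types (g h : R -> R) (a b c : R).

Definition rint g a b : R := (\int[lebesgue_measure]_(x in `[a, b]) g x)%R.

Lemma continuous_integrable_itv g a b : continuous g ->
  lebesgue_measure.-integrable `[a, b] (EFin \o g).
Proof.
move=> cg; apply: continuous_compact_integrable; first exact: segment_compact.
exact: continuous_subspaceT.
Qed.
Local Hint Resolve continuous_integrable_itv : core.

Lemma rintD g h a b : continuous g -> continuous h ->
  rint (fun x => g x + h x) a b = rint g a b + rint h a b.
Proof. by move=> cg ch; rewrite /rint RintegralD//; apply: continuous_integrable_itv. Qed.

Lemma rintB g h a b : continuous g -> continuous h ->
  rint (fun x => g x - h x) a b = rint g a b - rint h a b.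
Proof. by move=> cg ch; rewrite /rint RintegralB//; apply: continuous_integrable_itv. Qed.

Lemma rintZ k g a b : continuous g ->
  rint (fun x => k * g x) a b = k * rint g a b.
Proof. by move=> cg; rewrite /rint RintegralZl//; apply: continuous_integrable_itv. Qed.

Lemma eq_rint g h a b : (forall x, a <= x <= b -> g x = h x) ->
  rint g a b = rint h a b.
Proof.
by move=> gh; apply: eq_Rintegral => x; rewrite inE/= in_itv/= => /gh.
Qed.

Lemma rint_cst (k a b : R) : a <= b -> rint (fun=> k) a b = k * (b - a).
Proof.
move=> ab; rewrite /rint Rintegral_cst//= lebesgue_measure_itv/= lte_fin.
by case: ltP => [//|ba]; rewrite (le_anti (introT andP (conj ab ba))) subrr.
Qed.

Lemma ler_rint g h a b : continuous g -> continuous h ->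
  (forall x, a <= x <= b -> g x <= h x) -> rint g a b <= rint h a b.
Proof.
move=> cg ch gh; apply: le_Rintegral => //; exact: continuous_integrable_itv.
Qed.

Lemma rint_norm_le (M : R) g a b : a <= b -> continuous g ->
  (forall x, a <= x <= b -> `|g x| <= M) -> `|rint g a b| <= M * (b - a).
Proof.
move=> ab cg gM; rewrite ler_norml; apply/andP; split.
  rewrite -mulNr -rint_cst//; apply: ler_rint => //; first by move=> ?; exact: cvg_cst.
  by move=> x /gM; rewrite ler_norml => /andP[].
rewrite -rint_cst//; apply: ler_rint => //; first by move=> ?; exact: cvg_cst.
by move=> x /gM; rewrite ler_norml => /andP[].
Qed.

Lemma rint_split g a b c : a <= b -> b <= c -> continuous g ->
  rint g a c = rint g a b + rint g b c.
Proof.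
move=> ab bc cg; apply/eqP; rewrite addrC -subr_eq; apply/eqP.
rewrite /rint Rintegral_itvB ?bnd_simp//; last exact: continuous_integrable_itv.
rewrite Rintegral_itv_obnd_cbnd//.
apply: integrableS (continuous_integrable_itv b c cg) => //.
by apply: subset_itvr; rewrite bnd_simp.
Qed.

Lemma rint_FTC2 g (G : R -> R) a b : a <= b -> continuous g ->
  (forall x : R, is_derive x 1 G (g x)) -> rint g a b = G b - G a.
Proof.
rewrite le_eqVlt => /predU1P[<- _ _|ab cg dG].
  by rewrite /rint set_itv1 Rintegral_set1 subrr.
have dG' x : derivable G x 1 by case: (dG x).
have cG : continuous G.
  by move=> x; apply/differentiable_continuous/derivable1_diffP.
rewrite /rint /Rintegral (@continuous_FTC2 _ g G)//.
- exact: continuous_subspaceT.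
- split; first by [].
  + exact/cvg_at_right_filter/cG.
  + exact/cvg_at_left_filter/cG.
- by move=> x _; rewrite derive1E; apply: derive_val.
Qed.

End RealIntegral.

(** * Complex integrals and Goursat's lemma *)

Section ComplexIntegral.
Variable R : realType.
Local Notation C := R[i].
Local Notation Re := (@complex.Re R).
Local Notation Im := (@complex.Im R).
Implicit Types (g h : R -> C) (a b c : R).

Lemma continuous_Re : continuous (Re : C -> R).
Proof.
move=> z; apply/(@cvgrPdist_lt _ _ _ (nbhs z)) => e e0; apply/nbhs_nrP; exists e => // w.
by rewrite nr_distC; apply: le_lt_trans; rewrite -raddfB; exact: ler_abs_Re.
Qed.

Lemma continuous_Im : continuous (Im : C -> R).
Proof.
move=> z; apply/(@cvgrPdist_lt _ _ _ (nbhs z)) => e e0; apply/nbhs_nrP; exists e => // w.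
by rewrite nr_distC; apply: le_lt_trans; rewrite -raddfB; exact: ler_abs_Im.
Qed.

Lemma continuous_real_complex : continuous (fun r : R => r%:C : C).
Proof.
move=> z; apply/cvgrPdist_lt => e e0.
have eE : e = (Re e)%:C by rewrite RRe_real// gtr0_real.
have e0' : 0 < Re e by rewrite -ltcR -eE.
near=> w; rewrite -rmorphB/= nrE nr_real eE ltcR.
by near: w; exact: cvgr_dist_lt.
Unshelve. all: by end_near. Qed.

Lemma continuous_ReIm g : continuous g ->
  continuous (fun x => Re (g x)) /\ continuous (fun x => Im (g x)).
Proof.
move=> cg; split=> x; apply: continuous_comp (cg x) _; [exact: continuous_Re|
  exact: continuous_Im].
Qed.

Definition cint g a b : C :=
  rint (fun x => Re (g x)) a b +i* rint (fun x => Im (g x)) a b.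

Lemma cintD g h a b : continuous g -> continuous h ->
  cint (fun x => g x + h x) a b = cint g a b + cint h a b.
Proof.
move=> /continuous_ReIm[cg cg'] /continuous_ReIm[ch ch'].
rewrite /cint; apply/eqP; rewrite eq_complex /= -!rintD//.
by apply/andP; split; apply/eqP/eq_rint => x _; rewrite raddfD.
Qed.

Lemma cintZ (k : C) g a b : continuous g ->
  cint (fun x => k * g x) a b = k * cint g a b.
Proof.
move=> /continuous_ReIm[cg cg']; rewrite /cint; case: k => k l.
have ck r (f : R -> R) : continuous f -> continuous (fun x => r * f x).
  by move=> cf x; apply: cvgMr; exact: cf.
apply/eqP; rewrite eq_complex /= -!rintZ// -rintD -?rintB; try exact: ck.
apply/andP; split; apply/eqP/eq_rint => x _; case: (g x) => //=.
Qed.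

Lemma cintB g h a b : continuous g -> continuous h ->
  cint (fun x => g x - h x) a b = cint g a b - cint h a b.
Proof.
move=> cg ch; have cNh : continuous (fun x => -1 * h x).
  by move=> x; apply: cvgMr; exact: ch.
rewrite -(mulN1r (cint h a b)) -(cintZ (-1) a b ch) -(cintD a b cg cNh).
by congr cint; apply/funext => x; rewrite mulN1r.
Qed.

Lemma eq_cint g h a b : (forall x, a <= x <= b -> g x = h x) ->
  cint g a b = cint h a b.
Proof. by move=> gh; congr Complex; apply: eq_rint => x /gh ->. Qed.

(** Real and imaginary parts are bounded separately, which costs the factor 2; the later estimates
    only need some constant. *)
Lemma cint_norm_le (M : R) g a b : a <= b -> continuous g ->
  (forall x, a <= x <= b -> nr (g x) <= M) -> nr (cint g a b) <= 2 * M * (b - a).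
Proof.
move=> ab /continuous_ReIm[cg cg'] gM; rewrite (le_trans (ler_nr_ReIm _))//=.
have -> : 2 * M * (b - a) = M * (b - a) + M * (b - a) by ring.
by apply: lerD; apply: rint_norm_le => // x /gM; apply: le_trans;
  [exact: ler_abs_Re|exact: ler_abs_Im].
Qed.

Lemma cint_split g a b c : a <= b -> b <= c -> continuous g ->
  cint g a c = cint g a b + cint g b c.
Proof.
move=> ab bc /continuous_ReIm[cg cg'].
by rewrite /cint !(rint_split ab bc).
Qed.

Lemma cint_FTC2 g (G : R -> C) a b : a <= b -> continuous g ->
  (forall x : R, is_derive x 1 (fun x => Re (G x)) (Re (g x))) ->
  (forall x : R, is_derive x 1 (fun x => Im (G x)) (Im (g x))) ->
  cint g a b = G b - G a.
Proof.
move=> ab /continuous_ReIm[cg cg'] dRe dIm.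
rewrite /cint (rint_FTC2 ab cg dRe) (rint_FTC2 ab cg' dIm).
by case: (G b) (G a) => [? ?] [? ?].
Qed.

Lemma cint_cst (k : C) a b : a <= b -> cint (fun=> k) a b = k * (b - a)%:C.
Proof.
move=> ab; rewrite /cint !rint_cst//; case: k => k l /=.
by apply/eqP; rewrite eq_complex/= !mulr0 subr0 add0r !eqxx.
Qed.

Lemma cint_conj g a b : continuous g ->
  cint (fun x => (g x)^*%C) a b = (cint g a b)^*%C.
Proof.
move=> /continuous_ReIm[cg cg']; rewrite /cint/=; congr Complex.
  by apply: eq_rint => x _; case: (g x).
rewrite -[RHS]mulN1r -rintZ//; apply: eq_rint => x _.
by rewrite mulN1r; case: (g x).
Qed.

End ComplexIntegral.

Section Bisection.
Variable R : realType.
Local Notation C := R[i].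

Definition halves (a b x y : R) :=
  (x = a /\ y = (a + b) / 2) \/ (x = (a + b) / 2 /\ y = b).

(** The common point is the supremum of the left ends, each of which lies below every right end. *)
Lemma nested_halves (a b : nat -> R) : a 0%N <= b 0%N ->
  (forall k, halves (a k) (b k) (a k.+1) (b k.+1)) ->
  (forall k, b k - a k = (b 0%N - a 0%N) / 2 ^+ k) /\
  exists x, forall k, a k <= x <= b k.
Proof.
move=> ab0 h.
have ab k : a k <= b k.
  by elim: k => // k ih; case: (h k) => -[-> ->]; lra.
split.
  elim=> [|k ih]; first by rewrite expr0 divr1.
  have -> : b k.+1 - a k.+1 = (b k - a k) / 2 by case: (h k) => -[-> ->]; lra.
  by rewrite ih exprS invfM; ring.
have nda : nondecreasing_seq a.
  by apply/nondecreasing_seqP => k; have := ab k; case: (h k) => -[-> _]; lra.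
have nib : nonincreasing_seq b.
  by apply/nonincreasing_seqP => k; have := ab k; case: (h k) => -[_ ->]; lra.
have amb k l : a k <= b l.
  rewrite (le_trans (nda _ _ (leq_maxl k l)))//.
  by rewrite (le_trans (ab _))// nib// leq_maxr.
exists (sup (range a)) => k; apply/andP; split.
  apply: ub_le_sup; last by exists k.
  by exists (b 0%N) => _ [l _ <-].
apply: ge_sup; first by exists (a 0%N), 0%N.
by move=> _ [l _ <-].
Qed.

(* If [D] were nonzero, a suitable quarter would have at least the same defect
   per squared size; this contradicts the local estimate at the limit point. *)
Lemma goursat_bisection (a0 b0 c0 d0 : R) (D : R -> R -> R -> R -> C) :
  a0 <= b0 -> c0 <= d0 ->
  (forall a b c d, a0 <= a -> a <= b -> b <= b0 -> c0 <= c -> c <= d -> d <= d0 ->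
    let p := (a + b) / 2 in let q := (c + d) / 2 in
    D a b c d = D a p c q + D p b c q + D a p q d + D p b q d) ->
  (forall x y, a0 <= x <= b0 -> c0 <= y <= d0 -> forall e, 0 < e ->
    exists2 r, 0 < r & forall a b c d, a0 <= a -> a <= x <= b -> b <= b0 ->
     c0 <= c -> c <= y <= d -> d <= d0 -> b - a < r -> d - c < r ->
     nr (D a b c d) <= e * (b - a + (d - c)) ^+ 2) ->
  D a0 b0 c0 d0 = 0.
Proof.
move=> ab0 cd0 Dadd Dloc; apply/eqP; rewrite -nr_eq0 eq_le nr_ge0 andbT.
apply/ler_addgt0Pl => e e0; rewrite addr0.
pose S := b0 - a0 + (d0 - c0).
have S0 : 0 <= S by rewrite /S; lra.
(* Chosen so that [t * S ^+ 2 <= e]; the summand 1 covers the degenerate case [S = 0]. *)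
pose t := e / (S ^+ 2 + 1).
have t0 : 0 < t by rewrite divr_gt0// ltr_wpDl// sqr_ge0.
suff DS : nr (D a0 b0 c0 d0) <= t * S ^+ 2.
  rewrite (le_trans DS)// /t mulrAC ler_pdivrMr ?ltr_wpDl ?sqr_ge0//.
  by rewrite ler_wpM2l ?lerDl// ltW.
rewrite leNgt; apply/negP => big.
pose rect := (R * R * R * R)%type.
pose ok (q : rect) := let: (a, b, c, d) := q in
  [/\ a0 <= a, a <= b, b <= b0, c0 <= c & c <= d] /\ d <= d0 /\
  t * (b - a + (d - c)) ^+ 2 < nr (D a b c d).
(* The implication sits under the existential so that [choice] yields a successor map defined on all
   rectangles. *)
have step (q : rect) : exists q' : rect, ok q -> ok q' /\
    let: (a, b, c, d) := q in let: (a', b', c', d') := q' in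
    halves a b a' b' /\ halves c d c' d'.
  case: q => [[[a b] c] d].
  case: (pselect (ok (a, b, c, d))) => [okq|]; last by exists (a, b, c, d).
  move: (okq) => -[[h1 h2 h3 h4 h5] [h6 h7]].
  have /= := Dadd a b c d h1 h2 h3 h4 h5 h6.
  set p := (a + b) / 2; set q := (c + d) / 2 => DE.
  have ap : a <= p by rewrite /p; lra.
  have pb : p <= b by rewrite /p; lra.
  have cq : c <= q by rewrite /q; lra.
  have qd : q <= d by rewrite /q; lra.
  (* A quarter of the bound for the whole rectangle: if no subrectangle exceeded it, the four
     together would respect that bound. *)
  pose s := t * ((b - a + (d - c)) / 2) ^+ 2.
  have quarter a' b' c' d' : b' - a' = (b - a) / 2 -> d' - c' = (d - c) / 2 ->
      t * (b' - a' + (d' - c')) ^+ 2 = s by move=> -> ->; rewrite /s; field.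
  have [n1|n1] := ltP s (nr (D a p c q)).
    exists (a, p, c, q) => _; split; last by split; left.
    by split; [split=> //; lra|split; [lra|rewrite quarter//; rewrite /p /q; lra]].
  have [n2|n2] := ltP s (nr (D p b c q)).
    exists (p, b, c, q) => _; split; last by split; [right|left].
    by split; [split=> //; lra|split; [lra|rewrite quarter//; rewrite /p /q; lra]].
  have [n3|n3] := ltP s (nr (D a p q d)).
    exists (a, p, q, d) => _; split; last by split; [left|right].
    by split; [split=> //; lra|split; [lra|rewrite quarter//; rewrite /p /q; lra]].
  have [n4|n4] := ltP s (nr (D p b q d)).
    exists (p, b, q, d) => _; split; last by split; right.
    by split; [split=> //; lra|split; [lra|rewrite quarter//; rewrite /p /q; lra]].
  have : nr (D a b c d) <= s + s + s + s.
    rewrite DE; do 3 rewrite (le_trans (ler_nrD _ _))// lerD//.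
  have -> : s + s + s + s = t * (b - a + (d - c)) ^+ 2 by rewrite /s; field.
  by rewrite leNgt h7.
have [nxt hnxt] := choice step.
pose q := fix q k := if k is k'.+1 then nxt (q k') else (a0, b0, c0, d0).
have okq k : ok (q k).
  elim: k => [|k ih]; last by have [] := hnxt _ ih.
  by split; [split|split].
pose a k := (q k).1.1.1; pose b k := (q k).1.1.2.
pose c k := (q k).1.2; pose d k := (q k).2.
have qE k : q k = (a k, b k, c k, d k).
  by rewrite /a /b /c /d; case: (q k) => [[[]]].
have hq k : halves (a k) (b k) (a k.+1) (b k.+1) /\
            halves (c k) (d k) (c k.+1) (d k.+1).
  by have [_] := hnxt _ (okq k); rewrite -[nxt _]/(q k.+1) !qE.
have [abk [x hx]] := nested_halves (ab0 : a 0%N <= b 0%N) (fun k => (hq k).1).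
have [cdk [y hy]] := nested_halves (cd0 : c 0%N <= d 0%N) (fun k => (hq k).2).
have [r r0 hr] := Dloc x y (hx 0%N) (hy 0%N) t t0.
have [k [k1 k2]] : exists k, b k - a k < r /\ d k - c k < r.
  have : \forall k \near \oo, S * (2^-1) ^+ k < r.
    have : (fun k => S * (2^-1) ^+ k) @ \oo --> (0 : R).
      by apply: cvg_geometric; rewrite ger0_norm ?invr_ge0// invf_lt1// ltr1n.
    by move=> /cvgr_lt; apply.
  move=> [k _ /(_ k (leqnn k)) /= hk]; exists k.
  have hk2 : 0 <= (2 ^+ k : R)^-1 by rewrite invr_ge0 exprn_ge0.
  rewrite abk cdk; split; apply: le_lt_trans hk; rewrite exprVn;
    by apply: ler_wpM2r => //; rewrite /S /a /b /c /d /=; lra.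
have := okq k; rewrite qE => -[[g1 g2 g3 g4 g5] [g6]]; apply/negP.
by rewrite -leNgt; apply: hr.
Qed.

End Bisection.

(** * Cauchy's formula on the unit circle *)

Section CauchyFormula.
Variable R : realType.
Local Notation C := R[i].
Local Notation Re := (@complex.Re R).
Local Notation Im := (@complex.Im R).
Implicit Types (f g : C -> C) (w z : C) (a b c d s t : R).

(** The point [e^(it)] of the unit circle. *)
Definition cexp t : C := cos t +i* sin t.

Lemma cexpE t : cexp t = (cos t)%:C + 'i%C * (sin t)%:C.
Proof. by rewrite [LHS]complexE. Qed.

Lemma continuous_cexp : continuous cexp.
Proof.
have -> : cexp = fun t => (cos t)%:C + 'i%C * (sin t)%:C.
  by apply/funext => t; rewrite cexpE.
move=> t; apply: cvgD.
  by apply: continuous_comp; [exact: continuous_cos|exact: continuous_real_complex].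
apply: cvgMr.
by apply: continuous_comp; [exact: continuous_sin|exact: continuous_real_complex].
Qed.

Lemma nr_cexp t : nr (cexp t) = 1.
Proof. by rewrite /nr normc_def/= cos2Dsin2 sqrtr1. Qed.

Lemma cexp0 : cexp 0 = 1.
Proof. by rewrite /cexp cos0 sin0. Qed.

Lemma cexp_2pi : cexp (pi *+ 2) = 1.
Proof. by rewrite -cexp0 /cexp -[pi *+ 2]add0r cosD2pi sinD2pi. Qed.

Lemma cexpJ t : cexp t * (cexp t)^*%C = 1.
Proof.
rewrite /cexp/=; apply/eqP; rewrite eq_complex/= mulrN opprK -!expr2 cos2Dsin2 eqxx/=.
by rewrite mulrN addrC mulrC subrr.
Qed.

Lemma cexp_neq0 t : cexp t != 0.
Proof. by rewrite -nr_gt0 nr_cexp. Qed.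

Lemma cint_cexp c d : c <= d ->
  'i%C * cint cexp c d = cexp d - cexp c.
Proof.
move=> cd; rewrite -cintZ//; last exact: continuous_cexp.
apply: cint_FTC2 => //.
- by move=> x; apply: cvgMr; exact: continuous_cexp.
- by move=> x; rewrite /cexp/= !mul0r mul1r ?add0r ?sub0r; exact: is_derive_cos.
- by move=> x; rewrite /cexp/= !mul0r mul1r ?addr0 ?add0r; exact: is_derive_sin.
Qed.

Lemma nr_i : nr ('i%C : C) = 1.
Proof. by rewrite /nr normc_def/= expr0n expr1n/= add0r sqrtr1. Qed.

Lemma cexp_lipschitz c d : c <= d -> nr (cexp d - cexp c) <= 2 * (d - c).
Proof.
move=> cd; rewrite -cint_cexp// nrM nr_i mul1r -[2]mulr1.
by apply: cint_norm_le => //; [exact: continuous_cexp|move=> t _; rewrite nr_cexp].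
Qed.

Lemma cexp_subr_gt w t : nr w < 1 -> 1 - nr w <= nr (cexp t - w).
Proof.
move=> w1; rewrite lerBlDr (le_trans _ (ler_nrD _ _))//.
by rewrite subrK nr_cexp.
Qed.

Lemma cexp_subr_neq0 w t : nr w < 1 -> cexp t - w != 0.
Proof.
move=> w1; rewrite -nr_gt0 (lt_le_trans _ (cexp_subr_gt t w1))//.
by rewrite subr_gt0.
Qed.

(** Cauchy's kernel: for [z = cexp t], the form [dz / (z - w)] is [i * ckern w t dt]. *)
Definition ckern w t : C := cexp t / (cexp t - w).

Lemma continuous_ckern w : nr w < 1 -> continuous (ckern w).
Proof.
move=> w1 t; apply: cvgM; first exact: continuous_cexp.
apply: cvgV; first exact: cexp_subr_neq0.
by apply: cvgB; [exact: continuous_cexp|exact: cvg_cst].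
Qed.

Lemma nr_ckern_le w t : nr w < 1 -> nr (ckern w t) <= (1 - nr w)^-1.
Proof.
move=> w1; rewrite nrM nr_cexp mul1r nrV lef_pV2 ?posrE ?subr_gt0//.
  exact: cexp_subr_gt.
by rewrite (lt_le_trans _ (cexp_subr_gt t w1))// subr_gt0.
Qed.

Section Homotopy.
Variable w : C.
Hypothesis w1 : nr w < 1.

(** The homotopy contracting the unit circle to [w]. It pulls [dz / (z - w)] back to
    [ds / s + i * ckern w t dt], in which the variables are separated. *)
Definition ray s t : C := w + s%:C * (cexp t - w).

Lemma nr_ray_le s t : 0 <= s <= 1 -> nr (ray s t) <= 1.
Proof.
move=> /andP[s0 s1]; have -> : ray s t = (1 - s)%:C * w + s%:C * cexp t.
  by rewrite /ray rmorphB rmorph1; ring.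
rewrite (le_trans (ler_nrD _ _))// !nrM !nr_real nr_cexp mulr1.
rewrite !ger0_norm ?subr_ge0//.
have : (1 - s) * nr w <= (1 - s) * 1 by rewrite ler_wpM2l ?subr_ge0// ltW.
by lra.
Qed.

Lemma ray_dist s s' t t' : 0 <= s <= 1 -> t <= t' \/ t' <= t ->
  nr (ray s' t' - ray s t) <= 2 * `|s' - s| + 2 * `|t' - t|.
Proof.
move=> /andP[s0 s1] tt.
have -> : ray s' t' - ray s t =
    (s' - s)%:C * (cexp t' - w) + s%:C * (cexp t' - cexp t).
  by rewrite /ray rmorphB; ring.
rewrite (le_trans (ler_nrD _ _))// !nrM !nr_real.
have h1 : nr (cexp t' - w) <= 2.
  by rewrite (le_trans (ler_nrB _ _))// nr_cexp; move: w1; lra.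
have h2 : nr (cexp t' - cexp t) <= 2 * `|t' - t|.
  case: tt => tt.
    by rewrite ger0_norm ?subr_ge0//; exact: cexp_lipschitz.
  by rewrite nr_distC distrC ger0_norm ?subr_ge0//; exact: cexp_lipschitz.
apply: lerD; first by rewrite mulrC ler_wpM2r.
rewrite (le_trans _ h2)// ger0_norm// -[leRHS]mul1r.
by rewrite ler_wpM2r ?nr_ge0.
Qed.

Definition cdisc f := forall z, nr z <= 1 -> {for z, continuous f}.

Lemma continuous_ray_r s : continuous (ray s).
Proof.
move=> t; apply: cvgD; first exact: cvg_cst.
apply: cvgMr; apply: cvgB; [exact: continuous_cexp|exact: cvg_cst].
Qed.

Lemma continuous_ray_l t : continuous (ray^~ t).
Proof.
move=> s; apply: cvgD; first exact: cvg_cst.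
by apply: cvgMl; exact: continuous_real_complex.
Qed.

Definition circle_int f s c d := cint (fun t => f (ray s t) * ckern w t) c d.

Lemma continuous_circle_int f s : cdisc f -> 0 <= s <= 1 ->
  continuous (fun t => f (ray s t) * ckern w t).
Proof.
move=> cf s01 t; apply: cvgM; last exact: continuous_ckern.
by apply: continuous_comp; [exact: continuous_ray_r|apply/cf/nr_ray_le].
Qed.

Section Rectangle.
Variable s0 : R.
Hypothesis s0_gt0 : 0 < s0.
Hypothesis s0_le1 : s0 <= 1.

(** Truncating the parameter to [[s0, 1]] makes the integrand of [radial_int] continuous on the
    whole line, as the integration lemmas require, and keeps it away from the pole of [ds / s]. *)
Definition clamp s := Num.max s0 (Num.min s 1).

Lemma clampP s : s0 <= clamp s <= 1.
Proof. by rewrite /clamp le_max lexx/= ge_max s0_le1 ge_min lexx orbT. Qed.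

Lemma clampE s : s0 <= s <= 1 -> clamp s = s.
Proof. by move=> /andP[h1 h2]; rewrite /clamp (min_idPl h2) (max_idPr h1). Qed.

Lemma clamp01 s : 0 <= clamp s <= 1.
Proof. by have /andP[h ->] := clampP s; rewrite (le_trans (ltW s0_gt0) h). Qed.

Lemma continuous_clamp : continuous clamp.
Proof.
move=> s; apply: (@continuous_max R R (fun=> s0) (fun s => Num.min s 1)).
  exact: cvg_cst.
by apply: (@continuous_min R R id (fun=> 1)); [exact: cvg_id|exact: cvg_cst].
Qed.

Definition radial_int f t a b := cint (fun s => f (ray (clamp s) t) / (clamp s)%:C) a b.

Lemma continuous_radial_int f t : cdisc f ->
  continuous (fun s => f (ray (clamp s) t) / (clamp s)%:C).
Proof.
move=> cf s; apply: cvgM.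
  apply: (@continuous_comp _ _ _ (fun s => ray (clamp s) t) f).
    apply: (@continuous_comp _ _ _ clamp (ray^~ t)); first exact: continuous_clamp.
    exact: continuous_ray_l.
  by apply/cf/nr_ray_le/clamp01.
apply: cvgV.
  have /andP[h _] := clampP s.
  by rewrite -nr_gt0 nr_real normr_gt0 gt_eqF// (lt_le_trans _ h).
by apply: continuous_comp; [exact: continuous_clamp|exact: continuous_real_complex].
Qed.

(* The integral of the closed form [f(z)/(z - w) dz], pulled back by [ray],
   along the boundary of the rectangle [[a, b] x [c, d]]. *)
Definition rect_int f a b c d : C :=
  'i%C * (circle_int f (clamp b) c d - circle_int f (clamp a) c d)
    - (radial_int f d a b - radial_int f c a b).

Lemma rect_int_split f a b c d : cdisc f -> a <= b -> c <= d ->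
  let p := (a + b) / 2 in let q := (c + d) / 2 in
  rect_int f a b c d = rect_int f a p c q + rect_int f p b c q + rect_int f a p q d + rect_int f p b q d.
Proof.
move=> cf ab cd p q; rewrite /rect_int /circle_int /radial_int.
have cV s := continuous_circle_int cf (clamp01 s).
have cH t : continuous (fun s => f (ray (clamp s) t) / (clamp s)%:C).
  exact: continuous_radial_int.
have ap : a <= p by rewrite /p; lra.
have pb : p <= b by rewrite /p; lra.
have cq : c <= q by rewrite /q; lra.
have qd : q <= d by rewrite /q; lra.
rewrite !(cint_split cq qd (cV _)) !(cint_split ap pb (cH _)).
do !move: (cint _ _ _) => ?.
by ring.
Qed.

Lemma rect_intB f g a b c d : cdisc f -> cdisc g ->
  rect_int (fun z => f z - g z) a b c d = rect_int f a b c d - rect_int g a b c d.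
Proof.
move=> cf cg; rewrite /rect_int /circle_int /radial_int.
have VB s : cint (fun t => (f (ray (clamp s) t) - g (ray (clamp s) t)) * ckern w t) c d =
    circle_int f (clamp s) c d - circle_int g (clamp s) c d.
  rewrite /circle_int -(cintB _ _ (continuous_circle_int cf (clamp01 s)) (continuous_circle_int cg (clamp01 s))).
  by apply: eq_cint => t _; rewrite mulrBl.
have HB t : cint (fun s => (f (ray (clamp s) t) - g (ray (clamp s) t)) / (clamp s)%:C) a b =
    radial_int f t a b - radial_int g t a b.
  rewrite /radial_int -(cintB _ _ (continuous_radial_int cf (t := t)) (continuous_radial_int cg (t := t))).
  by apply: eq_cint => s _; rewrite mulrBl.
by rewrite !VB !HB /circle_int /radial_int; ring.
Qed.

Lemma continuous_subr (a : C) : continuous (fun z : C => z - a).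
Proof.
move=> z; apply: (@cvgB _ _ _ (nbhs z) _ id (fun=> a)); first exact: cvg_id.
exact: cvg_cst.
Qed.

Lemma cdisc_affine (A B : C) : cdisc (fun z => A + B * (z - w)).
Proof.
move=> z _; apply: (@cvgD _ _ _ (nbhs z) _ (fun=> A)); first exact: cvg_cst.
by apply: (@cvgMr _ _ (nbhs z)); exact: continuous_subr.
Qed.

(** The contributions of [A] cancel on opposite sides because the pulled back form has separated
    variables. Those of [B] both equal [B * (b - a) * (cexp d - cexp c)], by [cint_cexp] on the
    circular sides. *)
Lemma rect_int_affine (A B : C) a b c d : s0 <= a -> a <= b -> b <= 1 -> c <= d ->
  rect_int (fun z => A + B * (z - w)) a b c d = 0.
Proof.
move=> sa ab b1 cd; have caff : cdisc (fun v => A + B * (v - w)) by exact: cdisc_affine.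
have ca : clamp a = a by rewrite clampE// sa (le_trans ab).
have cb : clamp b = b by rewrite clampE// b1 (le_trans sa).
rewrite /rect_int /circle_int /radial_int.
have cV s := continuous_circle_int caff (clamp01 s).
have cH t : continuous (fun s => (A + B * (ray (clamp s) t - w)) / (clamp s)%:C).
  exact: (continuous_radial_int caff).
rewrite -(cintB _ _ (cV _) (cV _)) -(cintB _ _ (cH _) (cH _)).
rewrite (@eq_cint _ _ (fun t => B * (b - a)%:C * cexp t)); last first.
  move=> t _; rewrite /ray /ckern ca cb rmorphB.
  by have := cexp_subr_neq0 t w1 => ?; field.
rewrite cintZ; last exact: continuous_cexp.
rewrite [X in _ - X](@eq_cint _ _ (fun=> B * (cexp d - cexp c))); last first.
  move=> s /andP[s1 s2]; have sE : clamp s = s.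
    by rewrite clampE// (le_trans sa)// (le_trans s2).
  have sn0 : s%:C != 0 :> C.
    by rewrite -nr_gt0 nr_real normr_gt0 gt_eqF// (lt_le_trans s0_gt0)// (le_trans sa).
  by rewrite sE /ray; field.
by rewrite cint_cst// -cint_cexp//; ring.
Qed.

(** Two opposite sides and the factor 2 of [cint_norm_le] give the 4; nonnegative mixed terms are
    added to reach a product. *)
Lemma rect_int_norm_le (M : R) f a b c d : cdisc f -> 0 <= M ->
  s0 <= a -> a <= b -> b <= 1 -> c <= d ->
  (forall s t, a <= s <= b -> c <= t <= d -> nr (f (ray s t)) <= M) ->
  nr (rect_int f a b c d) <=
    4 * M * ((1 - nr w)^-1 + s0^-1) * (b - a + (d - c)).
Proof.
move=> cf M0 sa ab b1 cd fM.
have ca : clamp a = a by rewrite clampE// sa (le_trans ab).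
have cb : clamp b = b by rewrite clampE// b1 (le_trans sa).
have k0 : 0 <= (1 - nr w)^-1 by rewrite invr_ge0 subr_ge0 ltW.
have s0V : 0 <= s0^-1 by rewrite invr_ge0 ltW.
have VM s : a <= s <= b -> nr (circle_int f s c d) <= 2 * (M * (1 - nr w)^-1) * (d - c).
  move=> sab; apply: cint_norm_le => //.
    apply: continuous_circle_int => //; case/andP: sab => h1 h2; apply/andP; split.
      by rewrite (le_trans (ltW s0_gt0))// (le_trans sa).
    exact: le_trans b1.
  move=> t tcd; rewrite nrM ler_pM ?nr_ge0//; first exact: fM.
  exact: nr_ckern_le.
have HM t : c <= t <= d -> nr (radial_int f t a b) <= 2 * (M * s0^-1) * (b - a).
  move=> tcd; apply: cint_norm_le => //; first exact: continuous_radial_int.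
  move=> s /andP[h1 h2]; have sE : clamp s = s.
    by rewrite clampE// (le_trans sa)// (le_trans h2).
  have sp : s0 <= s by exact: le_trans h1.
  rewrite sE nrM nrV nr_real ler_pM ?nr_ge0 ?invr_ge0//.
    by apply: fM => //; apply/andP.
  by rewrite ger0_norm ?lef_pV2 ?posrE//; [exact: lt_le_trans sp|
    exact: le_trans (ltW _) sp].
rewrite /rect_int ca cb (le_trans (ler_nrB _ _))// nrM nr_i mul1r.
rewrite (le_trans (lerD (ler_nrB _ _) (ler_nrB _ _)))//.
have := VM b; rewrite lexx ab => /(_ isT).
have := VM a; rewrite lexx ab => /(_ isT).
have := HM d; rewrite lexx cd => /(_ isT).
have := HM c; rewrite lexx cd => /(_ isT).
have : 0 <= M * (1 - nr w)^-1 * (b - a) by rewrite !mulr_ge0// subr_ge0.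
have : 0 <= M * s0^-1 * (d - c) by rewrite !mulr_ge0// subr_ge0.
by lra.
Qed.

(** Goursat's argument: near the limit point [f] differs from its first-order expansion, whose
    integral vanishes by [rect_int_affine], by little compared with the size of the rectangle, and
    the length of the boundary supplies a second factor of that size. *)
Lemma rect_int_eq0 f c d : (forall z, nr z <= 1 -> differentiable f z) -> c <= d ->
  rect_int f s0 1 c d = 0.
Proof.
move=> df cd; have cf : cdisc f by move=> z /df/differentiable_continuous.
apply: goursat_bisection => //.
  by move=> a b c' d' ? ? ? ? ? ?; apply: rect_int_split.
move=> x y /andP[x1 x2] /andP[y1 y2] e e0.
have x01 : 0 <= x <= 1 by rewrite x2 (le_trans (ltW s0_gt0) x1).
set z := ray x y.
pose K := (1 - nr w)^-1 + s0^-1.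
have K0 : 0 < K by rewrite addr_gt0// invr_gt0// subr_gt0.
(* The 8 absorbs the 4 of [rect_int_norm_le] and the 2 of [ray_dist]. *)
pose e' := e / (8 * K).
have e'0 : 0 < e' by rewrite divr_gt0// mulr_gt0.
have [r r0 hr] := differentiable_eps (df z (nr_ray_le y x01)) e'0.
(* Then [sg < r / 2], while the image of the rectangle stays within [2 * sg] of [z]. *)
exists (r / 4); first by rewrite divr_gt0.
move=> a b c' d' sa /andP[ax xb] b1 cc' /andP[c'y yd'] d'd bar dcr.
pose B : C := 'd f z (1 : C).
pose A : C := f z - B * (z - w).
have caff : cdisc (fun v => A + B * (v - w)) by exact: cdisc_affine.
have ab : a <= b by exact: le_trans xb.
have c'd' : c' <= d' by exact: le_trans yd'.
have -> : rect_int f a b c' d' = rect_int (fun v => f v - (A + B * (v - w))) a b c' d'.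
  by rewrite rect_intB// [X in _ - X]rect_int_affine// subr0.
set sg := b - a + (d' - c').
have sg0 : 0 <= sg by rewrite /sg; lra.
rewrite (@le_trans _ _ (4 * (e' * (2 * sg)) * K * sg))//; last first.
  have -> : 4 * (e' * (2 * sg)) * K * sg = e * sg ^+ 2.
    by rewrite /e'; field; rewrite gt_eqF.
  by [].
have cfa : cdisc (fun v => f v - (A + B * (v - w))).
  by move=> v v1; apply: (@cvgB _ _ _ (nbhs v) _ f); [exact: cf|exact: caff].
have M0 : 0 <= e' * (2 * sg) by apply: mulr_ge0; [exact: ltW|exact: mulr_ge0].
apply: (rect_int_norm_le cfa M0 sa ab b1 c'd').
move=> s t /andP[as_ sb] /andP[ct td].
have -> : f (ray s t) - (A + B * (ray s t - w)) =
    f (z + (ray s t - z)) - f z - 'd f z (ray s t - z).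
  have -> : 'd f z (ray s t - z) = B * (ray s t - z).
    by rewrite -{1}[ray s t - z]mulr1 [LHS]linearZ/= mulrC.
  by rewrite subrKC /A; ring.
have dist : nr (ray s t - z) <= 2 * sg.
  rewrite (le_trans (ray_dist _ x01 _))//; first by case: (leP y t) => ?; [left|right; exact: ltW].
  have : `|s - x| <= b - a by rewrite ler_norml; apply/andP; split; lra.
  have : `|t - y| <= d' - c' by rewrite ler_norml; apply/andP; split; lra.
  by rewrite /sg; lra.
rewrite (le_trans (hr _ _))//.
  by rewrite (le_lt_trans dist)// /sg; lra.
by rewrite ler_wpM2l// ltW.
Qed.

End Rectangle.

(** The two radial sides, at angles 0 and [2 pi], coincide, so the vanishing of [rect_int] makes
    [circle_int f s] independent of [s]. As [s] tends to 0 the curve shrinks to [w] and [f] may be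
    replaced by [f w]. *)
Lemma circle_int_contract f : (forall z, nr z <= 1 -> differentiable f z) ->
  circle_int f 1 0 (pi *+ 2) = f w * cint (ckern w) 0 (pi *+ 2).
Proof.
move=> df; have cf : cdisc f by move=> z /df/differentiable_continuous.
have pi2 : 0 <= (pi *+ 2 : R) by rewrite mulrn_wge0// pi_ge0.
have VE s : 0 < s -> s <= 1 -> circle_int f 1 0 (pi *+ 2) = circle_int f s 0 (pi *+ 2).
  move=> s_gt0 s_le1.
  have := rect_int_eq0 s_gt0 s_le1 df pi2.
  rewrite /rect_int !clampE ?lexx ?s_le1//.
  have -> : radial_int s f (pi *+ 2) s 1 = radial_int s f 0 s 1.
    by rewrite /radial_int /ray cexp_2pi cexp0.
  rewrite subrr subr0 => /eqP; rewrite mulf_eq0 -nr_eq0 nr_i oner_eq0/=.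
  by rewrite subr_eq0 => /eqP.
apply/eqP; rewrite -subr_eq0 -nr_eq0 eq_le nr_ge0 andbT.
apply/ler_addgt0Pl => e e0; rewrite addr0.
pose K := 2 * (1 - nr w)^-1 * (pi *+ 2) + 1.
have K0 : 0 <= 2 * (1 - nr w)^-1 * (pi *+ 2).
  by rewrite !mulr_ge0// invr_ge0 subr_ge0 ltW.
have K1 : 0 < K by rewrite /K ltr_wpDl.
have e'0 : 0 < e / K by rewrite divr_gt0.
have [d d0 hd] := (continuous_nrP f w).1 (cf w (ltW w1)) _ e'0.
(* Since [cexp t - w] has norm at most 2, the curve then lies within [d / 2] of [w]. *)
pose s := Num.min 1 (d / 4).
have s_gt0 : 0 < s by rewrite /s lt_min ltr01 divr_gt0.
have s_le1 : s <= 1 by rewrite /s ge_min lexx.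
have s_led : s <= d / 4 by rewrite /s ge_min lexx orbT.
rewrite (VE s)// /circle_int -cintZ; last exact: continuous_ckern.
rewrite -cintB; last 2 first.
- by apply: continuous_circle_int => //; rewrite s_le1 ltW.
- by move=> t; apply: cvgMr; exact: continuous_ckern.
rewrite (@le_trans _ _ (2 * (e / K * (1 - nr w)^-1) * (pi *+ 2 - 0)))//.
  apply: cint_norm_le => //.
    move=> t; apply: cvgB.
      by apply: continuous_circle_int => //; rewrite s_le1 ltW.
    by apply: cvgMr; exact: continuous_ckern.
  move=> t _; rewrite -mulrBl nrM ler_pM ?nr_ge0//; last exact: nr_ckern_le.
  apply/ltW/hd; rewrite /ray addrC addKr nrM nr_real ger0_norm ?ltW//.
  have : nr (cexp t - w) <= 2.
    by rewrite (le_trans (ler_nrB _ _))// nr_cexp; move: w1; lra.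
  move=> h; rewrite (@le_lt_trans _ _ (d / 4 * 2))//; last by lra.
  by rewrite ler_pM ?nr_ge0// ltW.
have -> : 2 * (e / K * (1 - nr w)^-1) * (pi *+ 2 - 0) = e * ((K - 1) / K).
  have -> : K - 1 = 2 * (1 - nr w)^-1 * (pi *+ 2) by rewrite /K; ring.
  by ring.
rewrite -[leRHS]mulr1 ler_wpM2l ?(ltW e0)// ler_pdivrMr// mul1r.
by rewrite lerBlDr lerDl.
Qed.

End Homotopy.

(** On the circle [ckern w] is the complex conjugate of [f(z) = 1 / (1 - w^* z)], which is
    holomorphic on the closed disc. The contraction centred at 0, where the kernel is 1, evaluates
    the integral of [f] as [2 pi * f 0 = 2 pi]. *)
Lemma cint_ckern w : nr w < 1 -> cint (ckern w) 0 (pi *+ 2) = (pi *+ 2)%:C.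
Proof.
move=> w1.
have pi2 : 0 <= (pi *+ 2 : R) by rewrite mulrn_wge0// pi_ge0.
have nrJ (z : C) : nr z^*%C = nr z.
  by rewrite /nr !normc_def/=; case: z => a b /=; rewrite sqrrN.
pose f z : C := (1 - w^*%C * z)^-1.
have fn0 z : nr z <= 1 -> 1 - w^*%C * z != 0.
  move=> z1; rewrite -nr_gt0 (@lt_le_trans _ _ (1 - nr w))// ?subr_gt0//.
  rewrite lerBlDr (@le_trans _ _ (nr (1 - w^*%C * z) + nr (w^*%C * z)))//.
    by rewrite (le_trans _ (ler_nrD _ _))// subrK nr1.
  rewrite lerD2l nrM nrJ -[leRHS]mulr1 ler_wpM2l ?nr_ge0//.
have df z : nr z <= 1 -> differentiable f z.
  move=> z1; apply: differentiableV; last exact: fn0.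
  apply: differentiableB; first exact: differentiable_cst.
  apply: (@differentiableZ _ _ _ (@id C) w^*%C).
  exact: ex_diff.
have n01 : nr (0 : C) < 1 by rewrite nr0 ltr01.
have := circle_int_contract n01 df.
have k1 t : ckern 0 t = 1 by rewrite /ckern subr0 divff// cexp_neq0.
rewrite /circle_int.
rewrite (_ : (fun t => _ * _) = f \o cexp); last first.
  by apply/funext => t /=; rewrite k1 mulr1 /ray add0r mul1r subr0.
rewrite (_ : ckern 0 = fun=> 1); last exact/funext.
rewrite cint_cst// subr0 mul1r /f mulr0 subr0 invr1 mul1r => hf.
have cfe : continuous (fun t => f (cexp t)).
  move=> t; apply: continuous_comp; first exact: continuous_cexp.
  by apply/differentiable_continuous/df; rewrite nr_cexp.
have conjE (u : C) : ((1 - w^*%C * u)^-1)^*%C = (1 - w * u^*%C)^-1.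
  by rewrite conjc_inv rmorphB rmorph1 rmorphM /= (conjcK w).
have -> : ckern w = fun t => (f (cexp t))^*%C.
  apply/funext => t; rewrite /f conjE /ckern.
  have e0 := cexp_neq0 t; have ew := cexp_subr_neq0 t w1.
  have eJ : (cexp t)^*%C = (cexp t)^-1 by apply: (mulfI e0); rewrite cexpJ divff.
  by rewrite eJ; field; rewrite e0 ew.
by rewrite cint_conj// hf conjc_real.
Qed.

Definition avg (g : R -> C) : C := cint g 0 (pi *+ 2) / (pi *+ 2)%:C.

Lemma cauchy_formula f w : nr w < 1 ->
  (forall z, nr z <= 1 -> differentiable f z) ->
  f w = avg (fun t => f (cexp t) * ckern w t).
Proof.
move=> w1 df; have := circle_int_contract w1 df; rewrite cint_ckern// /circle_int.
rewrite (_ : (fun t => f (ray w 1 t) * ckern w t) =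
             (fun t => f (cexp t) * ckern w t)); last first.
  by apply/funext => t; rewrite /ray mul1r subrKC.
move=> hf; rewrite /avg hf mulfK//.
by rewrite -nr_gt0 nr_real normr_gt0 mulrn_eq0/= gt_eqF// pi_gt0.
Qed.

End CauchyFormula.

(** * Taylor expansions and holomorphic circle averages *)

Section Averages.
Variable R : realType.
Local Notation C := R[i].
Implicit Types (g h : R -> C).

Let pi2 : 0 < (pi *+ 2 : R).
Proof. by rewrite mulrn_wgt0// pi_gt0. Qed.

Lemma avgD g h : continuous g -> continuous h ->
  avg (fun t => g t + h t) = avg g + avg h.
Proof. by move=> cg ch; rewrite /avg cintD// mulrDl. Qed.

Lemma avgB g h : continuous g -> continuous h ->
  avg (fun t => g t - h t) = avg g - avg h.
Proof. by move=> cg ch; rewrite /avg cintB// mulrBl. Qed.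

Lemma avgZ (k : C) g : continuous g -> avg (fun t => k * g t) = k * avg g.
Proof. by move=> cg; rewrite /avg cintZ// mulrA. Qed.

Lemma avg_norm_le (M : R) g : continuous g -> (forall t, nr (g t) <= M) ->
  nr (avg g) <= 2 * M.
Proof.
move=> cg gM; rewrite /avg nrM nrV nr_real (gtr0_norm pi2) ler_pdivrMr//.
rewrite -{2}[pi *+ 2]subr0; apply: cint_norm_le => //; exact: ltW.
Qed.

Lemma uniform_limit_continuous (F : R -> C) :
  (forall e : R, 0 < e -> exists2 g : R -> C, continuous g &
     forall t, nr (F t - g t) <= e) -> continuous F.
Proof.
move=> h t; apply/cvgrPdist_lt => e e0.
have eE : e = (complex.Re e)%:C by rewrite RRe_real// gtr0_real.
have e0' : 0 < complex.Re e by rewrite -ltcR -eE.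
have [|g cg gF] := h (complex.Re e / 4); first by rewrite divr_gt0.
have e40 : 0 < (complex.Re e / 4)%:C by rewrite ltcR divr_gt0.
have /cvgrPdist_lt/(_ _ e40) := cg t.
apply: filterS => s; rewrite !nrE eE !ltcR => gts.
rewrite (le_lt_trans (ler_nr_distD (g t) _ _))//.
have := ler_nr_distD (g s) (g t) (F s).
have := gF t; have := gF s; rewrite (nr_distC (g s)); lra.
Qed.

Lemma continuous_circle (f : C -> C) :
  (forall z, nr z <= 1 -> {for z, continuous f}) -> continuous (fun t => f (cexp t)).
Proof.
move=> cf t; apply: continuous_comp; first exact: continuous_cexp.
by apply: cf; rewrite nr_cexp.
Qed.

Lemma continuous_cexpV k : continuous (fun t : R => (cexp t)^-1 ^+ k).
Proof.
elim: k => [|k ih] t; first exact: cvg_cst.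
under eq_fun do rewrite exprS.
apply: cvgM; last exact: ih.
by apply: cvgV; [exact: cexp_neq0|exact: continuous_cexp].
Qed.

Section OneVariable.
Variable (f : C -> C).
Hypothesis df : forall z, nr z <= 1 -> differentiable f z.

Let cf : forall z, nr z <= 1 -> {for z, continuous f}.
Proof. by move=> z /df/differentiable_continuous. Qed.

Definition taylor_coef k := avg (fun t => f (cexp t) * (cexp t)^-1 ^+ k).
(** The factor of [z ^+ k] left in [f z] after the terms [taylor_coef j * z ^+ j] with [j < k] are
    removed. *)
Definition taylor_rem k z :=
  avg (fun t => f (cexp t) * (cexp t)^-1 ^+ k * ckern z t).

Lemma continuous_taylor_coef k :
  continuous (fun t => f (cexp t) * (cexp t)^-1 ^+ k).
Proof.
move=> t; apply: cvgM; first exact: (continuous_circle cf).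
exact: continuous_cexpV.
Qed.

Lemma continuous_taylor_rem k z : nr z < 1 ->
  continuous (fun t => f (cexp t) * (cexp t)^-1 ^+ k * ckern z t).
Proof.
move=> z1 t; apply: cvgM; first exact: continuous_taylor_coef.
exact: continuous_ckern.
Qed.

Lemma taylor_rem0 z : nr z < 1 -> f z = taylor_rem 0 z.
Proof.
move=> z1; rewrite (cauchy_formula z1 df); congr avg.
by apply/funext => t; rewrite expr0 mulr1.
Qed.

(** One step of the geometric series: [ckern z t = 1 + z * (cexp t)^-1 * ckern z t]. *)
Lemma taylor_remS k z : nr z < 1 ->
  taylor_rem k z = taylor_coef k + z * taylor_rem k.+1 z.
Proof.
move=> z1; rewrite /taylor_rem /taylor_coef -avgZ; last exact: continuous_taylor_rem.
rewrite -avgD.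
- congr avg; apply/funext => t; rewrite /ckern exprS.
  move: ((cexp t)^-1 ^+ k) => c.
  by field; rewrite cexp_neq0 cexp_subr_neq0.
- exact: continuous_taylor_coef.
- by move=> t; apply: cvgMr; exact: continuous_taylor_rem.
Qed.

Variable M : R.
Hypothesis fM : forall z, nr z <= 1 -> nr (f z) <= M.

Lemma nr_taylor_coef_le k : nr (taylor_coef k) <= 2 * M.
Proof.
apply: avg_norm_le; first exact: continuous_taylor_coef.
move=> t; rewrite nrM nrX nrV nr_cexp invr1 expr1n mulr1.
by apply: fM; rewrite nr_cexp.
Qed.

Lemma nr_taylor_rem_le k z : nr z <= 1 / 2 -> nr (taylor_rem k z) <= 4 * M.
Proof.
move=> z1; have z1' : nr z < 1 by lra.
have -> : 4 * M = 2 * (M * 2) by ring.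
apply: avg_norm_le; first exact: continuous_taylor_rem.
move=> t; rewrite nrM ler_pM ?nr_ge0//.
  rewrite nrM nrX nrV nr_cexp invr1 expr1n mulr1.
  by apply: fM; rewrite nr_cexp.
rewrite (le_trans (nr_ckern_le t z1'))// invf_ple ?posrE//; lra.
Qed.

Lemma taylor2 z : nr z <= 1 / 2 ->
  nr (f z - f 0 - z * taylor_coef 1) <= 4 * M * nr z ^+ 2.
Proof.
move=> z1; have z1' : nr z < 1 by lra.
rewrite [f z]taylor_rem0// taylor_remS// taylor_remS//.
rewrite [f 0]taylor_rem0 ?nr0// (@taylor_remS 0 0) ?nr0//.
rewrite (_ : _ - _ - _ = z ^+ 2 * taylor_rem 2 z); last by ring.
by rewrite nrM nrX mulrC ler_wpM2r ?exprn_ge0 ?nr_ge0// nr_taylor_rem_le.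
Qed.

(** Here [f z = z ^+ k * taylor_rem k z] for every [k], and the remainders are bounded by [4 * M]
    independently of [k]. *)
Lemma taylor_coef_eq0 z : nr z <= 1 / 2 -> (forall k, taylor_coef k = 0) -> f z = 0.
Proof.
move=> z1 a0; have z1' : nr z < 1 by lra.
have fE k : f z = z ^+ k * taylor_rem k z.
  elim: k => [|k ->]; first by rewrite expr0 mul1r taylor_rem0.
  by rewrite taylor_remS// a0 add0r mulrA exprSr.
have M0 : 0 <= M by rewrite (le_trans (nr_ge0 (f 0)))// fM// nr0.
apply/eqP; rewrite -nr_eq0 eq_le nr_ge0 andbT.
apply/ler_addgt0Pl => e e0; rewrite addr0.
have : (fun k => (4 * M) * (2^-1) ^+ k) @ \oo --> (0 : R).
  by apply: cvg_geometric; rewrite ger0_norm ?invr_ge0// invf_lt1// ltr1n.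
move=> /cvgr_lt/(_ e e0)[k _ /(_ k (leqnn k)) /= hk].
rewrite (fE k) nrM nrX mulrC (le_trans _ (ltW hk))//.
rewrite ler_pM ?exprn_ge0 ?nr_ge0 ?nr_taylor_rem_le//.
by rewrite lerXn2r ?nnegrE ?nr_ge0 ?invr_ge0// -[2^-1]mul1r.
Qed.

Lemma taylor_order k : (forall j, (j < k)%N -> taylor_coef j = 0) ->
  (forall z, nr z < 1 -> f z = z ^+ k * taylor_rem k z) /\
  taylor_rem k 0 = taylor_coef k /\ {for 0, continuous (taylor_rem k)}.
Proof.
move=> a0; split.
  move=> z z1; suff fE j : (j <= k)%N -> f z = z ^+ j * taylor_rem j z by exact: fE.
  elim: j => [_|j ih jk]; first by rewrite expr0 mul1r taylor_rem0.
  by rewrite ih ?(ltnW jk)// taylor_remS// a0// add0r mulrA exprSr.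
have r0 : taylor_rem k 0 = taylor_coef k by rewrite taylor_remS ?nr0// mul0r addr0.
split=> //; apply/continuous_nrP => e e0.
have M0 : 0 <= M by rewrite (le_trans (nr_ge0 (f 0)))// fM// nr0.
have K0 : 0 < 4 * M + 1 by lra.
exists (Num.min (1 / 2) (e / (4 * M + 1))).
  by rewrite lt_min; apply/andP; split; [lra|rewrite divr_gt0].
move=> z; rewrite subr0 lt_min => /andP[z1 z2].
have z1' : nr z < 1 by lra.
rewrite r0 taylor_remS// [X in X - _]addrC addrK nrM.
rewrite (@le_lt_trans _ _ (nr z * (4 * M + 1)))// -?ltr_pdivlMr//.
by rewrite ler_wpM2l ?nr_ge0// (le_trans (nr_taylor_rem_le _ (ltW z1)))// lerDl.
Qed.

End OneVariable.

(** * Cauchy estimates on normed spaces, by restriction to complex lines *)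

Section SecondOrder.
Variables (V : normedModType C) (f : V -> C) (rho M : R).
Hypothesis rho0 : 0 < rho.
Hypothesis df : forall z : V, nr z < rho -> differentiable f z.
Hypothesis fM : forall z : V, nr z < rho -> nr (f z) <= M.

Let line (z u : V) (s : C) := f (z + s *: u).

Let ball_line (z u : V) (s : C) : nr z < rho / 2 -> nr u <= rho / 2 -> nr (s : C) <= 1 ->
  nr (z + s *: u) < rho.
Proof.
move=> z1 u1 s1; rewrite (le_lt_trans (ler_nrD _ _))// nrZ.
have : nr s * nr u <= 1 * nr u by rewrite ler_wpM2r ?nr_ge0.
by lra.
Qed.

Let dline (z u : V) : nr z < rho / 2 -> nr u <= rho / 2 ->
  forall s, nr s <= 1 -> differentiable (line z u) s.
Proof.
move=> z1 u1 s s1; apply: (@differentiable_comp _ _ _ _ (fun s : C => z + s *: u) f).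
  apply: (@differentiableD _ _ _ (cst z) (fun s : C => s *: u)).
    exact: differentiable_cst.
  exact: differentiableZl.
by apply: df; exact: ball_line.
Qed.

(** Two expansions of [f] at [z + s *: u] are compared: the differential is accurate up to an
    arbitrarily small multiple of [s], the Taylor expansion up to a multiple of [s ^+ 2]. *)
Lemma diff_taylor_coef (z u : V) : nr z < rho / 2 -> nr u <= rho / 2 ->
  'd f z u = taylor_coef (line z u) 1.
Proof.
move=> z1 u1; apply/eqP; rewrite -subr_eq0 -nr_eq0 eq_le nr_ge0 andbT.
have zr : nr z < rho by move: rho0; lra.
apply/ler_addgt0Pl => e e0; rewrite addr0.
have M0 : 0 <= M by rewrite (le_trans (nr_ge0 (f z)))// fM.
have e'0 : 0 < e / (2 * (nr u + 1)).
  by rewrite divr_gt0// mulr_gt0// ltr_wpDl ?nr_ge0.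
have [d d0 hd] := differentiable_eps (df zr) e'0.
(* The three bounds allow [taylor2], keep [s *: u] within [d], and make the quadratic error at most
   [s * (e / 2)]. *)
pose s := Num.min (1 / 2) (Num.min (d / (2 * (nr u + 1))) (e / (8 * (M + 1)))).
have s0 : 0 < s.
  rewrite !lt_min; apply/and3P; split; first by lra.
    by rewrite divr_gt0// mulr_gt0// ltr_wpDl ?nr_ge0.
  by rewrite divr_gt0// mulr_gt0// ltr_wpDl.
have [s1 s2 s3] : [/\ s <= 1 / 2, s <= d / (2 * (nr u + 1)) & s <= e / (8 * (M + 1))].
  by rewrite /s; split; rewrite ?ge_min ?lexx ?orbT.
have nrs : nr s%:C = s by rewrite nr_real gtr0_norm.
have snrd : nr (s%:C *: u) < d.
  rewrite nrZ nrs; have : s * (2 * (nr u + 1)) <= d.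
    by rewrite -ler_pdivlMr// mulr_gt0// ltr_wpDl ?nr_ge0.
  have := nr_ge0 u; have : 0 <= s * nr u by rewrite mulr_ge0 ?nr_ge0// ltW//.
  move=> *; lra.
have h1 := hd _ snrd.
have fM' x : nr x <= 1 -> nr (line z u x) <= M by move=> x1; apply/fM/ball_line.
have nrs2 : nr s%:C <= 1 / 2 by rewrite nrs.
have h2 := taylor2 (dline z1 u1) fM' nrs2.
have : s * nr ('d f z u - taylor_coef (line z u) 1) <=
   e / (2 * (nr u + 1)) * nr (s%:C *: u) + 4 * M * nr s%:C ^+ 2.
  rewrite -{1}nrs -nrM.
  apply: le_trans (lerD h1 h2).
  rewrite -(nrN (f _ - _ - _)) (le_trans _ (ler_nrD _ _))//.
  rewrite le_eqVlt; apply/orP; left; apply/eqP; congr nr; rewrite /line scale0r addr0 linearZ/=.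
  rewrite -[s%:C *: 'd f z u]/(s%:C * 'd f z u).
  by move: (f (z + s%:C *: u)) (f z) ('d f z u) (taylor_coef _ _) => ? ? ? ?; ring.
rewrite nrZ nrs => h3; rewrite -(ler_pM2l s0) (le_trans h3)//.
have -> : e / (2 * (nr u + 1)) * (s * nr u) = s * (e / 2 * (nr u / (nr u + 1))).
  by field; rewrite gt_eqF// ltr_wpDl ?nr_ge0.
have -> : s * e = s * (e / 2) + s * (e / 2) by field.
apply: lerD.
  rewrite ler_wpM2l ?(ltW s0)// -[leRHS]mulr1 ler_wpM2l//; first by lra.
  by rewrite ler_pdivrMr ?ltr_wpDl ?nr_ge0// mul1r lerDl.
have -> : 4 * M * s ^+ 2 = s * (4 * M * s) by ring.
rewrite ler_wpM2l ?(ltW s0)//.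
have : s * (8 * (M + 1)) <= e by rewrite -ler_pdivlMr// mulr_gt0// ltr_wpDl.
by lra.
Qed.

(** Scaling [v] to length [rho / 2] turns its image into a Taylor coefficient, which is at most
    [2 * M]. *)
Lemma diff_bound (z v : V) : nr z < rho / 2 -> nr ('d f z v) <= 4 * M / rho * nr v.
Proof.
move=> z1; have [->|vn0] := eqVneq v 0.
  by rewrite linear0 !nr0 mulr0.
have v0 : 0 < nr v by rewrite nr_gt0.
pose c := rho / 2 / nr v.
have c0 : 0 < c by rewrite !divr_gt0.
have nrc : nr c%:C = c by rewrite nr_real gtr0_norm.
have u1 : nr (c%:C *: v) <= rho / 2 by rewrite nrZ nrc /c mulfVK// gt_eqF.
have fM' x : nr x <= 1 -> nr (line z (c%:C *: v) x) <= M.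
  by move=> x1; apply/fM/ball_line.
have := nr_taylor_coef_le (dline z1 u1) fM' 1.
rewrite -diff_taylor_coef// linearZ/= nrZ nrc -ler_pdivlMl//.
move=> /le_trans; apply; rewrite /c le_eqVlt; apply/orP; left; apply/eqP.
by field; rewrite !gt_eqF.
Qed.

(** The constant depends on [M] and [rho] only, not on [f]; this uniformity permits differentiation
    under the integral sign. It is [taylor2] along the direction of [v] scaled to length
    [rho / 2]. *)
Lemma second_order (z v : V) : nr z < rho / 2 -> nr v <= rho / 4 ->
  nr (f (z + v) - f z - 'd f z v) <= 16 * M / rho ^+ 2 * nr v ^+ 2.
Proof.
move=> z1 vr; have [->|vn0] := eqVneq v 0.
  by rewrite addr0 subrr linear0 subrr !nr0 expr0n/= mulr0.
have v0 : 0 < nr v by rewrite nr_gt0.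
pose c := rho / 2 / nr v.
have c0 : 0 < c by rewrite !divr_gt0.
have nrc : nr c%:C = c by rewrite nr_real gtr0_norm.
have cn0 : c%:C != 0 :> C by rewrite -nr_gt0 nrc.
have u1 : nr (c%:C *: v) <= rho / 2 by rewrite nrZ nrc /c mulfVK// gt_eqF.
have fM' x : nr x <= 1 -> nr (line z (c%:C *: v) x) <= M.
  by move=> x1; apply/fM/ball_line.
have nrcV : nr (c%:C^-1 : C) = c^-1 by rewrite nrV nrc.
have c2 : nr (c%:C^-1 : C) <= 1 / 2.
  rewrite nrcV /c invf_div ler_pdivrMr ?divr_gt0//; lra.
have := taylor2 (dline z1 u1) fM' c2.
have dE : 'd f z (c%:C *: v) = c%:C * 'd f z v by rewrite [LHS]linearZ.
rewrite -diff_taylor_coef// dE /line scalerA mulVf// scale1r scale0r addr0.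
rewrite mulrA mulVf// mul1r.
move=> /le_trans; apply; rewrite nrcV /c le_eqVlt; apply/orP; left; apply/eqP.
by field; rewrite !gt_eqF.
Qed.

End SecondOrder.

(** The average of the differentials is the differential of the average, because the error terms are
    quadratic uniformly in [t]. *)
Lemma differentiable_avg (V : normedModType C) (K : R -> V -> C) (rho M : R) :
  0 < rho ->
  (forall t (z : V), nr z < rho -> differentiable (K t) z) ->
  (forall t (z : V), nr z < rho -> nr (K t z) <= M) ->
  (forall z : V, nr z < rho -> continuous (K^~ z)) ->
  forall z : V, nr z < rho / 2 -> differentiable (fun z => avg (K^~ z)) z.
Proof.
move=> rho0 dK KM cK z z1.
have so t v := @second_order V (K t) rho M rho0 (dK t) (KM t) z v z1.
have db t v := @diff_bound V (K t) rho M rho0 (dK t) (KM t) z v z1.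
have M0 : 0 <= M by rewrite (le_trans (nr_ge0 (K 0 z)))// KM//; lra.
set c := 16 * M / rho ^+ 2 in so.
have c0 : 0 <= c by rewrite /c divr_ge0 ?mulr_ge0// ?exprn_ge0// ?ltW.
(* Continuity in [t] is assumed for the values only; the differential inherits it as a uniform limit
   of difference quotients. *)
have cd v : continuous (fun t => 'd (K t) z v).
  apply: uniform_limit_continuous => e e0.
  pose B := c * nr v ^+ 2 + 1.
  have B0 : 0 < B by rewrite ltr_wpDl// mulr_ge0// exprn_ge0// nr_ge0.
  pose s := Num.min (rho / 4 / (nr v + 1)) (e / B).
  have v10 : 0 < nr v + 1 by rewrite ltr_wpDl ?nr_ge0.
  have s0 : 0 < s by rewrite lt_min !divr_gt0.
  have [s1 s2] : s <= rho / 4 / (nr v + 1) /\ s <= e / B.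
    by rewrite /s !ge_min !lexx orbT.
  have nrs : nr s%:C = s by rewrite nr_real gtr0_norm.
  have sn0 : s%:C != 0 :> C by rewrite -nr_gt0 nrs.
  have svr : nr (s%:C *: v) <= rho / 4.
    rewrite nrZ nrs; move: s1; rewrite ler_pdivlMr// => h.
    by rewrite (le_trans _ h)// ler_wpM2l ?(ltW s0)// lerDl.
  have zsv : nr (z + s%:C *: v) < rho by rewrite (le_lt_trans (ler_nrD _ _))//; lra.
  exists (fun t => s%:C^-1 * (K t (z + s%:C *: v) - K t z)).
    move=> t; apply: cvgMr; apply: cvgB; first exact: (cK _ zsv).
    by apply: cK; lra.
  move=> t; rewrite -(ler_pM2l s0) -{1}nrs -nrM.
  have -> : s%:C * ('d (K t) z v - s%:C^-1 * (K t (z + s%:C *: v) - K t z)) =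
      - (K t (z + s%:C *: v) - K t z - 'd (K t) z (s%:C *: v)).
    have -> : 'd (K t) z (s%:C *: v) = s%:C * 'd (K t) z v by rewrite [LHS]linearZ.
    by move: ('d (K t) z v : C) (K t _ : C) (K t _ : C) => *; field.
  rewrite nrN (le_trans (so _ _ svr))// nrZ nrs exprMn.
  move: s2; rewrite ler_pdivlMr// /B => h.
  have -> : c * (s ^+ 2 * nr v ^+ 2) = s * (s * (c * nr v ^+ 2)) by ring.
  by rewrite ler_wpM2l ?(ltW s0)// (le_trans _ h)// ler_wpM2l ?(ltW s0)// lerDl.
pose L0 v := avg (fun t => 'd (K t) z v).
have L0lin : linear L0.
  move=> a u v; rewrite /L0 -[a *: avg _]/(a * avg _) -avgZ; last exact: cd.
  rewrite -avgD; [|by move=> t; apply: cvgMr; exact: cd|exact: cd].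
  by congr avg; apply/funext => t; rewrite linearP.
pose L : {linear V -> C} := HB.pack L0 (GRing.isLinear.Build _ _ _ _ L0 L0lin).
have cL : continuous L.
  apply: (@linear_nr_continuous _ _ _ L (2 * (4 * M / rho))) => v.
  by rewrite -mulrA; apply: avg_norm_le; [exact: cd|move=> t; exact: db].
have c20 : 0 < 2 * c + 1 by lra.
apply: (eps_differentiable cL) => e e0.
exists (Num.min (rho / 4) (e / (2 * c + 1))).
  by rewrite lt_min !divr_gt0.
move=> v; rewrite lt_min => /andP[v1 v2].
have zv : nr (z + v) < rho by rewrite (le_lt_trans (ler_nrD _ _))//; lra.
have zr : nr z < rho by lra.
rewrite -[L v]/(avg (fun t => 'd (K t) z v)) -!avgB; try exact: cK; try exact: cd;
  last by move=> t; apply: cvgB; exact: cK.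
rewrite (@le_trans _ _ (2 * (c * nr v ^+ 2)))//.
  apply: avg_norm_le; last by move=> t; apply/so/ltW.
  by move=> t; apply: cvgB; [apply: cvgB; exact: cK|exact: cd].
rewrite (_ : 2 * (c * nr v ^+ 2) = nr v * (2 * c) * nr v); last by ring.
rewrite ler_wpM2r ?nr_ge0//.
move: v2; rewrite ltr_pdivlMr// => v2.
by rewrite (le_trans _ (ltW v2))// ler_wpM2l ?nr_ge0// lerDl.
Qed.

End Averages.

(** * Division by a coordinate *)

Section Division.
Variable R : realType.
Local Notation C := R[i].

Lemma holomorphic_near0P (V W : normedModType C) (f : V -> W) :
  holomorphic_near0 f ->
  exists rho M : R, [/\ 0 < rho, forall z, nr z < rho -> differentiable f z
    & forall z, nr z < rho -> nr (f z) <= M].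
Proof.
move=> /nbhs_nrP[d d0 df].
have d0' : differentiable f 0 by apply: df; rewrite subrr nr0.
have [d' d'0 hd] := (continuous_nrP f 0).1 (differentiable_continuous d0') _ ltr01.
exists (Num.min d d'), (nr (f 0) + 1); split; first by rewrite lt_min d0.
- by move=> z; rewrite lt_min => /andP[zd _]; apply: df; rewrite subr0.
- move=> z; rewrite lt_min => /andP[_ zd'].
  have := hd z; rewrite subr0 => /(_ zd')/ltW h.
  by rewrite -[f z](subrK (f 0)) (le_trans (ler_nrD _ _))// addrC lerD2l.
Qed.

(** Cauchy's formula is applied on the complex line through [z] in the direction [e], and the
    quotient is an explicit circle average. A general linear form [xi] covers both a coordinate of
    [x] and the parameter [t]. *)
Lemma holo_division (V : normedModType C) (f : V -> C) (xi : {linear V -> C})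
    (e : V) : continuous xi -> xi e = 1 -> holomorphic_near0 f ->
  exists2 h : V -> C, holomorphic_near0 h &
    \forall z \near (0 : V), f z - f (z - xi z *: e) = xi z * h z.
Proof.
move=> cxi xie /holomorphic_near0P[rho [M [rho0 df fM]]].
have [k0 k00 xik0] := linear_lipschitz cxi.
have [k k1 xik] : exists2 k : R, 0 < k & forall z, nr (xi z) <= k * nr z.
  have kE : k0 = (complex.Re k0)%:C by rewrite RRe_real// gtr0_real.
  exists (complex.Re k0); first by rewrite -ltcR -kE.
  by move=> z; have := xik0 z; rewrite !nrE kE -rmorphM lecR.
have M0 : 0 <= M by rewrite (le_trans (nr_ge0 (f 0)))// fM// nr0.
pose P z := z - xi z *: e.
pose r := rho / (2 * (nr e + 1)).
have e1 : 0 < nr e + 1 by rewrite ltr_wpDl ?nr_ge0.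
have r0 : 0 < r by rewrite divr_gt0// mulr_gt0.
have re : r * nr e < rho / 2.
  rewrite (@lt_le_trans _ _ (r * (nr e + 1)))//; first by rewrite ltr_pM2l// ltrDl.
  by rewrite le_eqVlt; apply/orP; left; apply/eqP; rewrite /r; field; rewrite gt_eqF.
have nrr : nr r%:C = r by rewrite nr_real gtr0_norm.
pose K1 := 1 + k * nr e.
have K10 : 0 < K1 by rewrite ltr_pwDl// mulr_ge0 ?nr_ge0// ltW.
(* The first bound keeps the circle around [P z] inside the domain; the second gives
   [nr (xi z) <= r / 2], so the denominators stay at least [r / 2]. *)
pose rho' := Num.min (rho / 2 / K1) (r / (2 * k)).
have rho'0 : 0 < rho' by rewrite lt_min !divr_gt0// mulr_gt0.
have inner z : nr z < rho' -> nr (P z) < rho / 2 /\ nr (xi z) <= r / 2.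
  rewrite lt_min => /andP[z1 z2]; split.
    rewrite (le_lt_trans (ler_nrB _ _))// nrZ.
    move: z1; rewrite ltr_pdivlMr// => /le_lt_trans; apply.
    rewrite /K1 mulrDr mulr1 lerD2l mulrCA mulrA ler_wpM2r ?nr_ge0//.
  rewrite (le_trans (xik z))//.
  move: z2; rewrite ltr_pdivlMr ?mulr_gt0// => /ltW z2.
  by move: z2; move: (nr z) => nz; lra.
have ballP z (s : C) : nr z < rho' -> nr s <= 1 -> nr (P z + (r%:C * s) *: e) < rho.
  move=> /inner[z1 _] s1; rewrite (le_lt_trans (ler_nrD _ _))//.
  rewrite nrZ nrM nrr mulrAC.
  have : r * nr e * nr s <= r * nr e * 1.
    by rewrite ler_wpM2l// mulr_ge0 ?nr_ge0// ltW.
  by move: z1 re; lra.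
have den z t : nr z < rho' -> r / 2 <= nr (r%:C * cexp t - xi z).
  move=> /inner[_ z2].
  have : nr (r%:C * cexp t) <= nr (r%:C * cexp t - xi z) + nr (xi z).
    by rewrite (le_trans _ (ler_nrD _ _))// subrK.
  by rewrite nrM nrr nr_cexp mulr1; lra.
have den0 z t : nr z < rho' -> r%:C * cexp t - xi z != 0.
  move=> z1; rewrite -nr_gt0 (lt_le_trans _ (den _ t z1))// divr_gt0//.
(* With [s0 = xi z / r], the kernels at [s0] and at 0 differ by [xi z / (r * cexp t - xi z)];
   removing the factor [xi z] leaves this integrand. *)
pose K t z := f (P z + (r%:C * cexp t) *: e) / (r%:C * cexp t - xi z).
have nrc t : nr (cexp t) <= 1 by rewrite nr_cexp.
have dxi z : differentiable xi z by exact: linear_differentiable.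
have dP z : differentiable P z.
  apply: (@differentiableB _ _ _ id (fun z => xi z *: e)); first exact: ex_diff.
  exact: differentiableZl.
have dK t z : nr z < rho' -> differentiable (K t) z.
  move=> z1; apply: (@differentiableM _ _ (fun z => f (P z + (r%:C * cexp t) *: e))
    (fun z => (r%:C * cexp t - xi z)^-1)).
    apply: (@differentiable_comp _ _ _ _ (fun z => P z + (r%:C * cexp t) *: e) f).
      apply: (@differentiableD _ _ _ P (cst ((r%:C * cexp t) *: e))) => //.
    by apply: df; exact: ballP.
  apply: differentiableV; last exact: den0.
  apply: (@differentiableB _ _ _ (cst (r%:C * cexp t)) xi) => //.
have KM t z : nr z < rho' -> nr (K t z) <= M * (2 / r).
  move=> z1; rewrite nrM nrV ler_pM ?nr_ge0 ?invr_ge0 ?nr_ge0//.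
    exact/fM/ballP.
  have r20 : 0 < r / 2 by lra.
  rewrite -[2 / r]invf_div lef_pV2 ?posrE ?den//.
  by rewrite (lt_le_trans _ (den _ t z1)).
have cr : continuous (fun t => r%:C * cexp t).
  by move=> t; apply: cvgMr; exact: continuous_cexp.
have cK z : nr z < rho' -> continuous (K^~ z).
  move=> z1 t; apply: cvgM.
    apply: (@continuous_comp _ _ _ (fun t => P z + (r%:C * cexp t) *: e) f).
      apply: cvgD; first exact: cvg_cst.
      by apply: cvgZl; exact: cr.
    by apply/differentiable_continuous/df/ballP.
  apply: cvgV; first exact: den0.
  by apply: cvgB; [exact: cr|exact: cvg_cst].
exists (fun z => avg (K^~ z)).
  apply/nbhs_nrP; exists (rho' / 2); first by rewrite divr_gt0.
  by move=> z; rewrite subr0; exact: (differentiable_avg rho'0 dK KM cK).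
apply/nbhs_nrP; exists rho' => // z; rewrite subr0 => z1.
pose phi (s : C) := f (P z + (r%:C * s) *: e).
have dphi s : nr s <= 1 -> differentiable phi s.
  move=> s1; apply: (@differentiable_comp _ _ _ _ (fun s : C => P z + (r%:C * s) *: e) f).
    apply: (@differentiableD _ _ _ (cst (P z)) (fun s : C => (r%:C * s) *: e)) => //.
    apply: differentiableZl.
    by apply: (@differentiableZ _ _ _ (@id C) r%:C); exact: ex_diff.
  by apply: df; exact: ballP.
pose s0 := xi z / r%:C.
have rn0 : r%:C != 0 :> C by rewrite -nr_gt0 nrr.
have s01 : nr s0 < 1.
  have [_] := inner _ z1.
  rewrite nrM nrV nrr ltr_pdivrMr// mul1r => /le_lt_trans; apply; lra.
have n0 : nr (0 : C) < 1 by rewrite nr0.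
have <- : phi s0 = f z by rewrite /phi /s0 mulrCA mulfV// mulr1 subrK.
have <- : phi 0 = f (P z) by rewrite /phi mulr0 scale0r addr0.
rewrite (cauchy_formula s01 dphi) (cauchy_formula n0 dphi).
have cphi (s : C) : nr s < 1 -> continuous (fun t => phi (cexp t) * ckern s t).
  move=> s1 t; apply: cvgM; last exact: continuous_ckern.
  apply: (@continuous_comp _ _ _ (@cexp R) phi); first exact: continuous_cexp.
  by apply/differentiable_continuous/dphi.
rewrite -avgB -?avgZ; [|exact: cK|exact: cphi|exact: cphi].
congr avg; apply/funext => t; rewrite -mulrBr /K /phi [RHS]mulrCA; congr (_ * _).
rewrite /ckern subr0 divff ?cexp_neq0//.
have d1 := den0 z t z1; have d2 := cexp_subr_neq0 t s01.
rewrite /s0 in d2 *.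
by field; apply/andP; split; [exact: d1|exact: rn0].
Qed.

(** After rescaling to the unit disc, either all Taylor coefficients vanish, and so does [c], or the
    first nonzero one gives the order. The cofactor [u] is the Taylor remainder. *)
Lemma holo_order (c : C -> C) : holomorphic_near0 c ->
  (\forall t \near (0 : C), c t = 0) \/
  exists k (u : C -> C), [/\ {for 0, continuous u}, u 0 != 0 &
    \forall t \near (0 : C), c t = t ^+ k * u t].
Proof.
move=> /holomorphic_near0P[rho [M [rho0 dc cM]]].
pose r := rho / 2; have r0 : 0 < r by rewrite divr_gt0.
have rr : r < rho by rewrite /r; lra.
have nrr : nr r%:C = r by rewrite nr_real gtr0_norm.
have rn0 : r%:C != 0 :> C by rewrite -nr_gt0 nrr.
pose phi (s : C) := c (r%:C * s).
have ball s : nr s <= 1 -> nr (r%:C * s) < rho.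
  move=> s1; rewrite nrM nrr (le_lt_trans _ rr)// -[leRHS]mulr1.
  by rewrite ler_wpM2l// ltW.
have dphi s : nr s <= 1 -> differentiable phi s.
  move=> s1; apply: (@differentiable_comp _ _ _ _ (fun s : C => r%:C * s) c).
    by apply: (@differentiableZ _ _ _ (@id C) r%:C); exact: ex_diff.
  by apply: dc; exact: ball.
have phiM s : nr s <= 1 -> nr (phi s) <= M by move=> s1; apply/cM/ball.
have cE t : c t = phi (t / r%:C) by rewrite /phi mulrCA mulfV// mulr1.
have nrtr (t : C) : nr (t / r%:C) = nr t / r by rewrite nrM nrV nrr.
have [a0|] := pselect (forall k, taylor_coef phi k = 0).
  left; apply/nbhs_nrP; exists (r / 2); first by rewrite divr_gt0.
  move=> t; rewrite subr0 => tr; rewrite cE.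
  apply: (taylor_coef_eq0 dphi phiM) => //.
  by rewrite nrtr ler_pdivrMr// mulrC mulrA mulr1 ltW.
move=> /existsNP/cid[k0 /eqP ak0]; right.
have ex : exists k, taylor_coef phi k != 0 by exists k0.
case: (ex_minnP ex) => k ak kmin.
have ltk j : (j < k)%N -> taylor_coef phi j = 0.
  by move=> jk; apply/eqP; apply: contraLR jk => /kmin; rewrite -leqNgt.
have [fE [rem0 crem]] := taylor_order dphi phiM ltk.
exists k, (fun t => r%:C ^- k * taylor_rem phi k (t / r%:C)); split.
- have cu : {for 0, continuous (taylor_rem phi k \o (fun t : C => t / r%:C))}.
    apply: continuous_comp; last by rewrite mul0r.
    by apply: (@cvgMl _ _ (nbhs (0 : C)) _ id); exact: cvg_id.
  exact: (@cvgMr _ _ (nbhs (0 : C)) _ _ _ _ cu).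
- by rewrite mul0r rem0 mulf_neq0// invr_eq0 expf_neq0.
- apply/nbhs_nrP; exists r => // t; rewrite subr0 => tr.
  rewrite cE fE; last by rewrite nrtr ltr_pdivrMr// mul1r.
  by rewrite /= exprMn exprVn; apply/esym/mulrA.
Qed.

End Division.

(** * Ideals and reductions in a local ring *)

Section IdealTheory.
Variable A : comNzRingType.
Implicit Types (I J B M G : set A) (x y z : A) (s : seq A).

Lemma ideal_gen_ideal G : is_ideal (ideal_gen G).
Proof.
split.
- by move=> I [[]].
- by move=> x y Gx Gy I [hI GI]; case: (hI) => _ hD _; apply: hD; [exact: Gx|exact: Gy].
- by move=> a x Gx I [hI GI]; case: (hI) => _ _; apply; exact: Gx.
Qed.
#[local] Hint Resolve ideal_gen_ideal : core.

Lemma sub_ideal_gen G : G `<=` ideal_gen G.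
Proof. exact: sub_gen_smallest. Qed.

Lemma ideal_gen_min G I : is_ideal I -> G `<=` I -> ideal_gen G `<=` I.
Proof. by move=> hI GI; exact: smallest_sub. Qed.

Lemma is_ideal0 I : is_ideal I -> I 0. Proof. by case. Qed.

Lemma is_idealD I x y : is_ideal I -> I x -> I y -> I (x + y).
Proof. by case=> _ h _; exact: h. Qed.

Lemma is_idealMl I a x : is_ideal I -> I x -> I (a * x).
Proof. by case=> _ _; apply. Qed.

Lemma is_idealMr I a x : is_ideal I -> I x -> I (x * a).
Proof. by move=> hI Ix; rewrite mulrC; exact: is_idealMl. Qed.

Lemma is_idealN I x : is_ideal I -> I x -> I (- x).
Proof. by move=> hI Ix; rewrite -mulN1r; exact: is_idealMl. Qed.

Lemma is_idealB I x y : is_ideal I -> I x -> I y -> I (x - y).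
Proof. by move=> hI Ix Iy; apply: is_idealD => //; exact: is_idealN. Qed.

Lemma is_ideal_sum I (T : Type) (r : seq T) (P : pred T) (F : T -> A) : is_ideal I ->
  (forall i, P i -> I (F i)) -> I (\sum_(i <- r | P i) F i).
Proof.
move=> hI IF; apply: big_ind => //; first exact: is_ideal0.
by move=> x y; exact: is_idealD.
Qed.

(** Lets a statement about products be checked on generators of one factor at a time. *)
Lemma ideal_colon B z : is_ideal B -> is_ideal [set x | B (x * z)].
Proof.
move=> hB; split => /=.
- by rewrite mul0r; exact: is_ideal0.
- by move=> x y Bx By; rewrite mulrDl; exact: is_idealD.
- by move=> a x Bx; rewrite -mulrA; exact: is_idealMl.
Qed.

Lemma ideal_add I J : is_ideal I -> is_ideal J ->
  is_ideal [set x | exists y z, [/\ I y, J z & x = y + z]].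
Proof.
move=> hI hJ; split => /=.
- by exists 0, 0; rewrite addr0; split=> //; exact: is_ideal0.
- move=> _ _ [y [z [Iy Jz ->]]] [y' [z' [Iy' Jz' ->]]].
  by exists (y + y'), (z + z'); split; [exact: is_idealD|exact: is_idealD|rewrite addrACA].
- move=> a _ [y [z [Iy Jz ->]]].
  by exists (a * y), (a * z); split; [exact: is_idealMl|exact: is_idealMl|rewrite mulrDr].
Qed.

Lemma ideal_setT : is_ideal [set: A]. Proof. by []. Qed.

Lemma ideal_mul_ideal I J : is_ideal (ideal_mul I J).
Proof. exact: ideal_gen_ideal. Qed.
#[local] Hint Resolve ideal_mul_ideal : core.

Lemma mem_ideal_mul I J x y : I x -> J y -> ideal_mul I J (x * y).
Proof. by move=> Ix Jy; apply: sub_ideal_gen; exists x => //; exists y. Qed.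

Lemma ideal_mul_min I J B : is_ideal B -> (forall x y, I x -> J y -> B (x * y)) ->
  ideal_mul I J `<=` B.
Proof. by move=> hB h; apply: ideal_gen_min => // _ [x Ix [y Jy <-]]; exact: h. Qed.

Lemma ideal_mul_min_r I J B z : is_ideal B ->
  (forall x y, I x -> J y -> B (x * y * z)) ->
  forall x, ideal_mul I J x -> B (x * z).
Proof. by move=> hB h; apply: (@ideal_mul_min I J _ (ideal_colon z hB)). Qed.

Lemma ideal_mul_subr I J : is_ideal J -> ideal_mul I J `<=` J.
Proof. by move=> hJ; apply: ideal_mul_min => // x y _; exact: is_idealMl. Qed.

Lemma ideal_mul_subl I J : is_ideal I -> ideal_mul I J `<=` I.
Proof. by move=> hI; apply: ideal_mul_min => // x y Ix _; exact: is_idealMr. Qed.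

Lemma ideal_mulS I I' J J' : I `<=` I' -> J `<=` J' ->
  ideal_mul I J `<=` ideal_mul I' J'.
Proof.
move=> II JJ; apply: ideal_mul_min => // x y /II Ix /JJ Jy.
exact: mem_ideal_mul.
Qed.

Lemma ideal_exp_ideal I k : is_ideal (ideal_exp I k).
Proof. by case: k => [|k]; [exact: ideal_setT|exact: ideal_mul_ideal]. Qed.
#[local] Hint Resolve ideal_exp_ideal : core.

Lemma mem_ideal_expD I p q x y : ideal_exp I p x -> ideal_exp I q y ->
  ideal_exp I (p + q) (x * y).
Proof.
elim: p x => [|p ih] x hx hy; first exact: is_idealMl.
rewrite addSn; move: x hx; apply: ideal_mul_min_r => // a b Ia Ib.
by rewrite -mulrA; apply: mem_ideal_mul => //; exact: ih.
Qed.

Lemma mem_ideal_exp1 I x : I x -> ideal_exp I 1 x.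
Proof. by move=> Ix; rewrite -[x]mulr1; exact: mem_ideal_mul. Qed.

Lemma mem_ideal_expX I p k x : ideal_exp I p x -> ideal_exp I (p * k) (x ^+ k).
Proof.
move=> Ix; elim: k => [|k ih]; first by rewrite muln0.
by rewrite mulnS exprS; exact: mem_ideal_expD.
Qed.

Lemma mem_ideal_exp_prod I m (g : 'I_m -> A) (a : 'I_m -> nat) : (forall i, I (g i)) ->
  ideal_exp I (\sum_i a i) (\prod_i g i ^+ a i).
Proof.
move=> Ig; elim/big_rec2: _ => // i k x _ Ix; apply: mem_ideal_expD => //.
by rewrite -[X in ideal_exp I X]mul1n; apply: mem_ideal_expX; exact: mem_ideal_exp1.
Qed.

Lemma ideal_exp_le I p q : (p <= q)%N -> ideal_exp I q `<=` ideal_exp I p.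
Proof.
move=> /subnK <-; elim: (q - p)%N => [//|k ih]; rewrite addSn.
by apply: subset_trans ih; exact: ideal_mul_subr.
Qed.

Lemma ideal_expS I J k : I `<=` J -> ideal_exp I k `<=` ideal_exp J k.
Proof. by move=> IJ; elim: k => [//|k ih]; exact: ideal_mulS. Qed.

Lemma ideal_mul_expD I J p q x y : ideal_exp I q x -> ideal_mul J (ideal_exp I p) y ->
  ideal_mul J (ideal_exp I (p + q)) (y * x).
Proof.
move=> Ix; move: y; apply: ideal_mul_min_r => // a b Ja Ib.
by rewrite -mulrA; apply: mem_ideal_mul => //; exact: mem_ideal_expD.
Qed.

(** The inclusion of [J I^r] in [I^(r+1)] follows from that of [J] in [I], and passing from [r] to
    [r.+1] makes the exponent positive. *)
Lemma reductionP J I : J `<=` I ->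
  (exists r, ideal_exp I r.+1 `<=` ideal_mul J (ideal_exp I r)) -> reduction J I.
Proof.
move=> JI [r hr]; split=> //; exists r.+1; split=> //; apply/seteqP; split.
  apply: ideal_mul_min => // x y Ix /hr Jy; rewrite mulrC -[r.+1]addn1.
  by apply: ideal_mul_expD => //; exact: mem_ideal_exp1.
exact: ideal_mulS.
Qed.

(** From [I^(r+1) = G I^r], induction gives the inclusion of [I^(k+r)] in [G^k I^r]. For [k = q + 1]
    the power of [G] is [J G^q], and [G^q I^r] lies in [I^(q+r)]. *)
Lemma reduction_trans J G I : reduction J G -> reduction G I -> reduction J I.
Proof.
move=> [JG [q [_ hq]]] [GI [r [_ hr]]].
apply: reductionP; first exact: subset_trans GI.
exists (q + r)%N.
pose T k := ideal_mul (ideal_exp G k) (ideal_exp I r).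
have TS k x y : I x -> T k y -> T k.+1 (y * x).
  move=> Ix; move: y; apply: ideal_mul_min_r; first exact: ideal_mul_ideal.
  move=> a b Ga Ib; have : ideal_exp I r.+1 (x * b) by exact: mem_ideal_mul.
  rewrite hr; have -> : a * b * x = x * b * a by ring.
  move: (x * b); apply: ideal_mul_min_r; first exact: ideal_mul_ideal.
  move=> g b' Gg Ib'; rewrite mulrAC; apply: mem_ideal_mul => //.
  exact: mem_ideal_mul.
have IT k : ideal_exp I (k + r) `<=` T k.
  elim: k => [|k ih].
    by move=> x Ix; rewrite -[x]mul1r; exact: mem_ideal_mul.
  rewrite addSn; apply: ideal_mul_min; first exact: ideal_mul_ideal.
  by move=> x y Ix /ih Ty; rewrite mulrC; exact: TS.
rewrite -addSn; apply: (subset_trans (IT _)); rewrite /T hq.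
apply: ideal_mul_min => // x y + Iy; move: x; apply: ideal_mul_min_r => // a b Ja Gb.
rewrite -mulrA; apply: mem_ideal_mul => //; apply: mem_ideal_expD => //.
exact: (ideal_expS GI).
Qed.

Lemma reduction_refl I : is_ideal I -> reduction I I.
Proof. by move=> hI; apply: reductionP => //; exists 0%N. Qed.

(** [I^(r+1)] lies in [J]. This carries powers of the variables over to the reduction, so that
    another generator can be removed. *)
Lemma reduction_pow J I x : is_ideal J -> reduction J I -> I x -> exists k, J (x ^+ k).
Proof.
move=> hJ [_ [r [_ hr]]] Ix; exists r.+1.
apply: (@ideal_mul_subl J (ideal_exp I r)) => //; rewrite -hr -[X in ideal_exp I X]mul1n.
by apply: mem_ideal_expX; exact: mem_ideal_exp1.
Qed.

Definition fin_gen I := exists s, I = ideal_gen [set x | x \in s].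

Lemma fin_gen_range m (g : 'I_m -> A) : fin_gen (ideal_gen (range g)).
Proof.
exists [seq g i | i <- enum 'I_m]; congr ideal_gen; apply/seteqP; split.
  by move=> _ [i _ <-] /=; apply: map_f; rewrite mem_enum.
by move=> x /= /mapP[i _ ->]; exists i.
Qed.

Lemma fin_gen_mul I J : fin_gen I -> fin_gen J -> fin_gen (ideal_mul I J).
Proof.
move=> [s ->] [t ->]; exists [seq x * y | x <- s, y <- t].
apply/seteqP; split.
  apply: ideal_mul_min => // x y + yt; move: x.
  apply: (@ideal_gen_min _ _ (ideal_colon _ (ideal_gen_ideal _))) => x xs /=.
  rewrite mulrC; move: y yt.
  apply: (@ideal_gen_min _ _ (ideal_colon _ (ideal_gen_ideal _))) => y yt /=.
  by apply: sub_ideal_gen; rewrite /= mulrC; apply/allpairsP; exists (x, y).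
apply: ideal_gen_min => // _ /= /allpairsP[[x y] [/= xs yt ->]].
by apply: mem_ideal_mul; exact: sub_ideal_gen.
Qed.

Lemma fin_gen_exp I k : fin_gen I -> fin_gen (ideal_exp I k).
Proof.
move=> fI; elim: k => [|k ih]; last exact: fin_gen_mul.
exists [:: 1]; apply/esym/seteqP; split=> // x _.
have h1 : ideal_gen [set y : A | y \in [:: 1]] 1.
  by apply: sub_ideal_gen; rewrite /= mem_head.
by have := is_idealMl x (ideal_gen_ideal _) h1; rewrite mulr1.
Qed.

(** * Nakayama's lemma and criteria for a reduction *)

Section Local.
Variable M : set A.
Hypothesis M_ideal : is_ideal M.
Hypothesis M_local : forall a, M a -> exists u, u * (1 - a) = 1.

(** The sum of the [M x] for [x] in [s], in a recursive form that isolates the coefficient of the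
    head. *)
Fixpoint comb s : set A :=
  if s is x :: s' then [set z | exists a y, [/\ M a, comb s' y & z = a * x + y]]
  else [set 0].

Lemma comb_ideal s : is_ideal (comb s).
Proof.
elim: s => [|x s ih] /=.
  by split=> //= [x y -> ->|a x ->]; rewrite ?addr0 ?mulr0.
split=> /=.
- by exists 0, 0; rewrite mul0r addr0; split=> //; exact: is_ideal0.
- move=> _ _ [a [y [Ma ys ->]]] [b [z [Mb zs ->]]]; exists (a + b), (y + z).
  by split; [exact: is_idealD|exact: is_idealD|rewrite mulrDl addrACA].
- move=> c _ [a [y [Ma ys ->]]]; exists (c * a), (c * y).
  by split; [exact: is_idealMl|exact: is_idealMl|rewrite mulrDr mulrA].
Qed.

Lemma mem_comb s a x : M a -> x \in s -> comb s (a * x).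
Proof.
move=> Ma; elim: s => [//|y s ih]; rewrite inE => /predU1P[<-|xs] /=.
  by exists a, 0; rewrite addr0; split=> //; apply: is_ideal0; exact: comb_ideal.
by exists 0, (a * x); rewrite mul0r add0r; split=> //; [exact: is_ideal0|exact: ih].
Qed.

Lemma comb_sub s B : is_ideal B -> (forall x, x \in s -> B x) -> comb s `<=` B.
Proof.
move=> hB; elim: s => [|z s ih] hs y /=; first by move=> ->; exact: is_ideal0.
move=> [c [w [Mc ws ->]]]; apply: is_idealD => //.
  by apply: is_idealMl => //; apply: hs; rewrite mem_head.
by apply: ih => // v vs; apply: hs; rewrite inE vs orbT.
Qed.

(** Instead of a determinant, elimination: the relation for the head [x] is solved for [x] by
    inverting [1 - a], substituted into the others, and the shorter list is handled by induction. *)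
Lemma nakayama_seq s B : is_ideal B ->
  (forall x, x \in s -> exists b y, [/\ B b, comb s y & x = b + y]) ->
  forall x, x \in s -> B x.
Proof.
move=> hB; elim: s => [//|x s ih] h.
have [b [_ [Bb [a [y [Ma ys ->]]] xE]]] := h x (mem_head _ _).
have [u ua] := M_local Ma.
have xE' : x = u * b + u * y.
  rewrite -mulrDr -[LHS]mul1r -ua -mulrA; congr (_ * _).
  by rewrite mulrBl mul1r {1}xE; ring.
have hs z : z \in s -> B z.
  apply: ih => z' z's.
  have [|b' [_ [Bb' [a' [y' [Ma' ys' ->]]] ->]]] := h z'.
    by rewrite inE z's orbT.
  exists (b' + a' * (u * b)), (a' * (u * y) + y'); split.
  - by apply: is_idealD => //; do 2!apply: is_idealMl => //.
  - have hc := comb_ideal s; apply: is_idealD => //.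
    by apply: (is_idealMl _ hc); apply: (is_idealMl _ hc).
  - by rewrite {1}xE'; ring.
have By : B y by exact: comb_sub hs _ ys.
move=> z; rewrite inE => /predU1P[->|/hs//].
by rewrite xE'; apply: is_idealD => //; exact: is_idealMl.
Qed.

Lemma nakayama I B : fin_gen I -> is_ideal B ->
  (forall x, I x -> exists b y, [/\ B b, ideal_mul M I y & x = b + y]) -> I `<=` B.
Proof.
move=> [s IE] hB h; rewrite {1}IE; apply: ideal_gen_min => // x /= xs.
move: x xs; apply: nakayama_seq => // x xs.
have [|b [y [Bb My ->]]] := h x; first by rewrite IE; exact: sub_ideal_gen.
exists b, y; split=> //; move: y My; apply: ideal_mul_min; first exact: comb_ideal.
move=> a y Ma; rewrite IE mulrC; move: y.
apply: (@ideal_gen_min _ _ (ideal_colon _ (comb_ideal _))) => y ys /=.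
by rewrite mulrC; exact: mem_comb.
Qed.

(* A relation among the powers [x^0, ..., x^q] is its lowest term times a unit. *)
Lemma power_of_relation q (Q : set A) (x : A) (v : 'I_q.+1 -> A) : is_ideal Q ->
  M x -> (forall i, v i = 0 \/ exists u, u * v i = 1) -> (exists i, v i != 0) ->
  Q (\sum_i v i * x ^+ i) -> Q (x ^+ q).
Proof.
move=> hQ Mx vu [i0 vi0] Qs.
have [k vk kmin] :=
  @arg_minnP _ i0 (fun i => v i != 0) (fun i : 'I_q.+1 => (i : nat)) vi0.
have [u0 u0E] : exists u, u * v k = 1.
  by case: (vu k) => // /eqP; rewrite (negbTE vk).
(* The terms after the lowest one, divided by [x ^+ k.+1]; those before it vanish by minimality. *)
pose w := \sum_(i < q.+1 | i != k) (if (k < i)%N then v i * x ^+ (i - k.+1) else 0).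
have hw : \sum_(i | i != k) v i * x ^+ i = x ^+ k.+1 * w.
  rewrite mulr_sumr; apply: eq_bigr => i ik; case: ltnP => ki.
    by rewrite mulrCA -exprD subnKC.
  have -> : v i = 0.
    apply/eqP; apply: contraTT ki => /kmin ki.
    by rewrite -ltnNge ltn_neqAle ki andbT eq_sym.
  by rewrite mul0r mulr0.
have [u uE] := M_local (is_idealMr (- u0 * w) M_ideal Mx).
have xk : Q (x ^+ k).
  have := is_idealMl (u * u0) hQ Qs; rewrite (bigD1 k)//= hw exprS.
  have -> : u * u0 * (v k * x ^+ k + x * x ^+ k * w) =
    x ^+ k * (u * (u0 * v k + x * (u0 * w))) by ring.
  have -> : u * (u0 * v k + x * (u0 * w)) = u * (1 - x * (- u0 * w)).
    by rewrite u0E; ring.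
  by rewrite uE mulr1.
by rewrite -(subnK (ltn_ord k : (k <= q)%N)) exprD; exact: is_idealMl.
Qed.

(* A substitute for [J * I ^ (k - 1)] that makes sense for [k = 0]. *)
Definition defect J I k := [set d | forall x, I x -> ideal_mul J (ideal_exp I k) (d * x)].

Lemma defect_ideal J I k : is_ideal (defect J I k).
Proof.
have hm := ideal_mul_ideal J (ideal_exp I k).
split=> /= [x _|x y hx hy z Iz|a x hx z Iz].
- by rewrite mul0r; exact: is_ideal0.
- by rewrite mulrDl; apply: (is_idealD hm); [exact: hx|exact: hy].
- by rewrite -mulrA; apply: (is_idealMl _ hm); exact: hx.
Qed.

Lemma defect_mul J I p q d x : defect J I p d -> ideal_exp I q x ->
  defect J I (p + q) (d * x).
Proof.
move=> hd Ix z Iz; rewrite mulrAC; apply: ideal_mul_expD => //; exact: hd.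
Qed.

Lemma defect_one J I a : J a -> defect J I 1 a.
Proof. by move=> Ja x Ix; apply: mem_ideal_mul => //; exact: mem_ideal_exp1. Qed.

Lemma reduction_of_power J I g j d y : is_ideal I -> fin_gen I -> J `<=` I -> I g ->
  (forall x, I x -> exists z a, [/\ J z & x = z + a * g]) ->
  defect J I j d -> ideal_mul M (ideal_exp I j) y -> g ^+ j = d + y ->
  reduction J I.
Proof.
move=> hI fI JI Ig IE Dd My gE.
have pow k x : ideal_exp I k x -> exists z a, [/\ defect J I k z & x = z + a * g ^+ k].
  elim: k x => [|k ih].
    by move=> x _; exists 0, x; rewrite add0r mulr1; split=> //; exact: (is_ideal0 (defect_ideal J I 0)).
  have hS : is_ideal [set x | exists z a, defect J I k.+1 z /\ x = z + a * g ^+ k.+1].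
    have hD := defect_ideal J I k.+1.
    split=> /=.
    - by exists 0, 0; rewrite mul0r addr0; split=> //; exact: (is_ideal0 hD).
    - move=> _ _ [z [a [hz ->]]] [z' [a' [hz' ->]]]; exists (z + z'), (a + a').
      by split; [exact: (is_idealD hD)|rewrite mulrDl addrACA].
    - move=> b _ [z [a [hz ->]]]; exists (b * z), (b * a).
      by split; [exact: (is_idealMl _ hD)|rewrite mulrDr mulrA].
  suff : ideal_exp I k.+1 `<=` [set x | exists z a, defect J I k.+1 z /\ x = z + a * g ^+ k.+1].
    by move=> h x /h[z [a []]]; exists z, a.
  apply: ideal_mul_min => // x y' /IE[z [a [Jz ->]]] Iy.
  have [d' [b [Dd' yE]]] := ih _ Iy.
  exists (z * y' + d' * g * a), (a * b); split; last by rewrite yE exprS; ring.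
  have hD := defect_ideal J I k.+1.
  apply: (is_idealD hD).
    by rewrite -add1n; apply: defect_mul => //; exact: defect_one.
  apply: (is_idealMr _ hD); rewrite -addn1; apply: defect_mul => //; exact: mem_ideal_exp1.
apply: reductionP => //; exists j.
apply: nakayama => //; first exact: fin_gen_exp.
have hS := ideal_add (ideal_mul_ideal J (ideal_exp I j)) (ideal_mul_ideal M (ideal_exp I j.+1)).
apply: (ideal_mul_min hS) => x y' Ix /pow[z [a [Dz ->]]].
exists (z * x + a * (d * x)), (a * (y * x)); split.
- have hm := ideal_mul_ideal J (ideal_exp I j).
  by apply: (is_idealD hm); [exact: Dz|apply: (is_idealMl _ hm); exact: Dd].
- apply: (is_idealMl _ (ideal_mul_ideal M (ideal_exp I j.+1))).
  rewrite -addn1; apply: ideal_mul_expD => //; exact: mem_ideal_exp1.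
- by rewrite gE; ring.
Qed.

(** Modulo [J], [c_0 g_i] agrees with [c_i g_0], so for the form [Q] of degree [j] the element
    [c_0^j Q(g)] agrees with [g_0^j Q(c)] up to a defect. As [Q(c)] is a unit, [g_0^j] is a defect
    plus an element of [M I^j]. *)
Lemma reduction_of_relation (m L : nat) (g c : 'I_m.+1 -> A)
    (alpha : 'I_L -> 'I_m.+1 -> nat) (b : 'I_L -> A) (j : nat) (u v : A) :
  let I := ideal_gen (range g) in
  let P e := (\sum_i alpha e i == j)%N in
  v * c ord0 = 1 ->
  u * (\sum_(e | P e) b e * \prod_i c i ^+ alpha e i) = 1 ->
  ideal_mul M (ideal_exp I j) (\sum_(e | P e) b e * \prod_i g i ^+ alpha e i) ->
  reduction (ideal_gen (range (fun i : 'I_m =>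
    c ord0 * g (lift ord0 i) - c (lift ord0 i) * g ord0))) I.
Proof.
move=> I P vc uc rel.
set J := ideal_gen _.
have hI : is_ideal I by exact: ideal_gen_ideal.
have hJ : is_ideal J by exact: ideal_gen_ideal.
have Ig i : I (g i) by apply: sub_ideal_gen; exists i.
have Jl i : J (c ord0 * g i - c i * g ord0).
  case: (unliftP ord0 i) => [k ->|->]; last by rewrite subrr; exact: (is_ideal0 hJ).
  by apply: sub_ideal_gen; exists k.
have JI : J `<=` I.
  apply: ideal_gen_min => // _ [i _ <-].
  by apply: (is_idealB hI); exact: (is_idealMl _ hI).
have IE x : I x -> exists z a, [/\ J z & x = z + a * g ord0].
  have hS : is_ideal [set x | exists z a, J z /\ x = z + a * g ord0].
    split=> /=.
    - by exists 0, 0; rewrite mul0r addr0; split=> //; exact: (is_ideal0 hJ).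
    - move=> _ _ [z [a [hz ->]]] [z' [a' [hz' ->]]]; exists (z + z'), (a + a').
      by split; [exact: (is_idealD hJ)|rewrite mulrDl addrACA].
    - move=> k _ [z [a [hz ->]]]; exists (k * z), (k * a).
      by split; [exact: (is_idealMl _ hJ)|rewrite mulrDr mulrA].
  suff : I `<=` [set x | exists z a, J z /\ x = z + a * g ord0].
    by move=> h /h[z [a []]]; exists z, a.
  apply: ideal_gen_min => // _ [i _ <-] /=.
  exists (v * (c ord0 * g i - c i * g ord0)), (v * c i); split; first exact: (is_idealMl _ hJ).
  by rewrite mulrBr !mulrA vc mul1r subrK.
(* Membership in [I^p] is carried along because a defect of degree [p] times an element of [I^q] is
   a defect of degree [p + q]; this makes the congruence multiplicative. *)
pose cong p x x' := [/\ ideal_exp I p x, ideal_exp I p x' & defect J I p (x - x')].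
have congM p q x x' y y' : cong p x x' -> cong q y y' -> cong (p + q)%N (x * y) (x' * y').
  move=> [h1 h2 h3] [k1 k2 k3]; split; [exact: mem_ideal_expD|exact: mem_ideal_expD|].
  have -> : x * y - x' * y' = (x - x') * y + (y - y') * x' by ring.
  apply: (is_idealD (defect_ideal J I (p + q))); first exact: defect_mul.
  by rewrite addnC; exact: defect_mul.
have cong0 : cong 0%N 1 1.
  by split=> //; rewrite subrr; exact: (is_ideal0 (defect_ideal J I 0)).
have cong1 i : cong 1%N (c ord0 * g i) (c i * g ord0).
  by split; [exact: (mem_ideal_exp1 (is_idealMl _ hI (Ig _)))|exact: (mem_ideal_exp1 (is_idealMl _ hI (Ig _)))|
    exact: defect_one].
have congX i k : cong k ((c ord0 * g i) ^+ k) ((c i * g ord0) ^+ k).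
  elim: k => [//|k ih]; rewrite !exprS -add1n; exact: congM.
have congprod (a : 'I_m.+1 -> nat) : cong (\sum_i a i)%N
    (\prod_i (c ord0 * g i) ^+ a i) (\prod_i (c i * g ord0) ^+ a i).
  by elim/big_rec3: _ => // i k x x' _; exact: congM (congX _ _).
pose Qg := \sum_(e | P e) b e * \prod_i g i ^+ alpha e i.
pose Qc := \sum_(e | P e) b e * \prod_i c i ^+ alpha e i.
have prodE (z : A) (f : 'I_m.+1 -> A) e : P e ->
    \prod_i (z * f i) ^+ alpha e i = z ^+ j * \prod_i f i ^+ alpha e i.
  move=> /eqP <-; rewrite expr_sum -big_split/=.
  by apply: eq_bigr => i _; rewrite exprMn.
have Dd : defect J I j (c ord0 ^+ j * Qg - g ord0 ^+ j * Qc).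
  rewrite /Qg /Qc !mulr_sumr -sumrB.
  apply: is_ideal_sum; first exact: defect_ideal.
  move=> e Pe; rewrite !(mulrCA (_ ^+ j)) -mulrBr -!prodE//.
  apply: (is_idealMl _ (defect_ideal J I j)).
  have [_ _] := congprod (alpha e); rewrite (eqP Pe).
  by under [X in _ - X]eq_bigr do rewrite mulrC.
apply: (@reduction_of_power J I (g ord0) j
   (- u * (c ord0 ^+ j * Qg - g ord0 ^+ j * Qc)) (u * (c ord0 ^+ j * Qg))) => //.
- exact: fin_gen_range.
- exact: (is_idealMl _ (defect_ideal J I j)).
- by do 2!apply: (is_idealMl _ (ideal_mul_ideal M (ideal_exp I j))).
- by rewrite -[LHS]mul1r -uc -/Qc; ring.
Qed.

End Local.
End IdealTheory.

(** * Families of holomorphic functions and their jets *)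

Section Holomorphic.
Variable R : realType.
Local Notation C := R[i].

Section Closure.
Variable V : normedModType C.
Implicit Types f g : V -> C.

Lemma holo_cst (W : normedModType C) (a : W) : holomorphic_near0 (fun _ : V => a).
Proof. by near=> x; exact: differentiable_cst. Unshelve. all: by end_near. Qed.

Lemma holoD f g : holomorphic_near0 f -> holomorphic_near0 g ->
  holomorphic_near0 (fun x => f x + g x).
Proof.
move=> hf hg; near=> x; apply: (@differentiableD _ _ _ f g).
  by near: x; exact: hf.
by near: x; exact: hg.
Unshelve. all: by end_near. Qed.

Lemma holoM f g : holomorphic_near0 f -> holomorphic_near0 g ->
  holomorphic_near0 (fun x => f x * g x).
Proof.
move=> hf hg; near=> x; apply: (@differentiableM _ _ f g).
  by near: x; exact: hf.
by near: x; exact: hg.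
Unshelve. all: by end_near. Qed.

Lemma holoZ a f : holomorphic_near0 f -> holomorphic_near0 (fun x => a * f x).
Proof. by move=> hf; apply: holoM => //; exact: holo_cst. Qed.

Lemma holoB f g : holomorphic_near0 f -> holomorphic_near0 g ->
  holomorphic_near0 (fun x => f x - g x).
Proof.
move=> hf hg; have -> : (fun x => f x - g x) = (fun x => f x + -1 * g x).
  by apply/funext => x; rewrite mulN1r.
by apply: holoD => //; exact: holoZ.
Qed.

Lemma holo_sum (T : Type) (r : seq T) (P : pred T) (F : T -> V -> C) :
  (forall i, holomorphic_near0 (F i)) ->
  holomorphic_near0 (fun x => \sum_(i <- r | P i) F i x).
Proof.
move=> hF; elim: r => [|i r ih].
  by under eq_fun do rewrite big_nil; exact: holo_cst.
under eq_fun do rewrite big_cons.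
by case: (P i) => //; apply: holoD => //; exact: hF.
Qed.

Lemma holo_prod (T : Type) (r : seq T) (P : pred T) (F : T -> V -> C) :
  (forall i, holomorphic_near0 (F i)) ->
  holomorphic_near0 (fun x => \prod_(i <- r | P i) F i x).
Proof.
move=> hF; elim: r => [|i r ih].
  by under eq_fun do rewrite big_nil; exact: holo_cst.
under eq_fun do rewrite big_cons.
by case: (P i) => //; apply: holoM => //; exact: hF.
Qed.

Lemma holoX f k : holomorphic_near0 f -> holomorphic_near0 (fun x => f x ^+ k).
Proof.
move=> hf; elim: k => [|k ih].
  by under eq_fun do rewrite expr0; exact: holo_cst.
by under eq_fun do rewrite exprS; exact: holoM.
Qed.

Lemma holoV f : holomorphic_near0 f -> f 0 != 0 ->
  holomorphic_near0 (fun x => (f x)^-1).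
Proof.
move=> hf f0; have df0 : differentiable f 0 by exact: nbhs_singleton hf.
have [d d0 hd] : exists2 d : R, 0 < d & forall x : V, nr x < d -> f x != 0.
  have nf0 : 0 < nr (f 0) by rewrite nr_gt0.
  have [d d0 hd] := (continuous_nrP f 0).1 (differentiable_continuous df0) _ nf0.
  exists d => // x xd; apply/eqP => fx.
  by have := hd x; rewrite subr0 fx sub0r nrN ltxx => /(_ xd).
near=> x; apply: differentiableV.
  by near: x; exact: hf.
by near: x; apply/nbhs_nrP; exists d => // x; rewrite subr0; exact: hd.
Unshelve. all: by end_near. Qed.

Lemma holo_linear (W : normedModType C) (f : {linear V -> W}) :
  continuous f -> holomorphic_near0 f.
Proof.
by move=> cf; near=> x; exact: linear_differentiable.
Unshelve. all: by end_near. Qed.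

End Closure.

Lemma near0_comp (V V' : normedModType C) (f : V -> V') (P : V' -> Prop) :
  holomorphic_near0 f -> f 0 = 0 ->
  (\forall y \near (0 : V'), P y) -> \forall x \near (0 : V), P (f x).
Proof.
move=> hf f0 hP; have df0 : differentiable f 0 by exact: nbhs_singleton hf.
by apply: (differentiable_continuous df0); rewrite f0.
Qed.

Lemma holo_comp (V V' W : normedModType C) (f : V -> V') (g : V' -> W) :
  holomorphic_near0 f -> f 0 = 0 -> holomorphic_near0 g ->
  holomorphic_near0 (fun x => g (f x)).
Proof.
move=> hf f0 hg; have h := near0_comp hf f0 hg.
near=> x; apply: (@differentiable_comp _ _ _ _ f g).
  by near: x; exact: hf.
by near: x; exact: h.
Unshelve. all: by end_near. Qed.

Lemma near_forall (V : normedModType C) (T : finType) (P : T -> V -> Prop) (v : V) :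
  (forall i, \forall x \near v, P i x) -> \forall x \near v, forall i, P i x.
Proof. by move=> h; apply: filter_forall. Qed.

End Holomorphic.

Section Families.
Variables (R : realType) (n : nat).
Local Notation C := R[i].
Local Notation V := ('rV[C]_n * C)%type.

Lemma nr_pair (z : V) : nr z = Num.max (nr z.1) (nr z.2).
Proof.
apply: complexI; rewrite -nrE prod_normE !nrE.
case: (leP (nr z.1) (nr z.2)) => h.
  by rewrite max_r ?lecR.
by rewrite max_l ?lecR// ltW.
Qed.

Lemma near_slice (P : V -> Prop) : (\forall z \near (0 : V), P z) ->
  \forall t \near (0 : C), \forall x \near (0 : 'rV[C]_n), P (x, t).
Proof.
move=> /nbhs_nrP[d d0 hd]; apply/nbhs_nrP; exists d => // t; rewrite subr0 => td.
apply/nbhs_nrP; exists d => // x; rewrite subr0 => xd.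
by apply: hd; rewrite subr0 nr_pair /= gt_max xd.
Qed.

Lemma holo_slice (W : normedModType C) (f : V -> W) : holomorphic_near0 f ->
  \forall t \near (0 : C), holomorphic_near0 (fun x => f (x, t)).
Proof.
move=> /near_slice; apply: filterS => t; apply: filterS => x df.
apply: (@differentiable_comp _ _ _ _ (fun x : 'rV[C]_n => (x, t)) f) => //.
Qed.

Lemma holo_fst : holomorphic_near0 (fun z : V => z.1).
Proof.
apply: (@holo_linear _ _ _ (@fst _ _ : {linear V -> 'rV[C]_n})) => z.
exact: cvg_fst.
Qed.

Lemma holo_snd : holomorphic_near0 (fun z : V => z.2).
Proof.
apply: (@holo_linear _ _ _ (@snd _ _ : {linear V -> C})) => z.
exact: cvg_snd.
Qed.

Lemma holo_coord_rV m (i : 'I_m) : holomorphic_near0 (fun x : 'rV[C]_m => x 0 i).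
Proof. by near=> x; exact: differentiable_coord. Unshelve. all: by end_near. Qed.

Lemma holo_of_fst (W : normedModType C) (f : 'rV[C]_n -> W) : holomorphic_near0 f ->
  holomorphic_near0 (fun z : V => f z.1).
Proof. by move=> hf; apply: holo_comp holo_fst _ hf. Qed.

Lemma holo_coord (i : 'I_n) : holomorphic_near0 (fun z : V => z.1 0 i).
Proof. exact: (holo_of_fst (holo_coord_rV i)). Qed.

Lemma holo_incl2 : holomorphic_near0 (fun t : C => ((0, t) : V)).
Proof.
near=> t; apply: (@differentiable_pair _ _ _ _ (cst (0 : 'rV[C]_n)) (@id C)).
  exact: differentiable_cst.
exact: ex_diff.
Unshelve. all: by end_near. Qed.

Lemma holo_at0 (W : normedModType C) (f : V -> W) : holomorphic_near0 f ->
  holomorphic_near0 (fun t => f (0, t)).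
Proof. by move=> hf; apply: holo_comp holo_incl2 _ hf. Qed.

(** Written as a subtraction to match the point [z - xi z *: e] of [holo_division]. *)
Definition zero_coord (i : 'I_n) (z : V) : V :=
  (z.1 - z.1 0 i *: delta_mx 0 i, z.2).

Definition zero_upto (k : nat) (z : V) : V :=
  (\row_j (if (j < k)%N then 0 else z.1 0 j), z.2).

Lemma zero_upto_coord (i : 'I_n) z : (zero_upto i z).1 0 i = z.1 0 i.
Proof. by rewrite mxE ltnn. Qed.

Lemma zero_uptoS (i : 'I_n) z : zero_coord i (zero_upto i z) = zero_upto i.+1 z.
Proof.
congr pair; apply/rowP => j; rewrite !mxE eqxx /= ltnn ltnS (leq_eqVlt j i).
have -> : ((j : nat) == i) = (j == i) by [].
by have [->|ne] := eqVneq j i; rewrite /= ?ltnn ?mulr1 ?subrr ?mulr0 ?subr0.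
Qed.

Lemma zero_upto0 z : zero_upto 0 z = z.
Proof. by case: z => x t; congr pair; apply/rowP => j; rewrite mxE. Qed.

Lemma zero_upton z : zero_upto n z = (0, z.2).
Proof. by congr pair; apply/rowP => j; rewrite !mxE ltn_ord. Qed.

Lemma zero_upto_at0 k : zero_upto k 0 = 0.
Proof. by congr pair; apply/rowP => j; rewrite !mxE; case: ifP. Qed.

Lemma holo_zero_coord i : holomorphic_near0 (zero_coord i).
Proof.
near=> z; apply: (@differentiable_pair _ _ _ _
   (fun z : V => z.1 - z.1 0 i *: delta_mx 0 i) snd).
  apply: (@differentiableB _ _ _ fst (fun z : V => z.1 0 i *: delta_mx 0 i)).
    by near: z; exact: holo_fst.
  apply: differentiableZl.
  by near: z; exact: holo_coord.
by near: z; exact: holo_snd.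
Unshelve. all: by end_near. Qed.

Lemma near_zero_upto k (P : V -> Prop) : (k <= n)%N -> (\forall z \near (0 : V), P z) ->
  \forall z \near (0 : V), P (zero_upto k z).
Proof.
elim: k P => [|k ih] P kn hP.
  by apply: filterS hP => z; rewrite zero_upto0.
have h0 : zero_coord (Ordinal kn) 0 = 0.
  by rewrite /zero_coord mxE scale0r subr0.
have := ih _ (ltnW kn) (near0_comp (holo_zero_coord (Ordinal kn)) h0 hP).
by apply: filterS => z; rewrite (zero_uptoS (Ordinal kn)).
Qed.

(** [holo_division] is repeated on the quotient. Evaluating [a k] at [zero_coord i z] expresses that
    the coefficients do not involve [x_i]. *)
Lemma coord_division (N : nat) (i : 'I_n) (f : V -> C) : holomorphic_near0 f ->
  exists (a : 'I_N -> V -> C) (h : V -> C),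
   [/\ forall k, holomorphic_near0 (a k), holomorphic_near0 h &
    \forall z \near (0 : V), f z =
      \sum_(k < N) z.1 0 i ^+ k * a k (zero_coord i z) + z.1 0 i ^+ N * h z].
Proof.
move=> hf; elim: N => [|N [a [h [ha hh E]]]].
  exists (fun _ _ => 0), f; split=> //; first by move=> _; exact: holo_cst.
  by near=> z; rewrite big_ord0 add0r mul1r.
pose xi0 (z : V) := z.1 0 i.
have xi_lin : linear xi0 by move=> c u v; rewrite /xi0 !mxE.
pose xi : {linear V -> C} := HB.pack xi0 (GRing.isLinear.Build _ _ _ _ xi0 xi_lin).
have cxi : continuous xi.
  move=> z; apply: (@continuous_comp _ _ _ (fst : V -> 'rV[C]_n) (fun x : 'rV[C]_n => x 0 i)).
    exact: cvg_fst.
  exact: coord_continuous.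
have xie : xi (delta_mx 0 i, 0) = 1 by rewrite /= /xi0 mxE !eqxx.
have [h' hh' E'] := holo_division cxi xie hh.
(* The new top coefficient is the previous quotient [h], evaluated at [x_i = 0]. *)
exists (fun k => if unlift ord_max k is Some l then a l else h), h'; split=> //.
  by move=> k; case: unlift.
apply: filterS2 E E' => z -> hE.
rewrite big_ord_recr/= unlift_none exprSr -addrA; congr (_ + _).
  apply: eq_bigr => k _; congr (_ ^+ _ * _).
  by have -> : widen_ord (leqnSn N) k = lift ord_max k; [
    apply: val_inj; rewrite /= /bump leqNgt ltn_ord|rewrite liftK].
rewrite -mulrA -mulrDr; congr (_ * _).
have -> : zero_coord i z = z - xi z *: ((delta_mx 0 i, 0) : V).
  by case: z {hE} => x t; congr pair; rewrite /= scaler0 subr0.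
by rewrite -hE addrC subrK.
Unshelve. all: by end_near. Qed.

Lemma jets_upto (N k : nat) : (k <= n)%N ->
  exists (T : finType) (E : T -> 'rV[C]_n -> C),
  [/\ #|T| = (N ^ k)%N, forall b, holomorphic_near0 (E b) &
   forall f : V -> C, holomorphic_near0 f ->
    exists (c : T -> V -> C) (h : 'I_n -> V -> C),
    [/\ forall b, holomorphic_near0 (c b), forall i, holomorphic_near0 (h i) &
     \forall z \near (0 : V), f z =
       \sum_b c b (zero_upto k z) * E b z.1 + \sum_i z.1 0 i ^+ N * h i z]].
Proof.
elim: k => [_|k ih kn].
  exists unit, (fun _ _ => 1); split; first by rewrite card_unit.
    by move=> _; exact: holo_cst.
  move=> f hf; exists (fun _ => f), (fun _ _ => 0); split=> //.
    by move=> _; exact: holo_cst.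
  near=> z; rewrite zero_upto0 (big_pred1 tt); last by case.
  by rewrite mulr1 big1 ?addr0// => i _; rewrite mulr0.
have [T [E [cT hE ET]]] := ih (ltnW kn).
pose i := Ordinal kn.
exists (T * 'I_N)%type, (fun (b : T * 'I_N) x => E b.1 x * x 0 i ^+ b.2); split.
- by rewrite card_prod cT card_ord expnSr.
- by move=> b; apply: holoM => //; apply: holoX; exact: holo_coord_rV.
move=> f /ET[c [h [hc hh fE]]].
have /choice[a /choice[g ag]] : forall b, exists a, exists g, _ :=
  fun b => coord_division N i (hc b).
have cE : \forall z \near (0 : V), forall b, c b (zero_upto k z) =
    \sum_(l < N) z.1 0 i ^+ l * a b l (zero_upto k.+1 z) +
    z.1 0 i ^+ N * g b (zero_upto k z).
  apply: near_forall => b.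
  have [_ _ /(near_zero_upto (ltnW kn))] := ag b.
  by apply: filterS => z; rewrite (zero_upto_coord i) (zero_uptoS i).
have hz : holomorphic_near0 (zero_upto k).
  elim: k kn {ih ET i ag cE c h hc hh fE a g cT} => [|k ihk] kn.
    by have -> : zero_upto 0 = id; [apply/funext => z; rewrite zero_upto0|
      near=> z; exact: ex_diff].
  have -> : zero_upto k.+1 = fun z => zero_coord (Ordinal (ltnW kn)) (zero_upto k z).
    by apply/funext => z; rewrite (zero_uptoS (Ordinal (ltnW kn))).
  apply: holo_comp (ihk (ltnW kn)) (zero_upto_at0 _) _.
  exact: holo_zero_coord.
exists (fun b => a b.1 b.2).
(* Only the cofactor of [x_i ^+ N] changes: it receives the remainders of all the coefficients. *)
exists (fun j z => h j z + (j == i)%:R * \sum_b g b (zero_upto k z) * E b z.1); split.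
- by move=> [b l]; have [] := ag b.
- move=> j; apply: holoD => //; apply: holoZ; apply: holo_sum => b.
  apply: holoM; last exact: holo_of_fst.
  by have [_ hg _] := ag b; apply: holo_comp hz (zero_upto_at0 _) hg.
apply: filterS2 fE cE => z -> cE.
set S := fun z => \sum_b g b (zero_upto k z) * E b z.1.
have -> : \sum_j z.1 0 j ^+ N * (h j z + (j == i)%:R * S z) =
    \sum_j z.1 0 j ^+ N * h j z + z.1 0 i ^+ N * S z.
  under eq_bigr do rewrite mulrDr.
  rewrite big_split /=; congr (_ + _).
  rewrite (bigD1 i)//= eqxx mul1r big1 ?addr0// => j /negbTE ->.
  by rewrite mul0r mulr0.
rewrite [RHS]addrCA [LHS]addrC; congr (_ + _).
rewrite -(pair_bigA _ (fun b l => a b l (zero_upto k.+1 z) * (E b z.1 * z.1 0 i ^+ l)))/=.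
rewrite mulr_sumr -big_split/=; apply: eq_bigr => b _.
rewrite cE mulrDl mulr_suml; congr (_ + _); last by ring.
by apply: eq_bigr => l _; ring.
Unshelve. all: by end_near. Qed.

Lemma jets (N : nat) :
  exists (T : finType) (E : T -> 'rV[C]_n -> C),
  [/\ #|T| = (N ^ n)%N, forall b, holomorphic_near0 (E b) &
   forall f : V -> C, holomorphic_near0 f ->
    exists (c : T -> C -> C) (h : 'I_n -> V -> C),
    [/\ forall b, holomorphic_near0 (c b), forall i, holomorphic_near0 (h i) &
     \forall z \near (0 : V), f z =
       \sum_b c b z.2 * E b z.1 + \sum_i z.1 0 i ^+ N * h i z]].
Proof.
have [T [E [cT hE ET]]] := jets_upto N (leqnn n).
exists T, E; split=> // f /ET[c [h [hc hh fE]]].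
exists (fun b t => c b (0, t)), h; split=> //.
  by move=> b; exact: holo_at0.
by apply: filterS fE => z ->; under eq_bigr do rewrite zero_upton.
Qed.

End Families.

(** * The ring of germs *)

Section Germs.
Variables (R : realType) (n : nat).
Local Notation C := R[i].
Local Notation X := 'rV[C]_n.
Local Notation germ := (@germ R n).
Implicit Types (f g : X -> C).

Lemma val_insub_holo f : holomorphic_near0 f ->
  holo_val (insubd (0 : holo_fun R n) f) = f.
Proof. by move=> /asboolP hf; exact: (@insubdK _ _ (holo_fun R n)). Qed.

Lemma holo_holo_val (f : holo_fun R n) : holomorphic_near0 f.
Proof. by apply/asboolP; exact: holo_valP. Qed.

Lemma pi_germ (f : holo_fun R n) :
  \pi_(Quotient.quot (null_germ (R := R) (n := n)))%qT f = germ f.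
Proof.
rewrite /Defs.germ; congr (\pi_(_)%qT _); apply: val_inj.
exact/esym/val_insub_holo/holo_holo_val.
Qed.

Lemma germ_surj (a : holo_germ R n) : exists2 f, holomorphic_near0 f & a = germ f.
Proof.
exists (repr a); first exact: holo_holo_val.
by rewrite -pi_germ reprK.
Qed.

Lemma germD f g : holomorphic_near0 f -> holomorphic_near0 g ->
  germ (fun x => f x + g x) = germ f + germ g.
Proof.
move=> hf hg; rewrite /Defs.germ -rmorphD; congr (\pi_(_)%qT _); apply: val_inj => /=.
by rewrite val_insub_holo ?val_insub_holo//; exact: holoD.
Qed.

Lemma germM f g : holomorphic_near0 f -> holomorphic_near0 g ->
  germ (fun x => f x * g x) = germ f * germ g.
Proof.
move=> hf hg; rewrite /Defs.germ -rmorphM; congr (\pi_(_)%qT _); apply: val_inj => /=.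
by rewrite val_insub_holo ?val_insub_holo//; exact: holoM.
Qed.

Lemma germ0 : germ (fun=> 0) = 0.
Proof.
rewrite /Defs.germ -(rmorph0 (\pi_(Quotient.quot (null_germ (R := R) (n := n)))%qT)).
congr (\pi_(_)%qT _); apply: val_inj => /=.
by rewrite val_insub_holo//; exact: holo_cst.
Qed.

Lemma germ1 : germ (fun=> 1) = 1.
Proof.
rewrite /Defs.germ -(rmorph1 (\pi_(Quotient.quot (null_germ (R := R) (n := n)))%qT)).
congr (\pi_(_)%qT _); apply: val_inj => /=.
by rewrite val_insub_holo//; exact: holo_cst.
Qed.

Lemma germX f k : holomorphic_near0 f -> germ (fun x => f x ^+ k) = germ f ^+ k.
Proof.
move=> hf; elim: k => [|k ih]; first exact: germ1.
rewrite exprS -ih -germM//; last exact: holoX.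
by congr germ; apply/funext => x; rewrite exprS.
Qed.

Lemma germ_sum (T : Type) (r : seq T) (P : pred T) (F : T -> X -> C) :
  (forall i, holomorphic_near0 (F i)) ->
  germ (fun x => \sum_(i <- r | P i) F i x) = \sum_(i <- r | P i) germ (F i).
Proof.
move=> hF; elim: r => [|i r ih].
  by rewrite big_nil -germ0; congr germ; apply/funext => x; rewrite big_nil.
rewrite big_cons -ih; case: ifP => Pi.
  rewrite -germD//; last exact: holo_sum.
  by congr germ; apply/funext => x; rewrite big_cons Pi.
by congr germ; apply/funext => x; rewrite big_cons Pi.
Qed.

Lemma germ_prod (T : Type) (r : seq T) (P : pred T) (F : T -> X -> C) :
  (forall i, holomorphic_near0 (F i)) ->
  germ (fun x => \prod_(i <- r | P i) F i x) = \prod_(i <- r | P i) germ (F i).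
Proof.
move=> hF; elim: r => [|i r ih].
  by rewrite big_nil -germ1; congr germ; apply/funext => x; rewrite big_nil.
rewrite big_cons -ih; case: ifP => Pi.
  rewrite -germM//; last exact: holo_prod.
  by congr germ; apply/funext => x; rewrite big_cons Pi.
by congr germ; apply/funext => x; rewrite big_cons Pi.
Qed.

Lemma germB f g : holomorphic_near0 f -> holomorphic_near0 g ->
  germ (fun x => f x - g x) = germ f - germ g.
Proof.
move=> hf hg; apply/eqP; rewrite eq_sym subr_eq -germD//; last exact: holoB.
by apply/eqP; congr germ; apply/funext => x; rewrite subrK.
Qed.

Lemma germ_near f g : holomorphic_near0 f -> holomorphic_near0 g ->
  (\forall x \near (0 : X), f x = g x) -> germ f = germ g.
Proof. by move=> hf hg h; apply/(germ_eqP hf hg). Qed.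

Lemma germ_value f g : holomorphic_near0 f -> holomorphic_near0 g ->
  germ f = germ g -> f 0 = g 0.
Proof. by move=> hf hg /(germ_eqP hf hg)/nbhs_singleton. Qed.

Lemma germ_unit f : holomorphic_near0 f -> f 0 != 0 -> exists u, u * germ f = 1.
Proof.
move=> hf f0; exists (germ (fun x => (f x)^-1)); have hV := holoV hf f0.
rewrite -germM// -germ1; apply: germ_near; [exact: holoM|exact: holo_cst|].
have df0 : differentiable f 0 by exact: nbhs_singleton hf.
have nf0 : 0 < nr (f 0) by rewrite nr_gt0.
have [d d0 hd] := (continuous_nrP f 0).1 (differentiable_continuous df0) _ nf0.
apply/nbhs_nrP; exists d => // x xd; rewrite mulVf//; apply/eqP => fx.
by have := hd x xd; rewrite fx sub0r nrN ltxx.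
Qed.

Definition cgerm (a : C) : holo_germ R n := germ (fun=> a).

Lemma cgermM a b : cgerm (a * b) = cgerm a * cgerm b.
Proof. by rewrite /cgerm -germM//; exact: holo_cst. Qed.

Lemma cgerm1 : cgerm 1 = 1. Proof. exact: germ1. Qed.

Lemma cgerm_unit a : a != 0 -> cgerm a^-1 * cgerm a = 1.
Proof. by move=> a0; rewrite -cgermM mulVf// cgerm1. Qed.

Notation maxI := (maximal_ideal R n).

Lemma mem_maximal f : holomorphic_near0 f -> maxI (germ f) <-> f 0 = 0.
Proof.
move=> hf; split; last by move=> f0; exists f.
by move=> [g [hg g0] gf]; rewrite -(germ_value hg hf gf).
Qed.

Lemma maximal_is_ideal : is_ideal maxI.
Proof.
split.
- by rewrite -germ0; apply/mem_maximal => //; exact: holo_cst.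
- move=> _ _ [f [hf f0] <-] [g [hg g0] <-]; rewrite -germD//.
  by apply/mem_maximal; [exact: holoD|rewrite f0 g0 addr0].
- move=> a _ [f [hf f0] <-]; have [g hg ->] := germ_surj a; rewrite -germM//.
  by apply/mem_maximal; [exact: holoM|rewrite f0 mulr0].
Qed.

Lemma maximal_local (a : holo_germ R n) : maxI a -> exists u, u * (1 - a) = 1.
Proof.
move=> [f [hf f0] <-].
have h1 : holomorphic_near0 (fun _ : X => (1 : C)) by exact: holo_cst.
have [|u hu] := germ_unit (holoB h1 hf); first by rewrite f0 subr0 oner_eq0.
by exists u; rewrite -[RHS]hu germB// germ1.
Qed.

Definition xgerm (i : 'I_n) : holo_germ R n := germ (fun x => x 0 i).

Lemma xgerm_maximal i : maxI (xgerm i).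
Proof. by apply/mem_maximal; [exact: holo_coord_rV|rewrite mxE]. Qed.

Definition xpow (N : nat) : set (holo_germ R n) :=
  ideal_gen (range (fun i => xgerm i ^+ N)).

End Germs.

(** * Linear relations over the germs in one variable *)

Section Elimination.
Variable R : realType.
Local Notation C := R[i].
Implicit Types (f g : C -> C).

Definition null0 f := \forall t \near (0 : C), f t = 0.

Lemma continuous_neq0 f : {for 0, continuous f} -> f 0 != 0 ->
  \forall t \near (0 : C), f t != 0.
Proof.
move=> cf f0; have nf0 : 0 < nr (f 0) by rewrite nr_gt0.
have [d d0 hd] := (continuous_nrP f 0).1 cf _ nf0.
apply/nbhs_nrP; exists d => // t td; apply/eqP => ft.
by have := hd t td; rewrite ft sub0r nrN ltxx.
Qed.

Lemma small_neq0 (d : R) : 0 < d -> exists2 t : C, t != 0 & nr t < d.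
Proof.
move=> d0; exists (d / 2)%:C.
  by rewrite -nr_gt0 nr_real normr_gt0 gt_eqF// divr_gt0.
by rewrite nr_real gtr0_norm ?divr_gt0//; lra.
Qed.

Lemma holo_nonzero f : holomorphic_near0 f -> ~ null0 f ->
  \forall t \near (0 : C), t != 0 -> f t != 0.
Proof.
move=> hf nf; case: (holo_order hf) => [//|[k [u [cu u0 fE]]]].
apply: filterS2 fE (continuous_neq0 cu u0) => t -> ut t0.
by rewrite mulf_neq0// expf_neq0.
Qed.

(** Zeros are isolated, and there are nonzero points arbitrarily close to 0. *)
Lemma null0_mul f g : holomorphic_near0 f -> holomorphic_near0 g ->
  ~ null0 f -> ~ null0 g -> ~ null0 (fun t => f t * g t).
Proof.
move=> hf hg nf ng nfg.
have nfalse : \forall t \near (0 : C), t = 0.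
  apply: filterS3 nfg (holo_nonzero hf nf) (holo_nonzero hg ng) => t /eqP + h1 h2.
  rewrite mulf_eq0; apply: contraTeq => t0.
  by rewrite negb_or h1 ?h2.
have [d d0 hd] := (nbhs_nrP _ _).1 nfalse.
have [t /eqP t0 td] := small_neq0 d0.
by apply/t0/hd; rewrite subr0.
Qed.

(** Fraction-free Gaussian elimination over a domain: [q + 1] rows of length [q] are dependent.
    Cross-multiplying with the pivot avoids division, so the coefficients stay holomorphic. *)
Lemma elimination q (c : 'I_q.+1 -> 'I_q -> C -> C) :
  (forall i j, holomorphic_near0 (c i j)) ->
  exists b : 'I_q.+1 -> C -> C, [/\ forall i, holomorphic_near0 (b i),
    exists i, ~ null0 (b i) &
    forall j, \forall t \near (0 : C), \sum_i b i t * c i j t = 0].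
Proof.
elim: q c => [|q ih] c hc.
  exists (fun _ _ => 1); split.
  - by move=> i; exact: holo_cst.
  - by exists ord0 => /nbhs_singleton/eqP; rewrite oner_eq0.
  - by case.
have [allnull|] := pselect (forall i, null0 (c i ord0)).
  have [b [hb [i0 nb] bE]] := ih (fun i j => c (lift ord_max i) (lift ord0 j))
    (fun i j => hc _ _).
  exists (fun i => if unlift ord_max i is Some k then b k else fun=> 0); split.
  - by move=> i; case: unlift => // *; exact: holo_cst.
  - by exists (lift ord_max i0); rewrite liftK.
  - move=> j; case: (unliftP ord0 j) => [k ->|->].
      apply: filterS (bE k) => t h; rewrite (bigD1_ord ord_max)//= unlift_none mul0r add0r.
      by rewrite -[RHS]h; apply: eq_bigr => i _; rewrite liftK.
    apply: filterS (near_forall allnull) => t h.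
    by apply: big1 => i _; rewrite h mulr0.
move=> /existsNP[i0 n0].
pose w i j t := c i0 ord0 t * c (lift i0 i) (lift ord0 j) t
  - c (lift i0 i) ord0 t * c i0 (lift ord0 j) t.
have hw i j : holomorphic_near0 (w i j).
  by apply: holoB; apply: holoM; exact: hc.
have [b [hb [k nb] bE]] := ih w hw.
(* The coefficient of the pivot row cancels column 0; on the other columns the sum becomes the
   relation for [w]. *)
exists (fun i => if unlift i0 i is Some k then fun t => b k t * c i0 ord0 t
  else fun t => - \sum_k b k t * c (lift i0 k) ord0 t); split.
- move=> i; case: unlift => [l|]; first by apply: holoM; [exact: hb|exact: hc].
  have -> : (fun t => - \sum_k b k t * c (lift i0 k) ord0 t) =
            (fun t => 0 - \sum_k b k t * c (lift i0 k) ord0 t).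
    by apply/funext => t; rewrite sub0r.
  apply: holoB; first exact: holo_cst.
  by apply: holo_sum => l; apply: holoM; [exact: hb|exact: hc].
- by exists (lift i0 k); rewrite liftK; apply: null0_mul.
- have sumE t (F : 'I_q.+2 -> C) :
      \sum_i (if unlift i0 i is Some k then fun t => b k t * c i0 ord0 t
        else fun t => - \sum_k b k t * c (lift i0 k) ord0 t) t * F i =
      \sum_k b k t * (c i0 ord0 t * F (lift i0 k) - c (lift i0 k) ord0 t * F i0).
    rewrite (bigD1_ord i0)//= unlift_none mulNr mulr_suml addrC -sumrB.
    by apply: eq_bigr => k' _; rewrite liftK; ring.
  move=> j; case: (unliftP ord0 j) => [l ->|->].
    by apply: filterS (bE l) => t h; rewrite sumE.
  by apply/nbhs_nrP; exists 1 => // t _; rewrite sumE big1// => k' _; ring.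
Qed.

(** The least order among the nonzero germs indexed by [P] is factored out; a germ attaining it
    keeps a nonzero value at 0. *)
Lemma common_order (T : finType) (P : pred T) (p : T -> C -> C) :
  (forall e, holomorphic_near0 (p e)) -> (exists2 e, P e & ~ null0 (p e)) ->
  exists (a : nat) (rho : T -> C -> C), [/\
    forall e, {for 0, continuous (rho e)},
    exists2 e, P e & rho e 0 != 0 &
    forall e, P e -> \forall t \near (0 : C), p e t = t ^+ a * rho e t].
Proof.
move=> hp [e0 Pe0 ne0].
have /choice[k /choice[u hu]] : forall e, exists k, exists u : C -> C,
    {for 0, continuous u} /\ (null0 (p e) /\ u = (fun=> 0) \/
      ~ null0 (p e) /\ u 0 != 0 /\ \forall t \near (0 : C), p e t = t ^+ k * u t).
  move=> e; have [n|n] := pselect (null0 (p e)).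
    exists 0%N, (fun=> 0); split; [exact: cst_continuous|by left].
  case: (holo_order (hp e)) => [//|[k [u [cu u0 pE]]]].
  by exists k, u; split=> //; right.
pose Q e := P e && `[< ~ null0 (p e) >].
have Qe0 : Q e0 by rewrite /Q Pe0; apply/asboolP.
have [em /andP[Pm /asboolP nm] kmin] := arg_minnP k Qe0.
exists (k em), (fun e t => t ^+ (k e - k em) * u e t); split.
- move=> e; have [cu _] := hu e.
  have hX : {for 0, continuous (fun t : C => t ^+ (k e - k em))}.
    have hid : holomorphic_near0 (@id C) by near=> t; exact: ex_diff.
    exact: differentiable_continuous (nbhs_singleton (holoX _ hid)).
  exact: (@cvgM _ _ (nbhs (0 : C)) _ _ _ _ _ hX cu).
- exists em => //; rewrite subnn expr0 mul1r.
  by case: (hu em) => _ [[]|[_ []]].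
- move=> e Pe; case: (hu e) => _ [[n ->]|[n [_ pE]]].
    by apply: filterS n => t ->; rewrite !mulr0.
  apply: filterS pE => t ->; rewrite mulrA -exprD subnKC//.
  by apply: kmin; rewrite /Q Pe; apply/asboolP.
Unshelve. all: by end_near. Qed.

End Elimination.

(** * Uniform finite colength *)

Section CGerm.
Variables (R : realType) (n : nat).

Lemma cgerm_is_zmod_morphism : zmod_morphism (@cgerm R n).
Proof. by move=> a b; rewrite /cgerm -germB//; exact: holo_cst. Qed.

Lemma cgerm_is_monoid_morphism : monoid_morphism (@cgerm R n).
Proof. by split; [exact: cgerm1|exact: cgermM]. Qed.

HB.instance Definition _ := GRing.isZmodMorphism.Build R[i] (holo_germ R n)
  (@cgerm R n) cgerm_is_zmod_morphism.
HB.instance Definition _ := GRing.isMonoidMorphism.Build R[i] (holo_germ R n)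
  (@cgerm R n) cgerm_is_monoid_morphism.

End CGerm.

Section Colength.
Variables (R : realType) (n : nat).
Local Notation C := R[i].
Local Notation X := 'rV[C]_n.
Local Notation V := ('rV[C]_n * C)%type.
Local Notation A := (holo_germ R n).
Local Notation maxI := (maximal_ideal R n).

Lemma holo_det (q : nat) (W : 'I_q -> 'I_q -> C -> C) :
  (forall i j, holomorphic_near0 (W i j)) ->
  holomorphic_near0 (fun t => \det (\matrix_(i, j) W i j t)).
Proof.
move=> hW; apply: holo_sum => p; apply: holoZ; apply: holo_prod => i.
by under eq_fun do rewrite mxE; exact: hW.
Qed.

Lemma jets_ord (N : nat) :
  exists E : 'I_(N ^ n) -> X -> C, (forall b, holomorphic_near0 (E b)) /\
   forall f : V -> C, holomorphic_near0 f ->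
    exists (c : 'I_(N ^ n) -> C -> C) (h : 'I_n -> V -> C),
    [/\ forall b, holomorphic_near0 (c b), forall i, holomorphic_near0 (h i) &
     \forall z \near (0 : V), f z =
       \sum_b c b z.2 * E b z.1 + \sum_i z.1 0 i ^+ N * h i z].
Proof.
have [T [E [cT hE ET]]] := jets R n N.
pose v (b : 'I_(N ^ n)) : T := enum_val (cast_ord (esym cT) b).
exists (fun b => E (v b)); split=> // f /ET[c [h [hc hh fE]]].
exists (fun b => c (v b)), h; split=> //.
apply: filterS fE => z ->; congr (_ + _).
apply: (reindex v); apply: onW_bij.
exists (fun x => cast_ord cT (enum_rank x)) => x.
  by rewrite /v enum_valK cast_ordKV.
by rewrite /v cast_ordK enum_rankK.
Qed.

Lemma ideal_gen_rangeP (D : comNzRingType) m (g : 'I_m -> D) x :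
  ideal_gen (range g) x <-> exists a : 'I_m -> D, x = \sum_i a i * g i.
Proof.
split; last first.
  move=> [a ->]; apply: (is_ideal_sum _ (ideal_gen_ideal _)) => i _.
  by apply: (is_idealMl _ (ideal_gen_ideal _)); apply: sub_ideal_gen; exists i.
move: x; apply: ideal_gen_min.
  split=> /=.
  - by exists (fun=> 0); rewrite big1// => i _; rewrite mul0r.
  - move=> _ _ [a ->] [b ->]; exists (fun i => a i + b i).
    by rewrite -big_split; apply: eq_bigr => i _; rewrite mulrDl.
  - move=> c _ [a ->]; exists (fun i => c * a i).
    by rewrite mulr_sumr; apply: eq_bigr => i _; rewrite mulrA.
move=> _ [i _ <-] /=; exists (fun j => (j == i)%:R).
rewrite (bigD1 i)//= eqxx mul1r big1 ?addr0// => j /negbTE ->.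
by rewrite mul0r.
Qed.

Lemma xpow_ideal N : is_ideal (@xpow R n N).
Proof. exact: ideal_gen_ideal. Qed.

Lemma mem_xpow N (h : 'I_n -> X -> C) : (forall i, holomorphic_near0 (h i)) ->
  xpow N (germ (fun x => \sum_i x 0 i ^+ N * h i x)).
Proof.
move=> hh; have hX i : holomorphic_near0 (fun x : X => x 0 i ^+ N).
  exact/holoX/holo_coord_rV.
rewrite germ_sum; last by move=> i; exact: holoM.
apply: (is_ideal_sum _ (xpow_ideal N)) => i _; rewrite germM//.
apply: (is_idealMr _ (xpow_ideal N)); apply: sub_ideal_gen; exists i => //.
by rewrite germX//; exact: holo_coord_rV.
Qed.

Lemma germ_lincomb (q : nat) (P : pred 'I_q) (c : 'I_q -> C) (E : 'I_q -> X -> C) :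
  (forall b, holomorphic_near0 (E b)) ->
  germ (fun x => \sum_(b | P b) c b * E b x) =
  \sum_(b | P b) @cgerm R n (c b) * germ (E b).
Proof.
move=> hE; rewrite germ_sum; last by move=> b; exact: holoZ.
by apply: eq_bigr => b _; rewrite germM//; exact: holo_cst.
Qed.

Lemma jet_span (N : nat) (E : 'I_(N ^ n) -> X -> C) :
  (forall b, holomorphic_near0 (E b)) ->
  (forall f : V -> C, holomorphic_near0 f ->
    exists (c : 'I_(N ^ n) -> C -> C) (h : 'I_n -> V -> C),
    [/\ forall b, holomorphic_near0 (c b), forall i, holomorphic_near0 (h i) &
     \forall z \near (0 : V), f z =
       \sum_b c b z.2 * E b z.1 + \sum_i z.1 0 i ^+ N * h i z]) ->
  forall a : A, exists c : 'I_(N ^ n) -> C,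
    xpow N (a - \sum_b cgerm n (c b) * germ (E b)).
Proof.
move=> hE ET a; have [f hf ->] := germ_surj a.
have [c [h [hc hh fE]]] := ET _ (holo_of_fst hf).
exists (fun b => c b 0).
have h0 i : holomorphic_near0 (fun x : X => h i (x, 0)).
  exact: nbhs_singleton (holo_slice (hh i)).
have fE0 := nbhs_singleton (near_slice fE).
rewrite -germ_lincomb// -germB//; last by apply: holo_sum => b; exact: holoZ.
rewrite (@germ_near _ _ _ (fun x => \sum_i x 0 i ^+ N * h i (x, 0))).
- exact: mem_xpow.
- by apply: holoB => //; apply: holo_sum => b; exact: holoZ.
- by apply: holo_sum => i; apply: holoM => //; apply: holoX; exact: holo_coord_rV.
- by apply: filterS fE0 => x /= ->; rewrite addrC addKr.
Qed.

Lemma lin_dependent q (phi : 'I_q.+1 -> 'I_q -> C) :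
  exists v : 'I_q.+1 -> C, (exists i, v i != 0) /\ forall j, \sum_i v i * phi i j = 0.
Proof.
pose M := \matrix_(i, j) phi i j.
have : kermx M != 0.
  rewrite -mxrank_eq0 mxrank_ker -lt0n subn_gt0.
  by rewrite (leq_ltn_trans (rank_leq_col M)).
move=> /rowV0Pn[v /sub_kermxP vM v0]; exists (fun i => v 0 i); split.
  apply/existsP; move: v0; apply: contraR; rewrite negb_exists => /forallP h.
  by apply/eqP/rowP => i; rewrite mxE; have := h i; rewrite negbK => /eqP.
move=> j; have /rowP/(_ j) := vM; rewrite !mxE => h; rewrite -[RHS]h.
by apply: eq_bigr => i _; rewrite mxE.
Qed.

Section UniformPower.
Variables (m : nat) (g : 'I_m -> V -> C).
Hypothesis hg : forall j, holomorphic_near0 (g j).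

Definition slice_ideal t : set A := ideal_gen (range (fun j => germ (fun x => g j (x, t)))).

Lemma slice_ideal_ideal t : is_ideal (slice_ideal t).
Proof. exact: ideal_gen_ideal. Qed.

(** With coefficients lifted from [t = 0], the difference of the two sides vanishes on that slice
    and is divisible by [t]. *)
Lemma deform_relation (f : X -> C) : holomorphic_near0 f -> slice_ideal 0 (germ f) ->
  exists (a : 'I_m -> X -> C) (H : V -> C),
   [/\ forall j, holomorphic_near0 (a j), holomorphic_near0 H &
    \forall z \near (0 : V), f z.1 = \sum_j a j z.1 * g j z - z.2 * H z].
Proof.
move=> hf /ideal_gen_rangeP[al fE].
have /choice[a ha] : forall j, exists a : X -> C, holomorphic_near0 a /\ al j = germ a.
  by move=> j; have [a ha ->] := germ_surj (al j); exists a.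
have hg0 j : holomorphic_near0 (fun x : X => g j (x, 0)).
  exact: nbhs_singleton (holo_slice (hg j)).
have rel0 : \forall x \near (0 : X), f x = \sum_j a j x * g j (x, 0).
  apply/germ_eqP => //.
    by apply: holo_sum => j; apply: holoM => //; have [] := ha j.
  rewrite fE germ_sum; last by move=> j; apply: holoM => //; have [] := ha j.
  by apply: eq_bigr => j _; have [h ->] := ha j; rewrite germM.
pose F (z : V) := \sum_j a j z.1 * g j z - f z.1.
have hF : holomorphic_near0 F.
  apply: holoB; last exact: holo_of_fst.
  by apply: holo_sum => j; apply: holoM => //; have [h _] := ha j; exact: holo_of_fst.
have csnd : continuous (@snd _ _ : {linear V -> C}) by move=> z; exact: cvg_snd.
have [H hH HE] := @holo_division _ _ F (@snd _ _ : {linear V -> C}) (0, 1) csnd erefl hF.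
exists a, H; split=> //; first by move=> j; have [] := ha j.
have rel0' : \forall z \near (0 : V), f z.1 = \sum_j a j z.1 * g j (z.1, 0).
  exact: (near0_comp (@holo_fst R n) erefl rel0).
apply: filterS2 HE rel0' => z /= hz h0; rewrite -hz /F.
have -> : z - z.2 *: ((0, 1) : V) = (z.1, 0).
  by case: z {hz h0} => x t; congr pair; rewrite /= ?scaler0 ?subr0// [_ *: _]mulr1 subrr.
by rewrite /= -h0 subrr subr0 opprB addrC subrK.
Qed.

(* Near [t = 0] the quotient by [I_t + (x_i^N)] is still spanned by the [s^n]
   classes spanning it at [t = 0]: the defect is multiplication by the
   invertible matrix [1 + t D(t)]. *)
Lemma slice_span s N : (forall i, slice_ideal 0 (xgerm R i ^+ s)) ->
  exists e : 'I_(s ^ n) -> A, \forall t \near (0 : C), forall a : A,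
   exists (c : 'I_(s ^ n) -> C) (y z : A), [/\ slice_ideal t y, xpow N z &
     a - \sum_b cgerm n (c b) * e b = y + z].
Proof.
move=> hs.
have /choice[a /choice[H aH]] : forall i, exists a, exists H, _ := fun i =>
  @deform_relation (fun x => x 0 i ^+ s) (holoX s (@holo_coord_rV R n i))
   (eq_ind_r (slice_ideal 0) (hs i) (germX s (@holo_coord_rV R n i))).
have ha i j : holomorphic_near0 (a i j) by have [] := aH i.
have hH i : holomorphic_near0 (H i) by have [] := aH i.
have [Es [hEs jets_s]] := jets_ord s.
have [EN [hEN jets_N]] := jets_ord N.
have span_N := jet_span hEN jets_N.
have /choice[c /choice[h ch]] : forall b, exists c, exists h, _ :=
  fun b => jets_s _ (holo_of_fst (hEN b)).
have hc b' b : holomorphic_near0 (c b' b) by have [] := ch b'.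
have hh b i : holomorphic_near0 (h b i) by have [] := ch b.
have hf b : holomorphic_near0 (fun z : V => \sum_i H i z * h b i z).
  by apply: holo_sum => i; exact: holoM.
have /choice[d /choice[k dk]] : forall b, exists d, exists k, _ :=
  fun b => jets_N _ (hf b).
have hd b' b : holomorphic_near0 (d b' b) by have [] := dk b'.
have hk b i : holomorphic_near0 (k b i) by have [] := dk b.
(* In the expansion of [EN b] by the [s]-jets, each [x_i ^+ s] is replaced using [deform_relation].
   The resulting multiple of [t] is expanded by the [N]-jets again, which produces the matrix
   [d]. *)
have rel : \forall z \near (0 : V), forall b,
    EN b z.1 + z.2 * \sum_b' d b b' z.2 * EN b' z.1 =
    \sum_b' c b b' z.2 * Es b' z.1 +
    (\sum_j (\sum_i h b i z * a i j z.1) * g j z + \sum_i z.1 0 i ^+ N * (- (z.2 * k b i z))).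
  apply: near_forall => b.
  have [_ _ r1] := ch b; have [_ _ r2] := dk b.
  have r3 : \forall z \near (0 : V), forall i : 'I_n,
      (z : V).1 0 i ^+ s = \sum_j a i j z.1 * g j z - z.2 * H i z.
    by apply: near_forall => i; have [] := aH i.
  apply: filterS3 r1 r2 r3 => z e1 e2 e3.
  rewrite e1 -addrA; congr (_ + _).
  have -> : \sum_b' d b b' z.2 * EN b' z.1 =
     \sum_i H i z * h b i z - \sum_i z.1 0 i ^+ N * k b i z by rewrite e2 addrK.
  have -> : \sum_i z.1 0 i ^+ N * (- (z.2 * k b i z)) =
      - (z.2 * \sum_i z.1 0 i ^+ N * k b i z).
    by rewrite mulr_sumr -sumrN; apply: eq_bigr => i _; ring.
  have -> : \sum_i z.1 0 i ^+ s * h b i z =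
      \sum_j (\sum_i h b i z * a i j z.1) * g j z - z.2 * \sum_i H i z * h b i z.
    under eq_bigr do rewrite e3.
    under [X in _ = X - _]eq_bigr do rewrite mulr_suml.
    rewrite exchange_big /= mulr_sumr -sumrB; apply: eq_bigr => i _.
    rewrite mulrBl mulr_suml; congr (_ - _); last by ring.
    by apply: eq_bigr => j _; ring.
  by rewrite mulrBr; ring.
exists (fun b => germ (Es b)).
pose W t : 'M[C]_(N ^ n) := 1%:M + t *: \matrix_(b, b') d b b' t.
have Wunit : \forall t \near (0 : C), W t \in unitmx.
  have hdet : holomorphic_near0 (fun t => \det (W t)).
    have -> : W = fun t => \matrix_(b, b') ((b == b')%:R + t * d b b' t).
      by apply/funext => t; apply/matrixP => b b'; rewrite !mxE.
    apply: holo_det => b b'; apply: holoD; first exact: holo_cst.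
    by apply: holoM => //; near=> t; exact: ex_diff.
  have cdet := differentiable_continuous (nbhs_singleton hdet).
  have := continuous_neq0 cdet; rewrite /W scale0r addr0 det1 oner_eq0 => /(_ isT).
  by apply: filterS => t dt; rewrite unitmxE unitfE.
have hgt : \forall t \near (0 : C), forall j, holomorphic_near0 (fun x : X => g j (x, t)).
  by apply: near_forall => j; exact: holo_slice.
have hht : \forall t \near (0 : C), forall b i, holomorphic_near0 (fun x : X => h b i (x, t)).
  by apply: near_forall => b; apply: near_forall => i; exact: holo_slice.
have hkt : \forall t \near (0 : C), forall b i, holomorphic_near0 (fun x : X => k b i (x, t)).
  by apply: near_forall => b; apply: near_forall => i; exact: holo_slice.
have hgh : \forall t \near (0 : C), (forall j, holomorphic_near0 (fun x : X => g j (x, t))) /\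
    forall b i, holomorphic_near0 (fun x : X => h b i (x, t)).
  by apply: filterS2 hgt hht.
have hkW : \forall t \near (0 : C), (forall b i, holomorphic_near0 (fun x : X => k b i (x, t))) /\
    W t \in unitmx.
  by apply: filterS2 hkt Wunit.
apply: filterS3 hgh hkW (near_slice rel) => t [{}hgt {}hht] [{}hkt {}Wunit] relt.
pose Q := [set x | exists y z, [/\ slice_ideal t y, xpow N z & x = y + z]].
have hQ : is_ideal Q.
  exact: (ideal_add (slice_ideal_ideal t) (ideal_gen_ideal _)).
suff span x : exists c : 'I_(s ^ n) -> C, Q (x - \sum_b cgerm n (c b) * germ (Es b)).
  by move=> x; have [c0 [y [z [hy hz e]]]] := span x; exists c0, y, z.
have relQ b : Q (\sum_b' cgerm n (W t b b') * germ (EN b') -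
                 \sum_b' cgerm n (c b b' t) * germ (Es b')).
  rewrite -!germ_lincomb// -germB; try by apply: holo_sum => ?; exact: holoZ.
  rewrite (@germ_near _ _ _ (fun x => \sum_j (\sum_i h b i (x, t) * a i j x) * g j (x, t)
      + \sum_i x 0 i ^+ N * (- (t * k b i (x, t))))).
  - have h1 j : holomorphic_near0 (fun x : X => \sum_i h b i (x, t) * a i j x).
      by apply: holo_sum => i; exact: holoM.
    have h2 i : holomorphic_near0 (fun x : X => - (t * k b i (x, t))).
      by under eq_fun do rewrite -mulNr; exact: holoZ.
    rewrite germD; last 2 first.
    + by apply: holo_sum => j; exact: holoM.
    + by apply: holo_sum => i; apply: holoM => //; apply: holoX; exact: holo_coord_rV.
    eexists; eexists; split; [|exact: mem_xpow h2|reflexivity].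
    rewrite germ_sum; last by move=> j; exact: holoM.
    apply: (is_ideal_sum _ (slice_ideal_ideal t)) => j _; rewrite germM//.
    by apply: (is_idealMl _ (slice_ideal_ideal t)); apply: sub_ideal_gen; exists j.
  - by apply: holoB; apply: holo_sum => ?; exact: holoZ.
  - apply: holoD; apply: holo_sum => i.
      by apply: holoM => //; apply: holo_sum => j; exact: holoM.
    apply: holoM; first by apply: holoX; exact: holo_coord_rV.
    by under eq_fun do rewrite -mulNr; exact: holoZ.
  - apply: filterS relt => x' /(_ b)/= e.
    rewrite -[RHS](addrK (\sum_b' c b b' t * Es b' x')) [X in _ = X - _]addrC -e.
    congr (_ - _); under eq_bigr do rewrite !mxE mulrDl.
    rewrite big_split /=; congr (_ + _).
      rewrite (bigD1 b)//= eqxx mul1r big1 ?addr0// => b' /negbTE nb.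
      by rewrite eq_sym nb mul0r.
    by rewrite mulr_sumr; apply: eq_bigr => b' _; rewrite mulrA.
have spanE b0 : exists c : 'I_(s ^ n) -> C,
    Q (germ (EN b0) - \sum_b cgerm n (c b) * germ (Es b)).
  (* Inverting [W t] in the system [relQ] expresses each [EN b0] through the classes of the [Es]. *)
  exists (fun b => \sum_b' invmx (W t) b0 b' * c b' b t).
  have -> : germ (EN b0) = \sum_b' cgerm n (invmx (W t) b0 b') *
       \sum_b'' cgerm n (W t b' b'') * germ (EN b'').
    under eq_bigr do rewrite mulr_sumr.
    rewrite exchange_big /= (bigD1 b0)//= [X in X + _](_ : _ = germ (EN b0)).
      rewrite big1 ?addr0// => b'' nb.
      under eq_bigr do rewrite mulrA -rmorphM.
      rewrite -mulr_suml -rmorph_sum /=.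
      have /matrixP/(_ b0 b'') := mulVmx Wunit; rewrite !mxE => ->.
      by rewrite eq_sym (negbTE nb) rmorph0 mul0r.
    under eq_bigr do rewrite mulrA -rmorphM.
    rewrite -mulr_suml -rmorph_sum /=.
    have /matrixP/(_ b0 b0) := mulVmx Wunit; rewrite !mxE => ->.
    by rewrite eqxx rmorph1 mul1r.
  have -> : \sum_b cgerm n (\sum_b' invmx (W t) b0 b' * c b' b t) * germ (Es b) =
     \sum_b' cgerm n (invmx (W t) b0 b') * \sum_b cgerm n (c b' b t) * germ (Es b).
    under [RHS]eq_bigr do rewrite mulr_sumr.
    rewrite exchange_big /=; apply: eq_bigr => b _.
    rewrite rmorph_sum mulr_suml; apply: eq_bigr => b' _.
    by rewrite rmorphM mulrA.
  rewrite -sumrB; apply: is_ideal_sum => // b' _; rewrite -mulrBr; exact: is_idealMl.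
have [c1 hc1] := choice spanE.
have [c2 hc2] := span_N x.
exists (fun b => \sum_b0 c2 b0 * c1 b0 b).
have -> : x - \sum_b cgerm n (\sum_b0 c2 b0 * c1 b0 b) * germ (Es b) =
   (x - \sum_b0 cgerm n (c2 b0) * germ (EN b0)) +
   \sum_b0 cgerm n (c2 b0) * (germ (EN b0) - \sum_b cgerm n (c1 b0 b) * germ (Es b)).
  under [X in _ = _ + X]eq_bigr do rewrite mulrBr.
  rewrite sumrB addrA subrK; congr (_ - _).
  under [RHS]eq_bigr do rewrite mulr_sumr.
  rewrite exchange_big /=; apply: eq_bigr => b _.
  rewrite rmorph_sum mulr_suml; apply: eq_bigr => b' _.
  by rewrite rmorphM mulrA.
apply: is_idealD => //.
  exists 0, (x - \sum_b0 cgerm n (c2 b0) * germ (EN b0)); split=> //.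
    exact: is_ideal0 (slice_ideal_ideal t).
  by rewrite add0r.
by apply: is_ideal_sum => // b0 _; exact: is_idealMl.
Unshelve. all: by end_near. Qed.

(** With [q = s ^ n], modulo [I_t + (x_j^(q+1))] the [q + 1] powers [1, ..., x_i^q] lie in the span
    of [q] classes, so [power_of_relation] puts [x_i^q] in that ideal. Hence [(x_i^q)] lies in
    [I_t + M (x_i^q)], and Nakayama's lemma applies. *)
Lemma uniform_power s : (forall i, slice_ideal 0 (xgerm R i ^+ s)) ->
  \forall t \near (0 : C), forall i, slice_ideal t (xgerm R i ^+ (s ^ n)).
Proof.
move=> /(slice_span (s ^ n).+1)[e]; apply: filterS => t span.
set q := (s ^ n)%N in e span *.
pose Q := [set x | exists y z, [/\ slice_ideal t y, xpow q.+1 z & x = y + z]].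
have hQ : is_ideal Q.
  exact: (ideal_add (slice_ideal_ideal t) (ideal_gen_ideal _)).
have powQ i : Q (xgerm R i ^+ q).
  have /choice[c hc] : forall k : 'I_q.+1, exists c : 'I_q -> C,
      Q (xgerm R i ^+ k - \sum_b cgerm n (c b) * e b).
    move=> k; have [c [y [z [hy hz E]]]] := span (xgerm R i ^+ k).
    by exists c, y, z.
  have [v [vn0 vE]] := lin_dependent c.
  have [k0 vk0] := vn0.
  apply: (@power_of_relation _ maxI (@maximal_is_ideal R n) (@maximal_local R n)
    q Q _ (fun k => cgerm n (v k)) hQ (xgerm_maximal R i)).
  - move=> k; have [->|vk] := eqVneq (v k) 0; first by left; exact: rmorph0.
    by right; exists (cgerm n (v k)^-1); exact: cgerm_unit.
  - exists k0; apply/eqP => h; have := cgerm_unit n vk0.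
    by rewrite h mulr0 => /esym/eqP; rewrite oner_eq0.
  have -> : \sum_k cgerm n (v k) * xgerm R i ^+ k =
      \sum_k cgerm n (v k) * (xgerm R i ^+ k - \sum_b cgerm n (c k b) * e b).
    apply/eqP; rewrite -subr_eq0 -sumrB; apply/eqP.
    under eq_bigr do rewrite mulrBr opprB addrC subrK mulr_sumr.
    rewrite exchange_big /= big1// => b _.
    under eq_bigr do rewrite mulrA -rmorphM.
    by rewrite -mulr_suml -rmorph_sum /= vE rmorph0 mul0r.
  by apply: is_ideal_sum => // k _; exact: is_idealMl.
suff : xpow q `<=` slice_ideal t.
  by move=> h i; apply: h; apply: sub_ideal_gen; exists i.
apply: (@nakayama _ maxI (@maximal_is_ideal R n) (@maximal_local R n) (xpow q) (slice_ideal t)).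
- exact: fin_gen_range.
- exact: slice_ideal_ideal.
apply: ideal_gen_min.
  exact: (ideal_add (slice_ideal_ideal t) (ideal_mul_ideal _ _)).
move=> _ [i _ <-]; have [y [z [hy hz E]]] := powQ i.
exists y, z; split=> //; move: z hz {E}; apply: ideal_gen_min.
  exact: ideal_mul_ideal.
move=> _ [j _ <-]; rewrite exprS; apply: mem_ideal_mul; first exact: xgerm_maximal.
by apply: sub_ideal_gen; exists j.
Qed.

End UniformPower.
End Colength.

(** * Eliminating one generator *)

Lemma sum_digits (B k e : nat) :
  (\sum_(i < k) (e %/ B ^ i) %% B * B ^ i = e %% B ^ k)%N.
Proof.
have [->|B0] := posnP B.
  elim: k e => [|k ih] e; first by rewrite big_ord0 expn0 modn1.
  rewrite big_ord_recl expn0 divn1 muln1 modn0 exp0n// modn0 big1 ?addn0//.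
  by move=> i _; rewrite exp0n// muln0.
elim: k => [|k ih]; first by rewrite big_ord0 expn0 modn1.
rewrite big_ord_recr/= ih; set q := (e %/ B ^ k)%N; set r := (e %% B ^ k)%N.
have eE : (e = q %/ B * B ^ k.+1 + (q %% B * B ^ k + r))%N.
  by rewrite expnS mulnA addnA -mulnDl -divn_eq -divn_eq.
rewrite [RHS](congr1 (modn^~ _) eE) modnMDl [RHS]modn_small; first exact: addnC.
have h1 : (q %% B <= B.-1)%N by rewrite -ltnS prednK// ltn_mod.
have h2 : (r < B ^ k)%N by rewrite ltn_mod expn_gt0 B0.
rewrite expnS -[X in (_ < X * _)%N](prednK B0) mulSn [X in (X < _)%N]addnC.
by rewrite -addSn leq_add// leq_mul2r h1 orbT.
Qed.

Lemma continuous_sum_at0 (R : realType) (T : Type) (r : seq T) (P : pred T)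
    (F : T -> R[i] -> R[i]) : (forall e, {for 0, continuous (F e)}) ->
  {for 0, continuous (fun t => \sum_(e <- r | P e) F e t)}.
Proof.
move=> cF; elim: r => [|e r ih].
  have -> : (fun t => \sum_(e <- [::] | P e) F e t) = fun=> 0.
    by apply/funext => t; rewrite big_nil.
  exact: cst_continuous.
have -> : (fun t => \sum_(e <- e :: r | P e) F e t) =
    if P e then fun t => F e t + \sum_(e <- r | P e) F e t
    else fun t => \sum_(e <- r | P e) F e t.
  by apply/funext => t; rewrite big_cons; case: (P e).
case: (P e); last exact: ih.
exact: (@cvgD _ _ _ (nbhs (0 : R[i])) _ (F e) _ _ _ (cF e) ih).
Qed.

Section FamilyRelation.
Variables (R : realType) (n m s : nat).
Local Notation C := R[i].
Local Notation X := 'rV[C]_n.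
Local Notation V := ('rV[C]_n * C)%type.
Local Notation maxI := (maximal_ideal R n).

(* The base [B] is so large that there are more monomials [g^alpha] with digits
   [alpha_i < B] than jets modulo [(x_1^N, ..., x_n^N)]. *)
Definition base := ((s * m.+1) ^ n).+1.
Definition degb := (m.+1 * base.-1)%N.
(** When [x_i^s] lies in [I_t], the power [s * degb] of [x_i] lies in [I_t^degb]; one more factor
    [x_i] gives an element of [M I_t^degb]. *)
Definition jetN := (s * degb).+1.
Definition njets := (jetN ^ n)%N.
(** A number [e] encodes the monomial whose exponents are its digits; at [c_i = y^(base^i)] this
    monomial takes the value [y ^+ e]. *)
Definition digit (e i : nat) := ((e %/ base ^ i) %% base)%N.

Lemma digit_le e i : (digit e i <= base.-1)%N.
Proof. by rewrite -ltnS prednK// ltn_mod. Qed.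

Lemma digit_degree e : (\sum_(i < m.+1) digit e i <= degb)%N.
Proof.
rewrite (@leq_trans (\sum_(i < m.+1) base.-1))//; first by apply: leq_sum => i _; exact: digit_le.
by rewrite sum_nat_const card_ord.
Qed.

(** As [jetN <= s * m.+1 * base], the number of jets is at most [(s * m.+1) ^ n * base ^ n], and the
    first factor is smaller than [base]. *)
Lemma njets_lt : (0 < s)%N -> (n <= m)%N -> (njets < base ^ m.+1)%N.
Proof.
move=> s0 nm.
have h1 : (jetN <= s * m.+1 * base)%N.
  have D0 : (0 < s * m.+1)%N by rewrite muln_gt0 s0.
  rewrite /jetN /degb mulnA; move: (s * m.+1)%N D0 (base) (ltn0Sn _ : 0 < base)%N.
  by move=> D D0 [//|B] _; rewrite /= mulnS -add1n leq_add2r.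
rewrite (@leq_ltn_trans ((s * m.+1 * base) ^ n))//.
  by rewrite /njets; have [->|n0] := posnP n; rewrite ?expn0 ?leq_exp2r//.
rewrite expnMn (@leq_trans (base ^ n.+1))//; last by rewrite leq_pexp2l.
by rewrite expnS ltn_pmul2r ?expn_gt0.
Qed.

Lemma digit_sum (e : 'I_njets.+1) : (0 < s)%N -> (n <= m)%N ->
  (\sum_(i < m.+1) digit e i * base ^ i = e)%N.
Proof.
move=> s0 nm; rewrite sum_digits modn_small//.
by rewrite (leq_ltn_trans _ (njets_lt s0 nm))// -ltnS.
Qed.

Variable g : 'I_m.+1 -> V -> C.
Hypothesis hg : forall j, holomorphic_near0 (g j).
Hypothesis g0 : \forall t \near (0 : C), forall j, g j (0, t) = 0.
Hypothesis hs : \forall t \near (0 : C), forall i, slice_ideal g t (xgerm R i ^+ s).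

Definition deg (e : 'I_njets.+1) := (\sum_(i < m.+1) digit e i)%N.

Definition gmon (t : C) (e : 'I_njets.+1) : holo_germ R n :=
  \prod_(i < m.+1) germ (fun x => g i (x, t)) ^+ digit e i.

Lemma xpow_sub_exp t j : (forall i, slice_ideal g t (xgerm R i ^+ s)) ->
  (j <= degb)%N ->
  xpow jetN `<=` ideal_mul maxI (ideal_exp (slice_ideal g t) j).
Proof.
move=> hst jd; apply: ideal_gen_min; first exact: ideal_mul_ideal.
move=> _ [i _ <-]; rewrite exprS; apply: mem_ideal_mul; first exact: xgerm_maximal.
apply: (ideal_exp_le jd); rewrite exprM -[X in ideal_exp _ X]mul1n.
by apply: mem_ideal_expX; apply: mem_ideal_exp1; exact: hst.
Qed.

Lemma slice_ideal_maximal t : (forall j, holomorphic_near0 (fun x : X => g j (x, t))) ->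
  (forall j, g j (0, t) = 0) -> slice_ideal g t `<=` maxI.
Proof.
move=> hgt gt0; apply: ideal_gen_min; first exact: maximal_is_ideal.
by move=> _ [j _ <-]; apply/mem_maximal => //; exact: gt0.
Qed.

Lemma gmon_mem t e : ideal_exp (slice_ideal g t) (deg e) (gmon t e).
Proof.
apply: (@mem_ideal_exp_prod _ _ m.+1 (fun i => germ (fun x => g i (x, t)))
  (fun i : 'I_m.+1 => digit e i)) => i.
by apply: sub_ideal_gen; exists i.
Qed.

(** The vector [r] holds the coefficients of the limit form, whose value at [c_i = y^(base^i)] is
    the sum in [y]. The case [t = 0] is left out because the relation is divided by [t ^+ a]. *)
Lemma family_relation : exists (j : nat) (r : 'I_njets.+1 -> C),
  (exists2 e, deg e == j & r e != 0) /\
  forall y, \sum_(e | deg e == j) r e * y ^+ e != 0 ->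
   \forall t \near (0 : C), t != 0 -> exists b : 'I_njets.+1 -> C,
    \sum_(e | deg e == j) b e * y ^+ e != 0 /\
    ideal_mul maxI (ideal_exp (slice_ideal g t) j)
      (\sum_(e | deg e == j) cgerm n (b e) * gmon t e).
Proof.
pose f (e : 'I_njets.+1) (z : V) := \prod_(i < m.+1) g i z ^+ digit e i.
have hf e : holomorphic_near0 (f e) by apply: holo_prod => i; exact: holoX.
have [E [hE jetsN]] := jets_ord R n jetN.
have /choice[c /choice[h ch]] : forall e, exists c, exists h, _ := fun e => jetsN _ (hf e).
have hc e b : holomorphic_near0 (c e b) by have [] := ch e.
have hh e i : holomorphic_near0 (h e i) by have [] := ch e.
have [p [hp [e0 pe0] pE]] := elimination hc.
have ex : exists j, [exists e, (deg e == j) && `[< ~ null0 (p e) >]].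
  by exists (deg e0); apply/existsP; exists e0; rewrite eqxx; apply/asboolP.
case: (ex_minnP ex) => j /existsP[e1 /andP[de1 /asboolP pe1]] jmin.
have low e : (deg e < j)%N -> null0 (p e).
  move=> ej; apply: contrapT => ne; move: ej; rewrite ltnNge jmin//.
  by apply/existsP; exists e; rewrite eqxx; apply/asboolP.
have [a [rho [crho [e2 de2 rho2] rhoE]]] :=
  common_order hp (ex_intro2 (fun e => deg e == j) (fun e => ~ null0 (p e)) e1 de1 pe1).
exists j, (fun e => rho e 0); split; first by exists e2.
move=> y y0.
have cS : {for 0, continuous (fun t => \sum_(e | deg e == j) rho e t * y ^+ e)}.
  apply: continuous_sum_at0 => e.
  by apply: (@cvgMl _ _ (nbhs (0 : C))); exact: crho.
have Sn0 := continuous_neq0 cS y0.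
have rel : \forall z \near (0 : V),
    \sum_e p e z.2 * f e z = \sum_i z.1 0 i ^+ jetN * \sum_e p e z.2 * h e i z.
  have r1 : \forall z \near (0 : V), forall e,
      f e z = \sum_b c e b z.2 * E b z.1 + \sum_i (z : V).1 0 i ^+ jetN * h e i z.
    by apply: near_forall => e; have [] := ch e.
  have r2 : \forall z \near (0 : V), forall b, \sum_e p e z.2 * c e b z.2 = 0.
    by apply: (near0_comp (@holo_snd R n) erefl (near_forall pE)).
  apply: filterS2 r1 r2 => z e3 e4.
  under eq_bigr do rewrite e3 mulrDr.
  rewrite big_split /= [X in X + _](_ : _ = 0) ?add0r; last first.
    under eq_bigr do rewrite mulr_sumr.
    rewrite exchange_big big1//= => b _.
    by under eq_bigr do rewrite mulrA; rewrite -mulr_suml e4 mul0r.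
  under eq_bigr do rewrite mulr_sumr.
  rewrite exchange_big; apply: eq_bigr => i _ /=.
  by rewrite mulr_sumr; apply: eq_bigr => e _; rewrite mulrCA.
have hgt : \forall t \near (0 : C), forall i, holomorphic_near0 (fun x : X => g i (x, t)).
  by apply: near_forall => i; exact: holo_slice.
have hht : \forall t \near (0 : C), forall e i, holomorphic_near0 (fun x : X => h e i (x, t)).
  by apply: near_forall => e; apply: near_forall => i; exact: holo_slice.
have lowt : \forall t \near (0 : C), forall e, (deg e < j)%N -> p e t = 0.
  apply: near_forall => e; have [ej|ej] := ltnP (deg e) j.
    by apply: filterS (low e ej) => t pt _.
  by apply/nbhs_nrP; exists 1.
have rhot : \forall t \near (0 : C), forall e, deg e == j -> p e t = t ^+ a * rho e t.
  apply: near_forall => e; have [ej|ej] := boolP (deg e == j).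
    by apply: filterS (rhoE e ej) => t pt _.
  by apply/nbhs_nrP; exists 1.
have hA : \forall t \near (0 : C), (forall i, holomorphic_near0 (fun x : X => g i (x, t))) /\
    forall e i, holomorphic_near0 (fun x : X => h e i (x, t)).
  exact: filterS2 hgt hht.
have hB : \forall t \near (0 : C), (forall e, (deg e < j)%N -> p e t = 0) /\
    forall e, deg e == j -> p e t = t ^+ a * rho e t.
  exact: filterS2 lowt rhot.
have hD : \forall t \near (0 : C), (forall i, g i (0, t) = 0) /\
    forall i, slice_ideal g t (xgerm R i ^+ s).
  exact: filterS2 g0 hs.
have hAB : \forall t \near (0 : C),
    ((forall i, holomorphic_near0 (fun x : X => g i (x, t))) /\
     forall e i, holomorphic_near0 (fun x : X => h e i (x, t))) /\
    ((forall e, (deg e < j)%N -> p e t = 0) /\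
     forall e, deg e == j -> p e t = t ^+ a * rho e t).
  by apply: filterS2 hA hB.
have hST : \forall t \near (0 : C), \sum_(e | deg e == j) rho e t * y ^+ e != 0 /\
    \forall x \near (0 : X), \sum_e p e t * f e (x, t) =
      \sum_i x 0 i ^+ jetN * \sum_e p e t * h e i (x, t).
  by apply: filterS2 Sn0 (near_slice rel) => t h1 h2.
apply: filterS3 hAB hD hST => t [[{}hgt {}hht] [{}lowt {}rhot]] [gt0 hst] [St relt] t0.
exists (fun e => rho e t); split=> //.
have jd : (j <= degb)%N by rewrite -(eqP de1) digit_degree.
set I := slice_ideal g t.
have hM : is_ideal (ideal_mul maxI (ideal_exp I j)) by exact: ideal_mul_ideal.
have gmonE e : germ (fun x => f e (x, t)) = gmon t e.
  rewrite /f germ_prod; last by move=> i; exact: holoX.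
  by apply: eq_bigr => i _; rewrite germX.
have hft e : holomorphic_near0 (fun x : X => f e (x, t)).
  by apply: holo_prod => i; exact: holoX.
have all_mem : ideal_mul maxI (ideal_exp I j) (\sum_e cgerm n (p e t) * gmon t e).
  apply: (xpow_sub_exp hst jd).
  under eq_bigr do rewrite -gmonE.
  rewrite -germ_lincomb// (@germ_near _ _ _
    (fun x => \sum_i x 0 i ^+ jetN * \sum_e p e t * h e i (x, t))) //.
  - by apply: mem_xpow => i; apply: holo_sum => e; exact: holoZ.
  - by apply: holo_sum => e; exact: holoZ.
  - apply: holo_sum => i; apply: holoM; first by apply: holoX; exact: holo_coord_rV.
    by apply: holo_sum => e; exact: holoZ.
(* Monomials of degree above [j] lie in [I^(j+1)], hence in [M I^j] because the generators vanish at
   the origin; those of degree below [j] have zero coefficients. *)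
have high_mem : ideal_mul maxI (ideal_exp I j)
    (\sum_(e | deg e != j) cgerm n (p e t) * gmon t e).
  apply: (is_ideal_sum _ hM) => e; rewrite neq_ltn => /orP[ej|ej].
    by rewrite lowt// rmorph0 mul0r; exact: (is_ideal0 hM).
  apply: (is_idealMl _ hM).
  apply: (ideal_mulS (slice_ideal_maximal hgt gt0) (@subset_refl _ (ideal_exp I j))).
  exact: (ideal_exp_le ej (gmon_mem t e)).
have -> : \sum_(e | deg e == j) cgerm n (rho e t) * gmon t e =
    cgerm n (t ^- a) * (\sum_e cgerm n (p e t) * gmon t e -
      \sum_(e | deg e != j) cgerm n (p e t) * gmon t e).
  rewrite [X in X - _](bigID (fun e => deg e == j))/= addrK mulr_sumr.
  apply: eq_bigr => e ej; rewrite mulrA -rmorphM/= rhot// mulKf//.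
  by rewrite expf_neq0.
by apply: (is_idealMl _ hM); exact: (is_idealB hM).
Qed.

End FamilyRelation.

(** * Projection along a vector and induction on the number of generators *)

Section Step.
Variables (R : realType) (n : nat).
Local Notation C := R[i].
Local Notation X := 'rV[C]_n.
Local Notation V := ('rV[C]_n * C)%type.
Local Notation maxI := (maximal_ideal R n).

Lemma poly_nonroot (p : {poly C}) : p != 0 -> exists y, p.[y] != 0.
Proof.
move=> p0; pose rs : seq C := [seq k%:R | k <- iota 0 (size p)].
have urs : uniq rs.
  by rewrite map_inj_uniq ?iota_uniq// => a b /eqP; rewrite eqr_nat => /eqP.
have : ~~ all (root p) rs.
  apply/negP => h; have := max_poly_roots p0 h urs.
  by rewrite size_map size_iota ltnn.
by move=> /allPn[y _ py]; exists y.
Qed.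

Lemma poly_of_coefs q (P : pred 'I_q) (r : 'I_q -> C) : (exists2 e, P e & r e != 0) ->
  exists2 p : {poly C}, p != 0 & forall y, p.[y] = \sum_(e | P e) r e * y ^+ e.
Proof.
move=> [e Pe re]; exists (\sum_(e | P e) r e *: 'X^e); last first.
  by move=> y; rewrite horner_sum; apply: eq_bigr => i _; rewrite hornerZ hornerXn.
apply: contraNneq re => /(congr1 (fun p : {poly C} => p`_e)).
rewrite coef_sum coef0 (bigD1 e)//= coefZ coefXn eqxx mulr1 big1 ?addr0; last first.
  by move=> i /andP[_ ie]; rewrite coefZ coefXn eq_sym -[_ == _]/(i == e) (negbTE ie) mulr0.
by move=> ->.
Qed.

Lemma holo_component k (G : V -> 'rV[C]_k) (i : 'I_k) : holomorphic_near0 G ->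
  holomorphic_near0 (fun z => G z 0 i).
Proof.
move=> hG; near=> z; apply: (@differentiable_comp _ _ _ _ G (fun v : 'rV[C]_k => v 0 i)).
  by near: z; exact: hG.
exact: differentiable_coord.
Unshelve. all: by end_near. Qed.

(* The kernel is spanned by [c] when [c 0 ord0 != 0]. *)
Definition proj_along k (c v : 'rV[C]_k.+1) : 'rV[C]_k :=
  \row_i (c 0 ord0 * v 0 (lift ord0 i) - c 0 (lift ord0 i) * v 0 ord0).

Lemma proj_along_linear k (c : 'rV[C]_k.+1) : linear (proj_along c).
Proof.
move=> a u v; apply/rowP => i; rewrite !mxE.
by ring.
Qed.

HB.instance Definition _ k (c : 'rV[C]_k.+1) :=
  GRing.isLinear.Build C 'rV[C]_k.+1 'rV[C]_k *:%R (proj_along c) (proj_along_linear c).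

Lemma reduction_step m s (G : V -> 'rV[C]_m.+1) : (n <= m)%N ->
  (forall i, holomorphic_near0 (fun z => G z 0 i)) ->
  (\forall t \near (0 : C), G (0, t) = 0) ->
  (forall i, component_ideal (fun x => G (x, 0)) (xgerm R i ^+ s)) ->
  exists p : {linear 'rV[C]_m.+1 -> 'rV[C]_m}, \forall t \near (0 : C),
    reduction (component_ideal (fun x => p (G (x, t))))
              (component_ideal (fun x => G (x, t))).
Proof.
move=> nm hG G0 hs0.
pose g (i : 'I_m.+1) (z : V) := G z 0 i.
have hg i : holomorphic_near0 (g i) by exact: hG.
have g0 : \forall t \near (0 : C), forall i, g i (0, t) = 0.
  by apply: filterS G0 => t h i; rewrite /g h mxE.
(* The exponent [s ^ n] of [uniform_power] may be 0, whereas the count of jets requires a positive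
   one. *)
pose S := (s ^ n).+1.
have idealS t i : slice_ideal g t (xgerm R i ^+ (s ^ n)) ->
    slice_ideal g t (xgerm R i ^+ S).
  by rewrite /S exprS; apply: is_idealMl; exact: slice_ideal_ideal.
have hs : \forall t \near (0 : C), forall i, slice_ideal g t (xgerm R i ^+ S).
  by apply: filterS (uniform_power hg hs0) => t h i; exact: (idealS _ _ (h i)).
have [j [r [r_n0 relr]]] := family_relation hg g0 hs.
(* The constant family with the slice at [t = 0]: its relation at any nonzero parameter is a
   relation for that slice. *)
pose g' i (z : V) := g i (z.1, 0).
have hg' i : holomorphic_near0 (g' i).
  exact: (holo_of_fst (nbhs_singleton (holo_slice (hg i)))).
have g'0 : \forall t \near (0 : C), forall i, g' i (0, t) = 0.
  by apply/nbhs_nrP; exists 1 => // t _; exact: (nbhs_singleton g0).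
have hs' : \forall t \near (0 : C), forall i, slice_ideal g' t (xgerm R i ^+ S).
  by apply/nbhs_nrP; exists 1 => // t _; exact: (nbhs_singleton hs).
have [j' [r' [r'_n0 relr']]] := family_relation hg' g'0 hs'.
have [Q Q0 QE] := poly_of_coefs r_n0.
have [Q' Q'0 Q'E] := poly_of_coefs r'_n0.
(* The factor ['X] makes [y], which is the entry [c 0 ord0], nonzero. *)
have [y] : exists y, ('X * (Q * Q')).[y] != 0.
  by apply: poly_nonroot; rewrite !mulf_neq0// polyX_eq0.
rewrite !hornerM hornerX !mulf_eq0 !negb_or QE Q'E => /and3P[y0 Qy Q'y].
pose c : 'rV[C]_m.+1 := \row_i y ^+ (base n m S ^ i).
have c00 : c 0 ord0 = y by rewrite mxE expn0 expr1.
exists (proj_along c : {linear _ -> _}).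
have main (f : 'I_m.+1 -> X -> C) (jj : nat) (b : 'I_(njets n m S).+1 -> C) :
    (forall i, holomorphic_near0 (f i)) ->
    \sum_(e | deg e == jj) b e * y ^+ e != 0 ->
    ideal_mul maxI (ideal_exp (ideal_gen (range (fun i => germ (f i)))) jj)
      (\sum_(e | deg e == jj) cgerm n (b e) * \prod_(i < m.+1) germ (f i) ^+ digit n m S e i) ->
    reduction (ideal_gen (range (fun i : 'I_m =>
       germ (fun x => c 0 ord0 * f (lift ord0 i) x - c 0 (lift ord0 i) * f ord0 x))))
      (ideal_gen (range (fun i => germ (f i)))).
  move=> hf by0 hb.
  have -> : (fun i : 'I_m => germ (fun x => c 0 ord0 * f (lift ord0 i) x - c 0 (lift ord0 i) * f ord0 x)) =
     (fun i => cgerm n (c 0 ord0) * germ (f (lift ord0 i)) - cgerm n (c 0 (lift ord0 i)) * germ (f ord0)).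
    apply/funext => i; rewrite germB; try exact: holoZ.
    by rewrite !germM//; exact: holo_cst.
  apply: (@reduction_of_relation _ maxI (@maximal_is_ideal R n) (@maximal_local R n)
    m (njets n m S).+1 (fun i => germ (f i)) (fun i => cgerm n (c 0 i))
    (fun e i => digit n m S e i) (fun e => cgerm n (b e)) jj
    (cgerm n (\sum_(e | deg e == jj) b e * y ^+ e)^-1) (cgerm n y^-1)).
  - by rewrite c00; exact: cgerm_unit.
  - rewrite -[RHS](cgerm_unit n by0); congr (_ * _).
    rewrite rmorph_sum; apply: eq_bigr => e _; rewrite rmorphM /=; congr (_ * _).
    (* The monomial with exponents the digits of [e] takes the value [y ^+ e] at [c], by
       [digit_sum]. *)
    under eq_bigr do rewrite -rmorphXn /= mxE -exprM mulnC.
    by rewrite -rmorph_prod /= -expr_sum digit_sum.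
  - exact: hb.
have compE t : component_ideal (fun x => proj_along c (G (x, t))) =
    ideal_gen (range (fun i : 'I_m => germ (fun x =>
      c 0 ord0 * g (lift ord0 i) (x, t) - c 0 (lift ord0 i) * g ord0 (x, t)))).
  rewrite /component_ideal (_ : (fun i : 'I_m => _) = (fun i : 'I_m => germ (fun x =>
      c 0 ord0 * g (lift ord0 i) (x, t) - c 0 (lift ord0 i) * g ord0 (x, t))))//.
  by apply/funext => i; congr germ; apply/funext => x; rewrite mxE.
have red0 : reduction (component_ideal (fun x => proj_along c (G (x, 0))))
    (component_ideal (fun x => G (x, 0))).
  have [d d0 hd] := (nbhs_nrP _ _).1 (relr' _ Q'y).
  have [t t0 td] := small_neq0 d0.
  have [|b [bn0 hb]] := hd t _ t0; first by rewrite subr0.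
  have hgz i : holomorphic_near0 (fun x : X => g i (x, 0)).
    exact: nbhs_singleton (holo_slice (hg i)).
  rewrite compE; exact: (@main (fun i x => g i (x, 0)) j' b hgz bn0 hb).
have hgt : \forall t \near (0 : C), forall i, holomorphic_near0 (fun x : X => g i (x, t)).
  by apply: near_forall => i; exact: holo_slice.
apply: filterS2 (relr _ Qy) hgt => t ht {}hgt.
have [->|t0] := eqVneq t 0; first exact: red0.
have [b [bn0 hb]] := ht t0.
by rewrite compE; exact: (@main (fun i x => g i (x, t)) j b hgt bn0 hb).
Qed.

Lemma component_ideal_linear k l (G : X -> 'rV[C]_k) (p : {linear 'rV[C]_k -> 'rV[C]_l}) :
  (forall i, holomorphic_near0 (fun x => G x 0 i)) ->
  component_ideal (fun x => p (G x)) `<=` component_ideal G.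
Proof.
move=> hG; apply: ideal_gen_min; first exact: ideal_gen_ideal.
move=> _ [i _ <-].
have -> : (fun x => p (G x) 0 i) = (fun x => \sum_j p (delta_mx 0 j) 0 i * G x 0 j).
  apply/funext => x; rewrite {1}[G x]row_sum_delta linear_sum summxE.
  by apply: eq_bigr => j _; rewrite linearZ mxE mulrC.
rewrite germ_lincomb//; apply: (is_ideal_sum _ (ideal_gen_ideal _)) => j _.
by apply: (is_idealMl _ (ideal_gen_ideal _)); apply: sub_ideal_gen; exists j.
Qed.

(** Induction on [m]: as long as [m > n] one generator is projected away, and the projections
    compose since reductions are transitive. *)
Lemma exists_reduction m s (G : V -> 'rV[C]_m) :
  (forall i, holomorphic_near0 (fun z => G z 0 i)) ->
  (\forall t \near (0 : C), G (0, t) = 0) ->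
  (forall i, component_ideal (fun x => G (x, 0)) (xgerm R i ^+ s)) ->
  exists p : {linear 'rV[C]_m -> 'rV[C]_n}, \forall t \near (0 : C),
    reduction (component_ideal (fun x => p (G (x, t))))
              (component_ideal (fun x => G (x, t))).
Proof.
have small k (F : V -> 'rV[C]_k) : (k <= n)%N ->
    (forall i, holomorphic_near0 (fun z => F z 0 i)) ->
    exists p : {linear 'rV[C]_k -> 'rV[C]_n}, \forall t \near (0 : C),
    reduction (component_ideal (fun x => p (F (x, t))))
              (component_ideal (fun x => F (x, t))).
  (* With at most [n] components, padding by zeros has a linear left inverse, so the ideal does not
     change. *)
  move=> kn hF; exists (mulmxr (pid_mx k : 'M[C]_(k, n))).
  have hFt : \forall t \near (0 : C), forall i, holomorphic_near0 (fun x : X => F (x, t) 0 i).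
    by apply: near_forall => i; exact: holo_slice (hF i).
  apply: filterS hFt => t {}hFt.
  suff -> : component_ideal (fun x => mulmxr (pid_mx k : 'M[C]_(k, n)) (F (x, t))) =
            component_ideal (fun x => F (x, t)).
    by apply: reduction_refl; exact: ideal_gen_ideal.
  apply/seteqP; split; first exact: component_ideal_linear.
  have -> : (fun x => F (x, t)) = (fun x =>
      mulmxr (pid_mx k : 'M[C]_(n, k)) (mulmxr (pid_mx k : 'M[C]_(k, n)) (F (x, t)))).
    by apply/funext => x; rewrite /= -mulmxA pid_mx_id// pid_mx_1 mulmx1.
  apply: (@component_ideal_linear _ _ (fun x => mulmxr (pid_mx k : 'M[C]_(k, n)) (F (x, t)))
    (mulmxr (pid_mx k : 'M[C]_(n, k)))) => i.
  under eq_fun do rewrite /= mxE.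
  by apply: holo_sum => j; apply: holoM => //; exact: holo_cst.
elim: m s G => [|m ih] s G hG G0 hs; first exact: small.
have [mn|nm] := leqP m.+1 n; first exact: small.
have [p pred] := reduction_step nm hG G0 hs.
have pE z i : p (G z) 0 i = \sum_j p (delta_mx 0 j) 0 i * G z 0 j.
  by rewrite {1}[G z]row_sum_delta linear_sum summxE;
    apply: eq_bigr => j _; rewrite linearZ mxE mulrC.
have hpG i : holomorphic_near0 (fun z => p (G z) 0 i).
  by under eq_fun do rewrite pE; apply: holo_sum => j; exact: holoZ.
have pG0 : \forall t \near (0 : C), p (G (0, t)) = 0.
  by apply: filterS G0 => t ->; rewrite linear0.
have red0 := nbhs_singleton pred.
have /choice[k hk] : forall i, exists k,
    component_ideal (fun x => p (G (x, 0))) ((xgerm R i ^+ s) ^+ k).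
  by move=> i; apply: (reduction_pow _ red0 (hs i)); exact: ideal_gen_ideal.
(* The exponent grows at each step but is needed at [t = 0] only, where finitely many variables
   allow a common bound. *)
have hs' i : component_ideal (fun x => p (G (x, 0))) (xgerm R i ^+ (s * \max_i k i)).
  rewrite exprM -(subnK (leq_bigmax i : (k i <= \max_i k i)%N)) exprD.
  exact: (is_idealMl _ (ideal_gen_ideal _) (hk i)).
have [p' pred'] := ih _ (fun z => p (G z)) hpG pG0 hs'.
exists (p' \o p : {linear _ -> _}).
by apply: filterS2 pred' pred => t; exact: reduction_trans.
Qed.

End Step.

Theorem theorem3 (R : realType) (n m : nat)
    (F : 'rV[R[i]]_n * R[i] -> 'rV[R[i]]_m)
    (F_holo : holomorphic_near0 F) (F0 : F (0, 0) = 0)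
    (F_prim : \forall t \near (0 : R[i]),
       primary_to (maximal_ideal R n) (component_ideal (fun x => F (x, t)))) :
  exists p : {linear 'rV[R[i]]_m -> 'rV[R[i]]_n},
    \forall t \near (0 : R[i]),
      reduction (component_ideal (fun x => p (F (x, t))))
                (component_ideal (fun x => F (x, t))).
Proof.
have hF i : holomorphic_near0 (fun z => F z 0 i) by exact: holo_component.
(* The given equation concerns the origin only; along the [t]-axis the components vanish at [x = 0]
   because they lie in the radical, which is the maximal ideal. *)
have Ft0 : \forall t \near (0 : R[i]), F (0, t) = 0.
  have hFt : \forall t \near (0 : R[i]), forall i,
      holomorphic_near0 (fun x : 'rV[R[i]]_n => F (x, t) 0 i).
    by apply: near_forall => i; exact: holo_slice (hF i).
  apply: filterS2 F_prim hFt => t [_ rad] hFt; apply/rowP => i; rewrite mxE.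
  apply/(mem_maximal (hFt i)); rewrite -rad; exists 1%N; rewrite expr1.
  by apply: sub_ideal_gen; exists i.
have [_ rad0] := nbhs_singleton F_prim.
(* The variables lie in the maximal ideal, which is the radical of the ideal at [t = 0]. *)
have /choice[k hk] : forall i : 'I_n, exists k,
    component_ideal (fun x => F (x, 0)) (xgerm R i ^+ k).
  by move=> i; have := xgerm_maximal R i; rewrite -rad0.
apply: (@exists_reduction R n m (\max_i k i) F hF Ft0) => i.
rewrite -(subnK (leq_bigmax i : (k i <= \max_i k i)%N)) exprD.
exact: (is_idealMl _ (ideal_gen_ideal _) (hk i)).
Qed.
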